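(* For every Borel set $G\subseteq\mathbb R^{N^2+N}$, with $\mathbb P$-probability one, $$\limsup_{t\to\infty}\frac1t\log Q_t^\omega(G)\le-\inf_{x\in\overline G}I(x),\qquad \liminf_{t\to\infty}\frac1t\log Q_t^\omega(G)\ge-\inf_{x\in G^{\circ}}I(x),$$ where $\overline G$, $G^\circ$ are the closure and interior of $G$, and the rate function $I:\mathbb R^{N^2+N}\to[0,+\infty]$ is $$I(\theta,\xi)=\begin{cases}\log\rho_0-H(\theta)+J_\theta(\xi),&\text{if }\theta\in\Delta\text{ and }H(\theta)\ge J_\theta(\xi),\\ +\infty,&\text{otherwise.}\end{cases}$$
   Context: Let $V=\{1,\dots,N\}$, $P$ a row-stochastic irreducible aperiodic $N\times N$ matrix with stationary distribution $\pi>0$, $E=\{(i,j):P_{ij}>0\}$, $P_0$ the 0-1 matrix with $(P_0)_{ij}=1$ iff $P_{ij}>0$, $\rho_0$ its spectral radius. $\mathcal S^t=\{s^t\in V^t:\pi_{s_1}\prod_{k<t}P_{s_ks_{k+1}}>0\}$, $C_t=|\mathcal S^t|$. Circular transition counts $K_{ij}(s^t)=|\{1\le k\le t:s_k=i,s_{k+1}=j\}|$ with $s_{t+1}:=s_1$, and $\Theta_t(s^t)=K(s^t)/t\in\mathbb R^{N\times N}$. $\Delta=\{\theta\in\mathbb R^{N\times N}:\theta_{ij}\ge0,\ \sum_{i,j}\theta_{ij}=1,\ \sum_j\theta_{ij}=\sum_j\theta_{ji}\ \forall i,\ \theta_{ij}=0\text{ if }(i,j)\notin E\}$; $\overline\theta=\theta\mathbf1$.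 $H(\theta)=-\sum_{i,j}\theta_{ij}\log(\theta_{ij}/\overline\theta_i)$ ($0\log0=0$). For $\theta\in\mathbb R^{N\times N}$, $J_\theta(\xi)=\sum_{i:\overline\theta_i>0}\frac{1}{\overline\theta_i}\frac{\xi_i^2}{2}$ if $\xi_i=0$ for every $i$ with $\overline\theta_i=0$, and $J_\theta(\xi)=+\infty$ otherwise. On a probability space $(\Omega,\mathcal F,\mathbb P)$ let, for each $t\ge1$ and each $s^t\in\mathcal S^t$, $Z_{s^t}=(Z_{s^t,1},\dots,Z_{s^t,t})$ be a vector of i.i.d. $\mathcal N(0,1)$ variables, with all these vectors (over all $s^t$ and all $t$) mutually independent. Define $\mathcal Z_t^\omega(s^t)\in\mathbb R^N$ by $\mathcal Z^\omega_{t,i}(s^t)=\frac1t\sum_{k\le t:s_k=i}Z_{s^t,k}(\omega)$ (equal to $0$ if no $k$ has $s_k=i$). The empirical measure is $Q_t^\omega(B)=\frac{1}{C_t}\big|\{s^t\in\mathcal S^t:(\Theta_t(s^t),\mathcal Z_t^\omega(s^t))\in B\}\big|$ for Borel $B\subseteq\mathbb R^{N^2+N}$. Convention $\log0=-\infty$. *)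

(* Defs.v *)
From HB Require Import structures.
From mathcomp Require Import all_boot all_order all_algebra.
From mathcomp Require Import all_classical all_reals all_analysis.
From mathcomp Require Import complex.

Set Implicit Arguments.
Unset Strict Implicit.
Unset Printing Implicit Defensive.

Import Order.TTheory GRing.Theory Num.Theory.

Import numFieldNormedType.Exports.
Local Open Scope classical_set_scope.
Local Open Scope ring_scope.

Definition row_stochastic (R : realType) (N : nat) (P : 'M[R]_N) : Prop :=
  (forall i j, 0 <= P i j) /\ (forall i, \sum_(j < N) P i j = 1).

Definition irreducible (R : realType) (N : nat) (P : 'M[R]_N) : Prop :=
  forall i j : 'I_N, exists k : nat, 0 < (P ^+ k) i j.

Definition aperiodic (R : realType) (N : nat) (P : 'M[R]_N) : Prop :=
  forall (i : 'I_N) (d : nat),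
    (forall k : nat, (0 < k)%N -> 0 < (P ^+ k) i i -> (d %| k)%N) -> d = 1%N.

Definition stationary_distribution (R : realType) (N : nat)
    (P : 'M[R]_N) (pi : 'rV[R]_N) : Prop :=
  (forall i, 0 <= pi 0 i) /\ \sum_(i < N) pi 0 i = 1 /\ pi *m P = pi.

Definition zero_one_mx (R : realType) (N : nat) (P : 'M[R]_N) : 'M[R]_N :=
  \matrix_(i, j) (if 0 < P i j then 1 else 0).

Definition spectral_radius (R : realType) (N : nat) (A : 'M[R]_N) : R :=
  sup [set r : R | exists l : R[i],
         eigenvalue (map_mx (fun x : R => (x%:C)%C) A) l /\ `|l| = (r%:C)%C].

Fixpoint path_prod (R : realType) (N : nat) (P : 'M[R]_N) (x : 'I_N)
    (s : seq 'I_N) : R :=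
  match s with
  | [::] => 1
  | y :: s' => P x y * path_prod P y s'
  end.

Definition path_weight (R : realType) (N : nat) (pi : 'rV[R]_N) (P : 'M[R]_N)
    (s : seq 'I_N) : R :=
  match s with
  | [::] => 0
  | x :: s' => pi 0 x * path_prod P x s'
  end.

Definition inS (R : realType) (N : nat) (pi : 'rV[R]_N) (P : 'M[R]_N)
    (t : nat) (s : t.-tuple 'I_N) : bool :=
  0 < path_weight pi P s.

Definition Ct (R : realType) (N : nat) (pi : 'rV[R]_N) (P : 'M[R]_N)
    (t : nat) : nat :=
  #|[set s : t.-tuple 'I_N | inS pi P s]|.

(* circular transition counts K_ij(s) = #{1<=k<=t : s_k = i, s_{k+1} = j},
   with s_{t+1} := s_1 *)
Definition Kcount (N : nat) (s : seq 'I_N) (i j : 'I_N) : nat :=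
  count (pred1 (i, j)) (zip s (rot 1 s)).

Definition Theta (R : realType) (N : nat) (t : nat) (s : t.-tuple 'I_N)
    : 'M[R]_N :=
  \matrix_(i, j) ((Kcount s i j)%:R / t%:R).

(* index set of the Gaussian family: pairs (s^t, k) with k : 'I_t
   standing for the index k+1 in {1,...,t} *)
Definition Zindex (N : nat) : Type := {t : nat & (t.-tuple 'I_N * 'I_t)%type}.

Definition Zfam (d : measure_display) (Omega : measurableType d) (R : realType)
    (N : nat) (Z : forall t : nat, t.-tuple 'I_N -> 'I_t -> Omega -> R)
    (a : Zindex N) : Omega -> R :=
  Z (tag a) (tagged a).1 (tagged a).2.

(* the indices actually used: s^t \in S^t (t >= 1 since 'I_t is inhabited) *)
Definition Zdom (R : realType) (N : nat) (pi : 'rV[R]_N) (P : 'M[R]_N)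
    : set (Zindex N) :=
  [set a | inS pi P (tagged a).1].

Definition Zcal (d : measure_display) (Omega : measurableType d) (R : realType)
    (N : nat) (Z : forall t : nat, t.-tuple 'I_N -> 'I_t -> Omega -> R)
    (t : nat) (s : t.-tuple 'I_N) (omega : Omega) : 'rV[R]_N :=
  \row_i ((t%:R)^-1 * \sum_(k < t | tnth s k == i) Z t s k omega).

Definition Qemp (d : measure_display) (Omega : measurableType d)
    (R : realType) (N : nat) (pi : 'rV[R]_N) (P : 'M[R]_N)
    (Z : forall t : nat, t.-tuple 'I_N -> 'I_t -> Omega -> R)
    (t : nat) (omega : Omega) (B : set ('M[R]_N * 'rV[R]_N)) : R :=
  (#|[set s : t.-tuple 'I_N |
        inS pi P s && `[< B (Theta R s, Zcal Z s omega) >] ]|)%:R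
  / (Ct pi P t)%:R.

Definition elog (R : realType) (x : R) : \bar R :=
  if x == 0 then -oo%E else (ln x)%:E.

Definition simplexDelta (R : realType) (N : nat) (P : 'M[R]_N)
    : set 'M[R]_N :=
  [set theta | (forall i j, 0 <= theta i j)
     /\ \sum_(i < N) \sum_(j < N) theta i j = 1
     /\ (forall i, \sum_(j < N) theta i j = \sum_(j < N) theta j i)
     /\ (forall i j, ~~ (0 < P i j) -> theta i j = 0)].

Definition thetabar (R : realType) (N : nat) (theta : 'M[R]_N) (i : 'I_N) : R :=
  \sum_(j < N) theta i j.

Definition entropyH (R : realType) (N : nat) (theta : 'M[R]_N) : R :=
  - \sum_(i < N) \sum_(j < N)
      (if theta i j == 0 then 0
       else theta i j * ln (theta i j / thetabar theta i)).

Definition Jfun (R : realType) (N : nat) (theta : 'M[R]_N) (xi : 'rV[R]_N)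
    : \bar R :=
  if [forall i, (thetabar theta i == 0) ==> (xi 0 i == 0)] then
    (\sum_(i < N | 0 < thetabar theta i)
        (thetabar theta i)^-1 * (xi 0 i ^+ 2 / 2))%:E
  else +oo%E.

Definition rateI (R : realType) (N : nat) (P : 'M[R]_N)
    (x : 'M[R]_N * 'rV[R]_N) : \bar R :=
  let theta := x.1 in let xi := x.2 in
  if `[< simplexDelta P theta >] && ((Jfun theta xi) <= (entropyH theta)%:E)%E
  then ((ln (spectral_radius (zero_one_mx P)) - entropyH theta)%:E
        + Jfun theta xi)%E
  else +oo%E.

Definition borel_set (T : topologicalType) (A : set T) : Prop :=
  <<s open >> A.

Definition std_normal_rv (d : measure_display) (Omega : measurableType d)
    (R : realType) (Pr : probability Omega R) (X : Omega -> R) : Prop :=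
  measurable_fun setT X /\
  forall B : set R, measurable B -> Pr (X @^-1` B) = normal_prob 0 1 B.

Definition mutually_independent (d : measure_display) (Omega : measurableType d)
    (R : realType) (Pr : probability Omega R) (I : eqType) (D : set I)
    (X : I -> Omega -> R) : Prop :=
  forall (J : seq I) (B : I -> set R),
    uniq J -> (forall a, a \in J -> D a) -> (forall a, measurable (B a)) ->
    Pr (\bigcap_(a in [set` J]) (X a @^-1` B a))
    = \big[*%E/1%E]_(a <- J) Pr (X a @^-1` B a).

(* Main.v *)
(* Let L = log rho_0; by Perron-Frobenius C_t lies between two multiples of
   exp(t L).

   Upper bound: for F with \sum_j exp(F_ij) <= 1 and a vector l, the linear function
   Phi(theta, xi) = \sum theta_ij F_ij + l.xi - \sum l_i^2 bar(theta)_i / 2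
   satisfies E \sum_s exp(t Phi(Theta(s), Z(s))) <= N, so by Borel-Cantelli the number
   of s with Phi > h is almost surely at most exp(-t (h - eps)) eventually. Optimizing
   over F and l gives J - H at each point; when this is positive the number is
   eventually < 1, hence 0, which is why the rate function is infinite on H < J.
   Compactness and exponential tightness finish the upper bound.

   Lower bound: it suffices to treat theta positive on every edge and J < H (or
   H = 0, xi = 0). About exp(t H) paths have Theta(s) near theta, each has Z(s) near xi
   with probability at least exp(-t (J + eps)), and distinct paths are independent, so
   a second moment estimate and Borel-Cantelli give exp(t (H - J - eps)) good paths. *)

Require Import Defs.
From HB Require Import structures.
From mathcomp Require Import all_boot all_order all_algebra.
From mathcomp Require Import all_classical all_reals all_analysis.
From mathcomp Require Import measurable_realfun complex ring lra.

Set Implicit Arguments.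
Unset Strict Implicit.
Unset Printing Implicit Defensive.

Import Order.TTheory GRing.Theory Num.Theory.
Import numFieldNormedType.Exports.
Local Open Scope classical_set_scope.
Local Open Scope ring_scope.

(** * Paths and circular transition counts *)

(** Three obstacles shape the argument. (1) Every almost sure bound has its own null set, so the
    optimization over F and l cannot take place inside one event. Exponential decay is therefore
    made a property of a set that is stable under finite unions, compactness is applied to that
    property, and at the end only rational thresholds are used. (2) Closing the path makes the
    frequencies exactly balanced, but the closing edge may lie outside E, so Theta(s) can miss Delta
    by 1/t; this edge costs only a bounded factor. (3) The variance of the number of good paths is
    at most its mean, so concentration needs the mean to grow exponentially, that is J < H. Mixing
    theta with the pair law pi_i P_ij while shrinking xi faster than theta turns J <= H into J < H,
    except when H = 0 and xi = 0. The same mixing makes theta positive on every edge; its kernel is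
    then irreducible with theta as its only stationary pair law, which is why the chain with that
    kernel concentrates at theta. *)

Section Paths.
Context (R : realType) (N : nat).
Implicit Types (Q : 'M[R]_N) (F : 'I_N -> 'I_N -> R).

Lemma big_tuple_cons (V : nmodType) (T : finType) (t : nat) (F : t.+1.-tuple T -> V) :
  \sum_(s : t.+1.-tuple T) F s = \sum_(x : T) \sum_(s : t.-tuple T) F [tuple of x :: s].
Proof.
rewrite pair_big /=.
rewrite (reindex (fun p : T * t.-tuple T => [tuple of p.1 :: p.2])) //=.
exists (fun s => (thead s, [tuple of behead s])).
- by case=> x s _ /=; congr pair; apply/val_inj.
- by move=> s _ /=; rewrite -tuple_eta.
Qed.

Lemma sum_Kcount (F : 'I_N -> 'I_N -> R) (s : seq 'I_N) :
  \sum_i \sum_j (Kcount s i j)%:R * F i j =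
  \sum_(p <- zip s (rot 1 s)) F p.1 p.2.
Proof.
rewrite /Kcount; elim: (zip s (rot 1 s)) => [|[a b] l IH] /=.
  by rewrite big_nil big1// => i _; rewrite big1// => j _; rewrite mul0r.
rewrite big_cons -IH /=.
under eq_bigr do under eq_bigr do rewrite natrD mulrDl.
under eq_bigr do rewrite big_split.
rewrite big_split; congr (_ + _).
rewrite (bigD1 a)//= (bigD1 b)//= eqxx mul1r big1 ?addr0; last first.
  by move=> j jb; rewrite xpair_eqE eqxx/= eq_sym (negbTE jb) mul0r.
rewrite big1 ?addr0// => i ia; rewrite big1// => j _.
by rewrite xpair_eqE eq_sym (negbTE ia) mul0r.
Qed.

Lemma zip_rot1 (T : Type) (x : T) s : zip (x :: s) (rot 1 (x :: s)) = zip (x :: s) (rcons s x).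
Proof. by rewrite rot1_cons. Qed.

Lemma zip_rcons_cons (T : Type) (x y : T) s :
  zip (x :: s) (rcons s y) = rcons (zip (x :: s) s) (last x s, y).
Proof. by elim: s x => [|z s IH] x //=; rewrite -IH. Qed.

Lemma path_prod_ge0 Q x s : (forall i j, 0 <= Q i j) -> 0 <= path_prod Q x s.
Proof. by move=> Q0; elim: s x => [|y s IH] x //=; rewrite mulr_ge0. Qed.

Lemma path_prod_gt0 Q x s : (forall i j, 0 <= Q i j) ->
  (0 < path_prod Q x s) = path (fun i j => 0 < Q i j) x s.
Proof.
move=> Q0; elim: s x => [|y s IH] x /=; first exact: ltr01.
by rewrite -IH !lt_def mulf_eq0 negb_or !mulr_ge0 ?path_prod_ge0 ?Q0 ?andbT//= andbC.
Qed.

Lemma path_prod_expR F x s :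
  path_prod (\matrix_(i, j) expR (F i j)) x s =
  expR (\sum_(p <- zip (x :: s) s) F p.1 p.2).
Proof.
elim: s x => [|y s IH] x /=; first by rewrite big_nil expR0.
by rewrite big_cons IH mxE expRD.
Qed.

Lemma sum_path_prod_le Q (t : nat) x : (forall i j, 0 <= Q i j) ->
  (forall i, \sum_j Q i j <= 1) -> \sum_(s : t.-tuple 'I_N) path_prod Q x s <= 1.
Proof.
move=> Q0 Q1; elim: t x => [|t IH] x.
  rewrite (eq_bigr (fun=> 1)) ?sumr_const ?card_tuple ?expn0//.
  by move=> s _; rewrite (tuple0 s).
rewrite big_tuple_cons (le_trans _ (Q1 x))// ler_sum// => y _ /=.
by rewrite -mulr_sumr ler_piMr.
Qed.

Lemma sum_path_prod_eq Q (t : nat) x :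
  (forall i, \sum_j Q i j = 1) -> \sum_(s : t.-tuple 'I_N) path_prod Q x s = 1.
Proof.
move=> Q1; elim: t x => [|t IH] x.
  rewrite (eq_bigr (fun=> 1)) ?sumr_const ?card_tuple ?expn0//.
  by move=> s _; rewrite (tuple0 s).
rewrite big_tuple_cons -[RHS](Q1 x); apply: eq_bigr => y _ /=.
by rewrite -mulr_sumr IH mulr1.
Qed.

(** Once the first vertex is fixed, the open path carries a product of substochastic weights, of
    total at most 1. The hypothesis forces F i j <= 0, so the closing edge contributes a factor at
    most 1; N counts the first vertices. *)
Lemma sum_expR_Kcount_le F (t : nat) : (forall i, \sum_j expR (F i j) <= 1) ->
  \sum_(s : t.+1.-tuple 'I_N) expR (\sum_i \sum_j (Kcount s i j)%:R * F i j) <= N%:R.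
Proof.
move=> F1; have F0 i j : F i j <= 0.
  rewrite -ler_expR expR0 (le_trans _ (F1 i))// (bigD1 j)//= lerDl sumr_ge0 ?expR_ge0//.
rewrite big_tuple_cons (le_trans (y := \sum_(x < N) 1))//; last first.
  by rewrite sumr_const card_ord.
apply: ler_sum => x _.
have := @sum_path_prod_le (\matrix_(i, j) expR (F i j)) t x.
move=> /(_ _ _)/(le_trans _); apply; last 2 first.
- by move=> i j; rewrite mxE expR_ge0.
- by move=> i; under eq_bigr do rewrite mxE; exact: F1.
apply: ler_sum => s _; rewrite path_prod_expR ler_expR sum_Kcount zip_rot1.
by rewrite zip_rcons_cons -cats1 big_cat big_seq1 /= gerDl.
Qed.

Lemma sum_Kcountr (s : seq 'I_N) i : (\sum_j Kcount s i j = count_mem i s)%N.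
Proof.
apply/eqP; rewrite -(@eqr_nat R) natr_sum.
have -> : \sum_j ((Kcount s i j)%:R : R) = \sum_a \sum_b (Kcount s a b)%:R * (a == i)%:R.
  rewrite [RHS](bigD1 i)//= [X in _ + X]big1 ?addr0; last first.
    by move=> a /negbTE ->; rewrite big1// => b _; rewrite mulr0.
  by apply: eq_bigr => j _; rewrite eqxx mulr1.
rewrite sum_Kcount -sum1_count natr_sum/=.
rewrite -[in eqbRHS](@unzip1_zip _ _ s (rot 1 s)) ?size_rot// big_map.
by rewrite [eqbRHS]big_mkcond; apply/eqP/eq_bigr => p _; case: eqP.
Qed.

(** The second ends of the edges form [rot 1 s], a permutation of [s]: this is how closing the path
    balances the counts. *)
Lemma sum_Kcountl (s : seq 'I_N) j : (\sum_i Kcount s i j = count_mem j s)%N.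
Proof.
apply/eqP; rewrite -(@eqr_nat R) natr_sum.
have -> : \sum_i ((Kcount s i j)%:R : R) = \sum_a \sum_b (Kcount s a b)%:R * (b == j)%:R.
  apply: eq_bigr => i _; rewrite (bigD1 j)//= eqxx mulr1 big1 ?addr0// => b /negbTE ->.
  by rewrite mulr0.
rewrite sum_Kcount.
rewrite -(seq.permP (permEl (perm_rot 1 s))) -sum1_count natr_sum/=.
rewrite -[in eqbRHS](@unzip2_zip _ _ s (rot 1 s)) ?size_rot// big_map.
by rewrite [eqbRHS]big_mkcond; apply/eqP/eq_bigr => p _; case: eqP.
Qed.

Lemma thetabar_Theta (t : nat) (s : t.-tuple 'I_N) i :
  thetabar (Theta R s) i = (count_mem i s)%:R / t%:R.
Proof.
by rewrite /thetabar -sum_Kcountr natr_sum mulr_suml; apply: eq_bigr => j _; rewrite mxE.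
Qed.

Lemma Theta_balanced (t : nat) (s : t.-tuple 'I_N) i :
  \sum_j Theta R s i j = \sum_j Theta R s j i.
Proof.
rewrite -[LHS]/(thetabar _ _) thetabar_Theta -sum_Kcountl natr_sum mulr_suml.
by apply: eq_bigr => j _; rewrite mxE.
Qed.

Lemma sum_Theta (t : nat) (s : t.-tuple 'I_N) F :
  t%:R * (\sum_i \sum_j Theta R s i j * F i j) =
  \sum_i \sum_j (Kcount s i j)%:R * F i j.
Proof.
rewrite mulr_sumr; apply: eq_bigr => i _; rewrite mulr_sumr; apply: eq_bigr => j _.
rewrite mxE; case: t s => [s|t s]; last by rewrite mulrA mulrCA mulfV ?pnatr_eq0 ?mulr1.
by rewrite mul0r (tuple0 s) /Kcount/= mul0r.
Qed.

Lemma Theta_ge0 (t : nat) (s : t.-tuple 'I_N) i j : 0 <= Theta R s i j.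
Proof. by rewrite mxE divr_ge0. Qed.

Lemma Theta_sum1 (t : nat) (s : t.+1.-tuple 'I_N) : \sum_i \sum_j Theta R s i j = 1.
Proof.
have := sum_Theta s (fun _ _ => 1); rewrite sum_Kcount big_const_seq count_predT.
rewrite size_zip size_rot minnn size_tuple iter_addr addr0 => /(congr1 ( *%R t.+1%:R^-1)).
rewrite mulKf ?pnatr_eq0// mulVf ?pnatr_eq0// => <-.
by apply: eq_bigr => i _; apply: eq_bigr => j _; rewrite mulr1.
Qed.

Lemma Theta_le1 (t : nat) (s : t.-tuple 'I_N) i j : Theta R s i j <= 1.
Proof.
case: t s => [s|t s]; first by rewrite mxE (tuple0 s) /Kcount/= mul0r ler01.
rewrite -(Theta_sum1 s) (bigD1 i)//= (bigD1 j)//= -addrA lerDl addr_ge0 ?sumr_ge0// => k _.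
  exact: Theta_ge0.
by rewrite sumr_ge0// => l _; exact: Theta_ge0.
Qed.

Context (P : 'M[R]_N) (pi : 'rV[R]_N).
Hypotheses (P0 : forall i j, 0 <= P i j) (pi0 : forall i, 0 < pi 0 i).

Lemma inS_cons (t : nat) (x : 'I_N) (s : t.-tuple 'I_N) :
  inS pi P [tuple of x :: s] = path (fun i j => 0 < P i j) x s.
Proof. by rewrite /inS /= -path_prod_gt0// pmulr_rgt0. Qed.

Lemma inS0 (s : 0.-tuple 'I_N) : inS pi P s = false.
Proof. by rewrite (tuple0 s) /inS/= ltxx. Qed.

Lemma path_zip (T : eqType) (e : rel T) x s :
  path e x s = all (fun p => e p.1 p.2) (zip (x :: s) s).
Proof. by elim: s x => [|y s IH] x //=; rewrite IH. Qed.

(** On an admissible path only the closing edge can leave E, so such a pair is counted at most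
    once. *)
Lemma inS_Theta_le (t : nat) (s : t.-tuple 'I_N) i j : inS pi P s -> ~~ (0 < P i j) ->
  Theta R s i j <= t%:R^-1.
Proof.
case: t s => [s|t s]; first by rewrite inS0.
rewrite (tuple_eta s) inS_cons => ps Pij.
rewrite mxE -[leRHS]mul1r ler_wpM2r ?invr_ge0 ?ler0n//.
rewrite /Kcount zip_rot1 zip_rcons_cons -cats1 count_cat /= addn0.
rewrite (_ : count _ _ = 0%N) ?add0n; first by case: (_ == _); rewrite ?ler01.
apply/eqP; rewrite -leqn0 leqNgt -has_count; apply/hasP => -[p pin /eqP pE].
by move: ps; rewrite path_zip => /allP/(_ _ pin); rewrite pE (negbTE Pij).
Qed.

End Paths.

(** * Perron eigenvector and growth of C_t *)

Section Perron.
Context (R : realType).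

Lemma mulmx_gt0 (N : nat) (x : 'rV[R]_N) (B : 'M[R]_N) :
  (forall j, 0 <= x 0 j) -> x != 0 -> (forall i j, 0 < B i j) ->
  forall j, 0 < (x *m B) 0 j.
Proof.
move=> x0 xn0 B0 j; rewrite mxE.
have [i xi] : exists i, 0 < x 0 i.
  apply/existsP; apply: contraNT xn0; rewrite negb_exists => /forallP h.
  apply/eqP/rowP => i; rewrite mxE; apply/eqP; rewrite eq_le x0 andbT leNgt; exact: h.
by rewrite (bigD1 i)//= ltr_wpDr ?mulr_gt0// sumr_ge0// => k _; rewrite mulr_ge0// ltW.
Qed.

Lemma exprM_ge0 (N : nat) (A : 'M[R]_N) k : (forall i j, 0 <= A i j) ->
  forall i j, 0 <= (A ^+ k) i j.
Proof.
move=> A0; elim: k => [|k IH] i j; first by rewrite expr0 mxE ler0n.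
by rewrite exprS mxE sumr_ge0// => l _; rewrite mulr_ge0.
Qed.

Lemma sum_exprM_gt0 (N : nat) (A : 'M[R]_N) : (forall i j, 0 <= A i j) ->
  (forall i j, exists k, 0 < (A ^+ k) i j) ->
  exists K, forall i j, 0 < (\sum_(k < K) A ^+ k) i j.
Proof.
move=> A0 irr.
have [f fP] := choice (fun p : 'I_N * 'I_N => irr p.1 p.2).
exists (\max_p f p).+1 => i j; rewrite summxE.
have lt : (f (i, j) < (\max_p f p).+1)%N by rewrite ltnS (leq_bigmax (i, j)).
rewrite (bigD1 (Ordinal lt))//= ltr_wpDr ?(fP (i, j))// sumr_ge0// => k _.
exact: exprM_ge0.
Qed.

Lemma continuous_sum_fun (T : topologicalType) (I : finType) (f : I -> T -> R) :
  (forall i, continuous (f i)) -> continuous (fun x => \sum_i f i x).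
Proof.
by move=> fc; apply: continuous_big => [|i _]; [exact: add_continuous|exact: fc].
Qed.

(* Collatz-Wielandt: r is the largest number with r x <= x A for some x in the
   simplex; if the inequality were not an equality, multiplying by the positive
   matrix B = \sum_k A^k, which commutes with A, would allow a larger r. *)
Lemma perron_eigenvector (n : nat) (A : 'M[R]_n.+1) :
  (forall i j, 0 <= A i j) -> (forall i j, exists k, 0 < (A ^+ k) i j) ->
  exists (r : R) (u : 'rV[R]_n.+1), (forall i, 0 < u 0 i) /\ u *m A = r *: u.
Proof.
move=> A0 irr; have [K BK] := sum_exprM_gt0 A0 irr.
set B := \sum_(k < K) A ^+ k in BK.
have AB : A *m B = B *m A.
  by apply: commr_sum => k _; exact: commrX.
(* Summing r x_j <= (x A)_j over j, with x in the simplex, gives r <= M, so the constraint set is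
   bounded. *)
pose M := \sum_i \sum_j A i j.
pose S := [set p : R * 'rV[R]_n.+1 | `[0, M]%classic p.1 /\
   (forall i, `[0, 1]%classic (p.2 0 i)) /\ \sum_i p.2 0 i = 1 /\
   forall j, p.1 * p.2 0 j <= (p.2 *m A) 0 j].
have cS : compact S.
  have cB : compact (`[0, M]%classic `*` [set x : 'rV[R]_n.+1 | forall i, `[0, 1]%classic (x 0 i)]).
    by apply: compact_setX; [exact: segment_compact|apply: (@rV_compact R _ (fun=> `[0, 1]%classic)) => i; exact: segment_compact].
  have c2 i : continuous (fun p : R * 'rV[R]_n.+1 => p.2 0 i).
    move=> p; apply: (@continuous_comp _ _ _ snd (fun x : 'rV[R]_n.+1 => x 0 i)).
      exact: cvg_snd.
    exact: coord_continuous.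
  have : closed [set p : R * 'rV[R]_n.+1 | \sum_i p.2 0 i = 1 /\
      forall j, p.1 * p.2 0 j <= (p.2 *m A) 0 j].
    rewrite (_ : mkset _ = ((fun p : R * 'rV[R]_n.+1 => \sum_i p.2 0 i) @^-1` [set 1]) `&`
      \bigcap_j ((fun p : R * 'rV[R]_n.+1 => (p.2 *m A) 0 j - p.1 * p.2 0 j) @^-1` [set x | 0 <= x])); last first.
      apply/seteqP; split => p /= [h1 h2]; split => // j; first by move=> _; rewrite /= subr_ge0.
      by rewrite -subr_ge0; exact: h2.
    apply: closedI.
      apply: closed_comp; last exact: closed_eq.
      by move=> p _; exact: continuous_sum_fun.
    apply: closed_bigI => j _; apply: closed_comp; last exact: closed_ge.
    move=> p _; apply: cvgB; last first.
      by apply: cvgM; [exact: cvg_fst|exact: c2].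
    have cA : continuous (fun p : R * 'rV[R]_n.+1 => (p.2 *m A) 0 j).
      under eq_fun do rewrite mxE.
      by apply: continuous_sum_fun => i q; apply: cvgM; [exact: c2|exact: cvg_cst].
    exact: cA.
  move=> /(compact_closedI cB); congr compact.
  by apply/seteqP; split => p /= => [[[? ?] [? ?]]|[? [? [? ?]]]].
have nS : S !=set0.
  exists (0, delta_mx 0 0); split => /=.
    by rewrite in_itv/= lexx sumr_ge0// => i _; exact: sumr_ge0.
  split; first by move=> i; rewrite in_itv/= mxE eqxx ler0n lern1 leq_b1.
  split => [|j].
    by rewrite (bigD1 0)//= mxE !eqxx big1 ?addr0// => i /negbTE i0; rewrite mxE i0 andbF.
  by rewrite mul0r mxE sumr_ge0// => i _; rewrite mulr_ge0// mxE ler0n.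
have c1 : continuous (fst : R * 'rV[R]_n.+1 -> R) by move=> p; exact: cvg_fst.
have [[r x]] := compact_EVT_max nS cS (continuous_subspaceT c1).
rewrite inE /S/= in_itv/= => -[/andP[r0 rM] [x01 [x1 rx]]] rmax.
have x0 i : 0 <= x 0 i by have := x01 i; rewrite in_itv/= => /andP[].
have xn0 : x != 0.
  by apply/eqP => xE; move: x1; rewrite xE big1 => [/esym/eqP|i _]; rewrite ?oner_eq0 ?mxE.
have Bx0 := mulmx_gt0 x0 xn0 BK.
exists r, (x *m B); split => //.
suff xA : x *m A = r *: x by rewrite -mulmxA -AB mulmxA xA scalemxAl.
apply/eqP; rewrite -subr_eq0; apply/negPn/negP => zn0.
pose z := x *m A - r *: x.
have z0 j : 0 <= z 0 j by have := rx j; rewrite -subr_ge0 /z !mxE.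
have Bz0 := mulmx_gt0 z0 zn0 BK.
set y := x *m B in Bx0.
have yA : y *m A = r *: y + z *m B.
  by rewrite /y /z mulmxBl -scalemxAl addrC subrK -!mulmxA AB.
(* The least ratio [eps] satisfies eps y <= z B, hence (r + eps) y <= y A, and the normalized y
   contradicts the maximality of r. *)
pose e := [arg min_(i < ord0) ((z *m B) 0 i / y 0 i)]%O.
pose eps := (z *m B) 0 e / y 0 e.
have eps0 : 0 < eps by rewrite divr_gt0.
have epsP i : eps * y 0 i <= (z *m B) 0 i.
  rewrite -ler_pdivlMr//; rewrite /eps /e; case: arg_minP => //= k _; exact.
have sy0 : 0 < \sum_i y 0 i.
  by rewrite (bigD1 ord0)//= ltr_wpDr// sumr_ge0// => i _; exact: ltW.
have : (r + eps, (\sum_i y 0 i)^-1 *: y) \in S.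
  have yS i : y 0 i / \sum_i y 0 i <= 1.
    rewrite ler_pdivrMr// mul1r (bigD1 i)//= lerDl sumr_ge0// => k _; exact: ltW.
  have y1 : \sum_i ((\sum_i y 0 i)^-1 *: y) 0 i = 1.
    by under eq_bigr do rewrite mxE; rewrite -mulr_sumr mulVf// gt_eqF.
  have yr j : (r + eps) * ((\sum_i y 0 i)^-1 *: y) 0 j <= (((\sum_i y 0 i)^-1 *: y) *m A) 0 j.
    rewrite -scalemxAl yA !mxE mulrCA ler_pM2l ?invr_gt0//.
    by have := epsP j; rewrite /y !mxE mulrDl lerD2l.
  rewrite inE; split => /=.
    rewrite in_itv/= addr_ge0 ?(ltW eps0)//=.
    rewrite -[leLHS]mulr1 -[in leLHS]y1 mulr_sumr.
    apply: (@le_trans _ _ (\sum_j (((\sum_i y 0 i)^-1 *: y) *m A) 0 j)); first exact: ler_sum.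
    rewrite /M exchange_big/= ler_sum// => j _; rewrite mxE ler_sum// => i _.
    by rewrite ler_piMl// mxE mulrC.
  split => // i; rewrite in_itv/= mxE mulrC yS andbT.
  by rewrite divr_ge0// ltW.
by move=> /rmax /=; rewrite gerDl leNgt eps0.
Qed.

End Perron.

(* The sets counted in Ct and Qemp are classical sets used as collective predicates. *)
Lemma card_mkset (T : finType) (p : pred T) : #|[set s | p s]| = #|p|.
Proof. by apply: eq_card => s; apply/idP/idP; rewrite inE. Qed.

Section Growth.
Context (R : realType) (n : nat).
Notation N := n.+1.
Local Notation C := (complex R).

(** Let w be a complex eigenvector for l, and k an index maximizing |w_k| / u_k. Then |l| |w_k| <=
    \sum_i |w_i| A_ik <= (|w_k| / u_k) \sum_i u_i A_ik = r |w_k|, so |l| <= r, and r is itself an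
    eigenvalue. *)
Lemma spectral_radius_positive_eigenvector (A : 'M[R]_N) (u : 'rV[R]_N) (r : R) :
  (forall i j, 0 <= A i j) -> (forall i, 0 < u 0 i) -> u *m A = r *: u ->
  spectral_radius A = r.
Proof.
move=> A0 u0 uA.
have r0 : 0 <= r.
  have : (u *m A) 0 0 = r * u 0 0 by rewrite uA mxE.
  rewrite mxE => rE; rewrite -(pmulr_lge0 _ (u0 0)) -rE sumr_ge0// => i _.
  by rewrite mulr_ge0// ltW.
pose iota : R -> C := fun x => (x%:C)%C.
have ub (x : R) : (exists l : C, eigenvalue (map_mx iota A) l /\ `|l| = (x%:C)%C) -> x <= r.
  move=> [l [/eigenvalueP[w wA wn0] lx]].
  rewrite -lecR -lx.
  pose a i := complex.Re `|w 0 i|.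
  have aE i : `|w 0 i| = ((a i)%:C)%C by rewrite /a normc_def.
  pose k := [arg max_(i > ord0) (a i / u 0 i)]%O.
  have kP i : a i / u 0 i <= a k / u 0 k by rewrite /k; case: arg_maxP => //= j _; exact.
  have a0 i : 0 <= a i by rewrite -(@lecR R) -aE normr_ge0.
  have ak : 0 < a k.
    rewrite lt_neqAle a0 andbT eq_sym; apply: contra_neq wn0 => ak0.
    apply/rowP => i; rewrite mxE; apply/eqP; rewrite -normr_eq0 aE.
    have := kP i; rewrite ak0 mul0r ler_pdivrMr// mul0r => ai0.
    by have /eqP -> : a i == 0 by rewrite eq_le ai0 a0.
  have le1 : `|l| * `|w 0 k| <= ((\sum_i a i * A i k)%:C)%C.
    rewrite -normrM (_ : l * w 0 k = (w *m map_mx iota A) 0 k); last by rewrite wA mxE.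
    rewrite mxE (le_trans (ler_norm_sum _ _ _))// rmorph_sum/= ler_sum// => i _.
    by rewrite normrM mxE aE rmorphM/= [`|iota _|]ger0_norm ?lecR ?A0.
  have le2 : \sum_i a i * A i k <= r * a k.
    have E : r * u 0 k = \sum_i u 0 i * A i k by have := congr1 (fun M : 'rV_N => M 0 k) uA; rewrite !mxE.
    rewrite (_ : r * a k = (a k / u 0 k) * (r * u 0 k)); last first.
      by rewrite mulrCA divfK// gt_eqF.
    rewrite E mulr_sumr ler_sum// => i _; rewrite mulrA ler_wpM2r//.
    by rewrite -ler_pdivrMr.
  rewrite -(@ler_pM2r _ `|w 0 k|); last by rewrite aE ltcR.
  rewrite (le_trans le1)// aE -rmorphM/= lecR//.
apply/eqP; rewrite eq_le; apply/andP; split.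
  apply: ge_sup.
    exists r, (r%:C)%C; split; last by rewrite normc_def/= expr0n/= addr0 sqrtr_sqr ger0_norm.
    apply/eigenvalueP; exists (map_mx iota u).
      by rewrite -map_mxM/= uA map_mxZ.
    apply/eqP => /rowP/(_ 0); rewrite !mxE => /(congr1 (@complex.Re R)) /= u00.
    by have := u0 0; rewrite u00 ltxx.
  by move=> x; exact: ub.
apply: ub_le_sup; first by exists r => x; exact: ub.
exists (r%:C)%C; split; last by rewrite normc_def/= expr0n/= addr0 sqrtr_sqr ger0_norm.
apply/eigenvalueP; exists (map_mx iota u).
  by rewrite -map_mxM/= uA map_mxZ.
apply/eqP => /rowP/(_ 0); rewrite !mxE => /(congr1 (@complex.Re R)) /= u00.
by have := u0 0; rewrite u00 ltxx.
Qed.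

Context (P : 'M[R]_N) (pi : 'rV[R]_N).
Hypotheses (P0 : forall i j, 0 <= P i j) (P1 : forall i, \sum_j P i j = 1)
  (irr : irreducible P) (pi0 : forall i, 0 < pi 0 i).

Lemma stochastic_le1 i j : P i j <= 1.
Proof. by rewrite -(P1 i) (bigD1 j)//= lerDl sumr_ge0. Qed.

Lemma path_prod_zero_one x s :
  path_prod (zero_one_mx P) x s = (path (fun i j => 0 < P i j) x s)%:R.
Proof.
elim: s x => //= y s IH x; rewrite IH mxE.
by case: ifP; rewrite ?mul1r ?mul0r.
Qed.

Lemma CtE t : (Ct pi P t.+1)%:R = \sum_x \sum_(s : t.-tuple 'I_N) path_prod (zero_one_mx P) x s.
Proof.
rewrite /Ct card_mkset -sum1_card natr_sum big_mkcond/= big_tuple_cons.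
apply: eq_bigr => x _; apply: eq_bigr => s _.
by rewrite path_prod_zero_one -(inS_cons P0 pi0) unfold_in /inS /=; case: (0 < _).
Qed.

Lemma zero_one_ge : forall i j, P i j <= zero_one_mx P i j.
Proof. by move=> i j; rewrite mxE; case: ifPn => [_|]; [exact: stochastic_le1|rewrite -leNgt]. Qed.

Lemma zero_one_ge0 i j : 0 <= zero_one_mx P i j.
Proof. exact: le_trans (zero_one_ge _ _). Qed.

Lemma zero_one_irreducible i j : exists k, 0 < (zero_one_mx P ^+ k) i j.
Proof.
have [k Pk] := irr i j; exists k; rewrite (lt_le_trans Pk)//.
elim: k i j {Pk} => [|k IH] i j; first by rewrite !expr0.
rewrite !exprS !mxE ler_sum// => l _; rewrite ler_pM//; first exact: exprM_ge0.
exact: zero_one_ge.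
Qed.

(** Weighting the number of paths that start at x by the Perron vector u_x gives exactly r^t \sum_x
    u_x, since t + 1 vertices make t edges. Bounding u_x above by \sum_j u_j and below by 1 / \sum_j
    (1 / u_j) removes the weights. That r >= 1 follows from P <= P_0 and the row sums of P. *)
Lemma Ct_growth : exists c, 1 <= spectral_radius (zero_one_mx P) /\
  forall t, spectral_radius (zero_one_mx P) ^+ t <= (Ct pi P t.+1)%:R
     <= c * spectral_radius (zero_one_mx P) ^+ t.
Proof.
have [r [u [u0 uA]]] := perron_eigenvector zero_one_ge0 zero_one_irreducible.
rewrite (spectral_radius_positive_eigenvector zero_one_ge0 u0 uA).
have r1 : 1 <= r.
  have : \sum_j (u *m zero_one_mx P) 0 j = r * \sum_j u 0 j.
    by rewrite uA mulr_sumr; apply: eq_bigr => j _; rewrite mxE.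
  under eq_bigr do rewrite mxE; rewrite exchange_big/= => rE.
  have su : 0 < \sum_j u 0 j by rewrite (bigD1 ord0)//= ltr_wpDr// sumr_ge0// => i _; exact: ltW.
  rewrite -(@ler_pM2r _ (\sum_j u 0 j))// mul1r -rE ler_sum// => i _.
  rewrite -mulr_sumr -[leLHS]mulr1 (ler_wpM2l (ltW (u0 i)))// -[leLHS](P1 i) ler_sum// => j _.
  exact: zero_one_ge.
have E t : \sum_x u 0 x * \sum_(s : t.-tuple 'I_N) path_prod (zero_one_mx P) x s = r ^+ t * \sum_x u 0 x.
  elim: t => [|t IH].
    rewrite expr0 mul1r; apply: eq_bigr => x _.
    rewrite (eq_bigr (fun=> 1)) ?sumr_const ?card_tuple ?expn0 ?mulr1//.
    by move=> s _; rewrite (tuple0 s).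
  under eq_bigr do rewrite big_tuple_cons mulr_sumr.
  rewrite exchange_big/= exprS -mulrA -IH mulr_sumr; apply: eq_bigr => y _.
  rewrite [RHS]mulrA; have <- : (u *m zero_one_mx P) 0 y = r * u 0 y by rewrite uA mxE.
  rewrite mxE mulr_suml; apply: eq_bigr => x _.
  by rewrite -mulr_sumr mulrA.
have W0 x t : 0 <= \sum_(s : t.-tuple 'I_N) path_prod (zero_one_mx P) x s.
  by rewrite sumr_ge0// => s _; rewrite path_prod_zero_one ler0n.
exists (\sum_j (u 0 j)^-1 * \sum_j u 0 j).
split => // t; rewrite CtE; apply/andP; split.
  have su : 0 < \sum_j u 0 j by rewrite (bigD1 ord0)//= ltr_wpDr// sumr_ge0// => i _; exact: ltW.
  rewrite -(@ler_pM2r _ (\sum_j u 0 j))// -E mulr_suml ler_sum// => x _.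
  rewrite mulrC ler_wpM2l// (bigD1 x)//= lerDl sumr_ge0// => i _; exact: ltW.
rewrite -mulr_suml -mulrA [_ * r ^+ t]mulrC -E mulr_sumr ler_sum// => x _.
rewrite mulrA -[leLHS]mul1r ler_wpM2r// (bigD1 x)//= mulrDl mulVf ?gt_eqF//.
by rewrite lerDl mulr_ge0 ?(ltW (u0 _))// sumr_ge0// => i _; rewrite invr_ge0 ltW.
Qed.

End Growth.

(** * Entropy and variational formulas *)

Section Entropy.
Context (R : realType) (N : nat).
Implicit Types (theta Q : 'M[R]_N) (xi l : 'rV[R]_N) (F : 'I_N -> 'I_N -> R).

Lemma entropyHE theta : entropyH theta =
  - \sum_i \sum_j theta i j * ln (theta i j / thetabar theta i).
Proof.
congr (- _); apply: eq_bigr => i _; apply: eq_bigr => j _.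
by case: eqP => // ->; rewrite !mul0r.
Qed.

Lemma thetabar_ge0 theta i : (forall i j, 0 <= theta i j) -> 0 <= thetabar theta i.
Proof. by move=> t0; exact: sumr_ge0. Qed.

Lemma le_thetabar theta i j : (forall i j, 0 <= theta i j) -> theta i j <= thetabar theta i.
Proof. by move=> t0; rewrite /thetabar (bigD1 j)//= lerDl sumr_ge0. Qed.

Lemma thetabar_gt0 theta i j : (forall i j, 0 <= theta i j) ->
  0 < theta i j -> 0 < thetabar theta i.
Proof. by move=> t0 tij; rewrite (lt_le_trans tij)// le_thetabar. Qed.

Lemma entropyH_ge0 theta : (forall i j, 0 <= theta i j) -> 0 <= entropyH theta.
Proof.
move=> t0; rewrite entropyHE -sumrN sumr_ge0// => i _; rewrite -sumrN sumr_ge0// => j _.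
rewrite oppr_ge0 mulr_ge0_le0// ln_le0//.
have [->|bn0] := eqVneq (thetabar theta i) 0; first by rewrite invr0 mulr0.
by rewrite ler_pdivrMr ?mul1r ?le_thetabar// lt_def bn0 thetabar_ge0.
Qed.

(** The term of a generalized relative entropy of [a] with respect to [b * q]; the linear correction
    makes each term nonnegative by itself. *)
Let gap (a b q : R) := a * ln (a / b) - a * ln q - (a - b * q).

(** For a > 0 and y = b q / a the gap equals a (y - 1 - ln y), which vanishes only at y = 1; for a =
    0 it equals b q. *)
Lemma gap_ge0 a b q : 0 <= a <= b -> 0 <= q -> (0 < a -> 0 < q) ->
  0 <= gap a b q /\ (gap a b q = 0 -> a = b * q).
Proof.
move=> /andP[a0 ab] q0 aq; rewrite /gap.
have [a_gt0|] := ltP 0 a; last first.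
  move=> ale0; have {}a0 : a = 0 by apply/eqP; rewrite eq_le ale0.
  have bq0 : 0 <= b * q by rewrite mulr_ge0// -a0.
  by rewrite a0 !mul0r !sub0r !opprK oppr0 add0r; split => // ->.
have {}q0 := aq a_gt0; have b0 : 0 < b := lt_le_trans a_gt0 ab.
pose y := b * q / a; have y0 : 0 < y by rewrite divr_gt0// mulr_gt0.
have -> : a * ln (a / b) - a * ln q - (a - b * q) = a * (y - 1 - ln y).
  have -> : ln y = - (ln (a / b) - ln q).
    by rewrite /y !lnM ?lnV ?posrE ?mulr_gt0 ?invr_gt0//; ring.
  by rewrite /y; field; rewrite gt_eqF.
have [y1|yn1] := eqVneq y 1.
  rewrite y1 ln1 subrr subr0 mulr0; split => // _.
  by rewrite -[LHS]mul1r -y1 /y divfK// gt_eqF.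
have : 0 < y - 1 - ln y.
  rewrite subr_gt0 ltrBrDr addrC -[ltRHS]lnK ?posrE// expR_gt1Dx//.
  by rewrite ln_eq0.
move=> h; split; first by rewrite ltW// mulr_gt0.
by move/eqP; rewrite gt_eqF// mulr_gt0.
Qed.

(** The difference of the two sides is the sum of the gaps plus the defects 1 - \sum_j Q i j
    weighted by the row masses. Both parts are nonnegative, so equality makes every gap zero. *)
Lemma gibbs theta Q : (forall i j, 0 <= theta i j) -> (forall i j, 0 <= Q i j) ->
  (forall i j, 0 < theta i j -> 0 < Q i j) -> (forall i, \sum_j Q i j <= 1) ->
  entropyH theta <= - \sum_i \sum_j theta i j * ln (Q i j) /\
  (- \sum_i \sum_j theta i j * ln (Q i j) <= entropyH theta ->
    forall i j, theta i j = thetabar theta i * Q i j).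
Proof.
move=> t0 Q0 tQ Q1.
have gP i j := @gap_ge0 (theta i j) (thetabar theta i) (Q i j)
  (introT andP (conj (t0 i j) (le_thetabar i j t0))) (Q0 i j) (tQ i j).
pose G := \sum_i \sum_j gap (theta i j) (thetabar theta i) (Q i j).
pose T := \sum_i (thetabar theta i * (1 - \sum_j Q i j)).
have E : - \sum_i \sum_j theta i j * ln (Q i j) - entropyH theta = G + T.
  rewrite entropyHE opprK -sumrN -!big_split; apply: eq_bigr => i _ /=.
  have -> : thetabar theta i * (1 - \sum_j Q i j) =
      \sum_j (theta i j - thetabar theta i * Q i j).
    by rewrite mulrBr mulr1 mulr_sumr sumrB.
  rewrite -sumrN -!big_split.
  by apply: eq_bigr => j _ /=; rewrite /gap; ring.
have G0 : 0 <= G by rewrite sumr_ge0// => i _; rewrite sumr_ge0// => j _; exact: (gP i j).1.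
have T0 : 0 <= T by rewrite sumr_ge0// => i _; rewrite mulr_ge0 ?thetabar_ge0 ?subr_ge0.
split; first by rewrite -subr_ge0 E addr_ge0.
rewrite -subr_le0 E => le0 i j.
have : G = 0 by apply/eqP; rewrite eq_le G0 andbT (le_trans _ le0)// lerDl.
move=> /eqP; rewrite psumr_eq0; last first.
  by move=> k _; rewrite sumr_ge0// => m _; exact: (gP k m).1.
move=> /allP/(_ i (mem_index_enum i)) /=; rewrite psumr_eq0; last first.
  by move=> m _; exact: (gP i m).1.
by move=> /allP/(_ j (mem_index_enum j)) /= /eqP; exact: (gP i j).2.
Qed.

Lemma sum_row_normalized theta i : \sum_j theta i j / thetabar theta i <= 1.
Proof.
rewrite -mulr_suml; have [->|b0] := eqVneq (thetabar theta i) 0; first by rewrite invr0 mulr0.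
by rewrite divff.
Qed.

(** The optimal F, the logarithm of the kernel of theta, is -oo where theta vanishes. Mixing that
    kernel with the uniform one, with weight exp(-eps) on the kernel, makes F finite and lowers it
    by at most eps where theta is positive. *)
Lemma entropyH_smooth theta (eps : R) : (forall i j, 0 <= theta i j) ->
  \sum_i \sum_j theta i j = 1 -> 0 < eps ->
  exists F, (forall i, \sum_j expR (F i j) <= 1) /\
    - entropyH theta - eps <= \sum_i \sum_j theta i j * F i j.
Proof.
move=> t0 t1 e0; pose a := expR (- eps).
have a01 : 0 < a < 1 by rewrite expR_gt0 expR_lt1 oppr_lt0.
have /andP[a0 a1] := a01.
have N0 : (0 < N)%N.
  by move: t1; case: N theta {t0} => // theta; rewrite big_ord0 => /eqP; rewrite eq_sym oner_eq0.
pose Q i j := a * (theta i j / thetabar theta i) + (1 - a) / N%:R.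
have Q0 i j : 0 < Q i j.
  rewrite /Q ltr_wpDl//; first by rewrite mulr_ge0 ?divr_ge0 ?thetabar_ge0// ltW.
  by rewrite divr_gt0 ?subr_gt0// ltr0n.
exists (fun i j => ln (Q i j)); split.
  move=> i; under eq_bigr do rewrite lnK ?posrE//.
  rewrite big_split/= -mulr_sumr sumr_const card_ord -[X in _ + X]mulr_natr divfK; last first.
    by rewrite pnatr_eq0 -lt0n.
  rewrite -lerBrDr opprB addrC subrK -[leRHS]mulr1 ler_wpM2l ?sum_row_normalized//.
  exact: ltW.
rewrite entropyHE opprK -[eps]mulr1 -t1 mulr_sumr -sumrB ler_sum// => i _.
rewrite mulr_sumr -sumrB ler_sum// => j _.
have [->|tij] := eqVneq (theta i j) 0; first by rewrite !mul0r mulr0 subr0.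
have {}tij : 0 < theta i j by rewrite lt_def tij t0.
have bi : 0 < thetabar theta i := thetabar_gt0 t0 tij.
rewrite [eps * _]mulrC -mulrBr ler_pM2l//.
have -> : - eps = ln a by rewrite expRK.
rewrite addrC -lnM ?posrE ?divr_gt0// ler_ln ?posrE ?mulr_gt0 ?divr_gt0 ?invr_gt0//.
by rewrite /Q lerDl divr_ge0// subr_ge0 ltW.
Qed.

Lemma thetabar_mix theta1 theta2 (a b : R) i :
  thetabar (a *: theta1 + b *: theta2) i = a * thetabar theta1 i + b * thetabar theta2 i.
Proof. by rewrite /thetabar !mulr_sumr -big_split; apply: eq_bigr => j _; rewrite !mxE. Qed.

(** The entropy of the mixture is the same mixture of the cross entropies of theta1 and theta2
    relative to its kernel; by [gibbs] these are at least the entropies, and that of theta2 is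
    nonnegative. *)
Lemma entropyH_mix theta1 theta2 (a : R) : (forall i j, 0 <= theta1 i j) ->
  (forall i j, 0 <= theta2 i j) -> 0 < a < 1 ->
  a * entropyH theta1 <= entropyH (a *: theta1 + (1 - a) *: theta2).
Proof.
move=> t1 t2 /andP[a0 a1]; set theta := _ + _.
have b0 : 0 < 1 - a by rewrite subr_gt0.
have t0 i j : 0 <= theta i j by rewrite !mxE addr_ge0 ?mulr_ge0// ltW.
pose Q : 'M[R]_N := \matrix_(i, j) (theta i j / thetabar theta i).
have Q0 i j : 0 <= Q i j by rewrite mxE divr_ge0 ?thetabar_ge0.
have Q1 i : \sum_j Q i j <= 1 by under eq_bigr do rewrite mxE; exact: sum_row_normalized.
have Qpos i j : 0 < theta i j -> 0 < Q i j by move=> h; rewrite mxE divr_gt0// (thetabar_gt0 t0 h).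
have tQ1 i j : 0 < theta1 i j -> 0 < Q i j.
  by move=> h; apply: Qpos; rewrite !mxE ltr_pwDl ?mulr_gt0// mulr_ge0// ltW.
have tQ2 i j : 0 < theta2 i j -> 0 < Q i j.
  by move=> h; apply: Qpos; rewrite !mxE ltr_pwDr ?mulr_gt0// mulr_ge0// ltW.
have [h1 _] := gibbs t1 Q0 tQ1 Q1.
have [h2 _] := gibbs t2 Q0 tQ2 Q1.
have -> : entropyH theta = a * (- \sum_i \sum_j theta1 i j * ln (Q i j)) +
   (1 - a) * (- \sum_i \sum_j theta2 i j * ln (Q i j)).
  rewrite entropyHE !mulrN -opprD !mulr_sumr -big_split; congr (- _).
  apply: eq_bigr => i _ /=; rewrite !mulr_sumr -big_split; apply: eq_bigr => j _ /=.
  by rewrite [Q i j]mxE !mxE; ring.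
rewrite -[leLHS]addr0 lerD//; first by rewrite ler_wpM2l// ltW.
by rewrite mulr_ge0 ?(ltW b0)// (le_trans _ h2)// entropyH_ge0.
Qed.

(* J - H is the supremum of Phi F l over all l and all F with
   \sum_j expR (F i j) <= 1. *)
Definition Phi F l theta xi : R :=
  \sum_i \sum_j theta i j * F i j + \sum_i l 0 i * xi 0 i
  - \sum_i l 0 i ^+ 2 * thetabar theta i / 2.

(** The quadratic part is maximal at l_i = xi_i / bar(theta)_i. Where J is infinite, some xi_i <> 0
    meets a zero row mass, the quadratic penalty disappears, and l_i can be taken as large as
    needed. *)
Lemma Jfun_variational theta xi (h : R) : (forall i j, 0 <= theta i j) ->
  \sum_i \sum_j theta i j = 1 -> ((h + entropyH theta)%:E < Jfun theta xi)%E ->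
  exists F l, (forall i, \sum_j expR (F i j) <= 1) /\ h < Phi F l theta xi.
Proof.
move=> t0 t1; rewrite /Jfun; case: ifPn => [/forallP h0|].
  rewrite lte_fin => hJ; set J := (X in _ < X) in hJ.
  pose eps := (J - (h + entropyH theta)) / 2.
  have e0 : 0 < eps by rewrite divr_gt0 ?subr_gt0.
  have [F [F1 FH]] := entropyH_smooth t0 t1 e0.
  exists F, (\row_i (xi 0 i / thetabar theta i)); split => //.
  have JE : \sum_i (\row_i (xi 0 i / thetabar theta i)) 0 i * xi 0 i
     - \sum_i (\row_i (xi 0 i / thetabar theta i)) 0 i ^+ 2 * thetabar theta i / 2 = J.
    rewrite /J [RHS]big_mkcond -sumrB; apply: eq_bigr => i _; rewrite !mxE.
    case: ifPn => b0; first by field; rewrite gt_eqF.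
    have -> : thetabar theta i = 0 by apply/eqP; rewrite eq_le thetabar_ge0// andbT leNgt.
    by rewrite invr0 !mulr0 !mul0r subr0.
  rewrite /Phi -addrA JE (lt_le_trans _ (lerD FH (lexx J)))//.
  by rewrite /eps; lra.
rewrite negb_forall; case/existsP => i; rewrite negb_imply => /andP[/eqP bi xin0] _.
have [F [F1 FH]] := entropyH_smooth t0 t1 (@ltr01 R).
(* This makes l_i xi_i = |h| + H + 2, which covers H, the smoothing loss 1 and the level h. *)
pose c := (`|h| + entropyH theta + 2) / xi 0 i ^+ 2.
exists F, (\row_k (if k == i then c * xi 0 i else 0)); split => //.
rewrite /Phi [X in _ + X - _](bigD1 i)//= [X in _ + (_ + X) - _]big1 ?addr0; last first.
  by move=> k /negbTE ki; rewrite mxE ki mul0r.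
rewrite [X in _ - X]big1 ?subr0; last first.
  move=> k _; rewrite mxE; case: eqP => [->|_]; first by rewrite bi mulr0 mul0r.
  by rewrite expr0n/= !mul0r.
rewrite mxE eqxx -mulrA -expr2 /c divfK ?sqrf_eq0//.
have := ler_norm h; lra.
Qed.

End Entropy.

(** * Gaussian integrals and independence *)

Section Density.
Local Open Scope ereal_scope.
Context d1 d2 (T1 : measurableType d1) (T2 : measurableType d2) (R : realType).
Variables (mu : {measure set T1 -> \bar R}) (nu : {measure set T2 -> \bar R}).
Variables (phi : T1 -> T2) (g : T1 -> R).
Hypotheses (mphi : measurable_fun setT phi) (mg : measurable_fun setT g)
  (g0 : forall x, (0 <= g x)%R).
Hypothesis gnu : forall A, measurable A -> \int[mu]_(x in phi @^-1` A) (g x)%:E = nu A.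

Import HBNNSimple.

(** Change of variables when nu is the image under phi of the measure with density g. It serves for
    the law of a variable (g = 1), for the normal density (phi = id), and for the law of one
    variable under an exponential weight. *)
Lemma ge0_integral_density (f : T2 -> \bar R) :
  measurable_fun setT f -> (forall y, 0 <= f y) ->
  \int[mu]_x (f (phi x) * (g x)%:E) = \int[nu]_y f y.
Proof.
move=> mf f0.
pose h := nnsfun_approx measurableT mf.
have mgE : measurable_fun setT (fun x => (g x)%:E) by exact/measurable_EFinP.
have mhphi n : measurable_fun setT (fun x => (h n (phi x))%:E).
  by apply/measurable_EFinP; exact: measurableT_comp.
have -> : \int[nu]_x f x = lim (\int[nu]_x (EFin \o h n) x @[n --> \oo]).
  have fE x : f x = lim ((EFin \o h n) x @[n --> \oo]).
    by apply/esym/cvg_lim => //; exact: cvg_nnsfun_approx.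
  under eq_integral do rewrite fE.
  apply: monotone_convergence => //.
  - by move=> n; exact/measurable_EFinP.
  - by move=> n x _ //=; rewrite lee_fin.
  - by move=> x _ a b ab; rewrite lee_fin; exact/lefP/nd_nnsfun_approx.
have -> : \int[mu]_x (f (phi x) * (g x)%:E) =
    lim (\int[mu]_x ((h n (phi x))%:E * (g x)%:E) @[n --> \oo]).
  have fg x : f (phi x) * (g x)%:E = lim ((h n (phi x))%:E * (g x)%:E @[n --> \oo]).
    by apply/esym/cvg_lim => //; apply: cvgeZr => //; exact: cvg_nnsfun_approx.
  under eq_integral do rewrite fg.
  apply: monotone_convergence => [//| | |].
  - by move=> n; exact: emeasurable_funM.
  - by move=> n x _ /=; rewrite mule_ge0 ?lee_fin.
  - by move=> x _ a b ab/=; rewrite lee_wpmul2r ?lee_fin//; exact/lefP/nd_nnsfun_approx.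
suff suf n : \int[mu]_x ((h n (phi x))%:E * (g x)%:E) = \int[nu]_x (EFin \o h n) x.
  by under eq_fun do rewrite suf.
have mpre A : measurable A -> measurable (phi @^-1` A).
  by move=> mA; rewrite -[X in measurable X]setTI; exact: mphi.
transitivity (\int[nu]_x
   (\sum_(y \in range (h n)) (y * \1_(h n @^-1` [set y]) x)%:E)); last first.
  by apply: eq_integral => t tE; rewrite /= fimfunE -fsumEFin.
rewrite ge0_integral_fsum//; last 2 first.
  - by move=> r; exact/measurable_EFinP/measurable_funM.
  - by move=> m y _; exact: nnfun_muleindic_ge0.
have mind r : measurable_fun [set: T1] (fun x => (r * \1_(h n @^-1` [set r]) (phi x))%:E).
  apply/measurable_EFinP/measurable_funM => //.
  have mi : measurable_fun setT (\1_(h n @^-1` [set r]) : T2 -> R) by exact: measurable_indic.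
  exact: (measurableT_comp mi mphi).
transitivity (\int[mu]_x (\sum_(y \in range (h n))
    (y * \1_(h n @^-1` [set y]) (phi x))%:E * (g x)%:E)).
  under [RHS]eq_integral => x xE.
    rewrite -ge0_mule_fsuml => [|y]; last exact: nnfun_muleindic_ge0.
    rewrite fsumEFin // -(fimfunE _ (phi x)); over.
  by [].
rewrite ge0_integral_fsum//; last 2 first.
  - by move=> y; exact: emeasurable_funM.
  - by move=> m y _; rewrite mule_ge0 ?lee_fin// -lee_fin nnfun_muleindic_ge0.
apply: eq_fsbigr => r rhn.
under [RHS]eq_integral do rewrite EFinM.
rewrite integralZl_indic_nnsfun => //.
under eq_integral do rewrite EFinM -muleA.
rewrite ge0_integralZl//.
- rewrite integral_indic// setIT -gnu//.
  congr (_ * _); rewrite [RHS]integral_mkcond; apply: eq_integral => x _.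
  by rewrite epatch_indic muleC /= !indicE.
- apply: emeasurable_funM => //; apply/measurable_EFinP.
  have mi : measurable_fun setT (\1_(h n @^-1` [set r]) : T2 -> R) by exact: measurable_indic.
  exact: (measurableT_comp mi mphi).
- by move=> t Et; rewrite mule_ge0 ?lee_fin.
- by move: rhn; rewrite inE => -[t _ <-]; rewrite lee_fin.
Qed.

End Density.

Section Normal.
Local Open Scope ereal_scope.
Context d (Omega : measurableType d) (R : realType) (Pr : probability Omega R).

Lemma integral_std_normal (X : Omega -> R) (f : R -> \bar R) : std_normal_rv Pr X ->
  measurable_fun setT f -> (forall x, 0 <= f x) ->
  \int[Pr]_w f (X w) = \int[lebesgue_measure]_x (f x * (normal_pdf 0 1 x)%:E).
Proof.
move=> [mX PX] mf f0.
rewrite (@ge0_integral_density _ _ _ _ R lebesgue_measure (normal_prob 0 1) id (normal_pdf 0 1))//; last 2 first.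
- exact: measurable_normal_pdf.
- exact: normal_pdf_ge0.
rewrite -(@ge0_integral_density _ _ _ _ R Pr (normal_prob 0 1) X (cst 1%R))//.
- by apply: eq_integral => w _; rewrite mule1.
- move=> A mA; transitivity (\int[Pr]_(x in X @^-1` A) cst 1 x) => //.
  rewrite integral_cst/= ?mul1e ?PX//.
  by rewrite -[X in measurable X]setTI; exact: mX.
Qed.

Lemma std_normal_mgf (X : Omega -> R) (a : R) : std_normal_rv Pr X ->
  \int[Pr]_w (expR (a * X w))%:E = (expR (a ^+ 2 / 2))%:E.
Proof.
move=> nX.
rewrite (@integral_std_normal X (fun x => (expR (a * x))%:E))//; last first.
  by apply/measurable_EFinP; apply: measurableT_comp => //; exact: measurable_funM.
(* Completing the square turns the tilted standard density into a normal density with mean a. *)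
transitivity (\int[lebesgue_measure]_x ((expR (a ^+ 2 / 2))%:E * (normal_pdf a 1 x)%:E)).
  apply: eq_integral => x _; rewrite -!EFinM /normal_pdf oner_eq0; congr EFin.
  rewrite /normal_fun mulrCA [RHS]mulrCA; congr (_ * _)%R.
  rewrite -!expRD; congr expR; rewrite !expr1n; by field.
rewrite ge0_integralZl//=.
- by rewrite integral_normal_pdf mule1.
- by apply/measurable_EFinP; exact: measurable_normal_pdf.
- by move=> x _; rewrite lee_fin normal_pdf_ge0.
Qed.

End Normal.

(** * Exponential moments of independent normal families *)

Section Independence.
Local Open Scope ereal_scope.
Context d (Omega : measurableType d) (R : realType) (Pr : probability Omega R).

Lemma preimage_measurable (X : Omega -> R) (B : set R) :
  measurable_fun setT X -> measurable B -> measurable (X @^-1` B).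
Proof. by move=> mX mB; rewrite -[X in measurable X]setTI; exact: mX. Qed.

Context (I : eqType) (D : set I) (X : I -> Omega -> R).
Hypothesis (NX : forall a, D a -> std_normal_rv Pr (X a)).
Hypothesis indX : mutually_independent Pr D X.

Let mX a : D a -> measurable_fun setT (X a).
Proof. by move=> /NX[]. Qed.

Definition rect (J : seq I) (B : I -> set R) : set Omega :=
  [set w | forall a, a \in J -> B a (X a w)].

Lemma rect_cons a J B : rect (a :: J) B = X a @^-1` B a `&` rect J B.
Proof.
apply/seteqP; split=> w /=.
  by move=> h; split=> [|b bJ]; apply: h; rewrite ?mem_head// in_cons bJ orbT.
by move=> [h1 h2] b; rewrite in_cons => /orP[/eqP->//|]; exact: h2.
Qed.

Lemma rect_nil B : rect [::] B = setT.
Proof. by apply/seteqP; split. Qed.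

Lemma eq_rect_in J B B' : {in J, B =1 B'} -> rect J B = rect J B'.
Proof.
by move=> BB; apply/seteqP; split=> w h a aJ; have := h a aJ; rewrite BB.
Qed.

Lemma measurable_rect (J : seq I) (B : I -> set R) :
  (forall a, a \in J -> D a) -> (forall a, measurable (B a)) -> measurable (rect J B).
Proof.
move=> + mB; elim: J => [|a J IH] JD; first by rewrite rect_nil.
rewrite rect_cons; apply: measurableI.
  by apply: preimage_measurable => //; apply/mX/JD; rewrite mem_head.
by apply: IH => b bJ; apply: JD; rewrite in_cons bJ orbT.
Qed.

Lemma prob_rect (J : seq I) (B : I -> set R) :
  uniq J -> (forall a, a \in J -> D a) -> (forall a, measurable (B a)) ->
  Pr (rect J B) = \prod_(a <- J) Pr (X a @^-1` B a).
Proof. by move=> uJ JD mB; rewrite -indX. Qed.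

Lemma prob_rect_cat (J1 J2 : seq I) (B : I -> set R) :
  uniq (J1 ++ J2) -> (forall a, a \in J1 ++ J2 -> D a) -> (forall a, measurable (B a)) ->
  Pr (rect (J1 ++ J2) B) = Pr (rect J1 B) * Pr (rect J2 B).
Proof.
move=> uJ JD mB; move: (uJ); rewrite cat_uniq => /and3P[u1 _ u2].
by rewrite !prob_rect// ?big_cat//= => a aJ; apply: JD; rewrite mem_cat aJ ?orbT.
Qed.

(** The rectangle over J2 is there for the induction: to split off X_a one needs its law under the
    remaining weight, and the test of X_a against a set A becomes one more side of the rectangle.
    The product formula for rectangles thus suffices, without product measures. *)
Lemma integral_rect_expR (c : I -> R) (J1 J2 : seq I) (B : I -> set R) :
  uniq (J1 ++ J2) -> (forall a, a \in J1 ++ J2 -> D a) -> (forall a, measurable (B a)) ->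
  \int[Pr]_(w in rect J2 B) (expR (\sum_(a <- J1) c a * X a w))%:E =
  (expR (\sum_(a <- J1) c a ^+ 2 / 2))%:E * Pr (rect J2 B).
Proof.
elim: J1 J2 B => [|a J1 IH] J2 B uJ JD mB.
  under eq_integral do rewrite big_nil expR0.
  rewrite big_nil expR0 -[RHS]integral_cst//.
  by apply: measurable_rect => // b bJ; exact: JD.
have mR : measurable (rect J2 B).
  by apply: measurable_rect => // b bJ; apply: JD; rewrite mem_cat bJ orbT.
have Da : D a by apply: JD; rewrite mem_cat mem_head.
have aJ2 : a \notin J2.
  by move: uJ; rewrite /= mem_cat negb_or => /andP[/andP[]].
have mS : measurable_fun setT (fun w => (\sum_(b <- J1) c b * X b w)%R).
  elim: J1 JD {IH uJ} => [|b J1 IH'] JD; first by under eq_fun do rewrite big_nil; exact: measurable_cst.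
  under eq_fun do rewrite big_cons.
  apply: measurable_funD; first by apply: measurable_funM => //; apply/mX/JD; rewrite !inE eqxx orbT.
  by apply: IH' => b' b'J; apply: JD; move: b'J; rewrite !inE orbCA => ->; rewrite orbT.
(* By induction this is the total mass of the weight [g], and under [g] the variable X_a keeps its
   normal law up to this factor. *)
pose cst0 := (expR (\sum_(a <- J1) c a ^+ 2 / 2) * fine (Pr (rect J2 B)))%R.
have cst0_ge0 : (0 <= cst0)%R by rewrite mulr_ge0 ?expR_ge0// fine_ge0.
pose g := fun w => (\1_(rect J2 B) w * expR (\sum_(a <- J1) c a * X a w))%R.
have mg : measurable_fun setT g.
  by apply: measurable_funM => //; apply: measurableT_comp.
have g0 w : (0 <= g w)%R by rewrite mulr_ge0 ?expR_ge0.
transitivity (\int[Pr]_w ((expR (c a * X a w))%:E * (g w)%:E)).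
  rewrite integral_mkcond; apply: eq_integral => w _.
  rewrite epatch_indic big_cons expRD -!EFinM; congr EFin; rewrite /g; ring.
pose f := fun x => (expR (c a * x))%:E.
have mf : measurable_fun setT f.
  by apply/measurable_EFinP; apply: measurableT_comp => //; exact: measurable_funM.
have f0 x : 0 <= f x by rewrite lee_fin expR_ge0.
rewrite (@ge0_integral_density _ _ _ _ R Pr (mscale (NngNum cst0_ge0) (normal_prob 0 1)) (X a) g _ _ _ _ f)//.
- rewrite ge0_integral_mscale//=.
  have <- : \int[Pr]_w f (X a w) = \int[normal_prob 0 1]_x f x.
    rewrite (@integral_std_normal _ _ _ Pr)//; last exact: NX.
    rewrite -(@ge0_integral_density _ _ _ _ R lebesgue_measure (normal_prob 0 1) id (normal_pdf 0 1))//.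
      exact: measurable_normal_pdf.
    exact: normal_pdf_ge0.
  rewrite std_normal_mgf; last exact: NX.
  rewrite /cst0 big_cons expRD !EFinM fineK; last exact: fin_num_measure.
  by rewrite muleC muleA.
- exact: mX.
- move=> A mA; rewrite /mscale/=.
  pose B' b := if b == a then A else B b.
  have mB' b : measurable (B' b) by rewrite /B'; case: ifP => _; [exact: mA|exact: mB].
  have RE : rect (a :: J2) B' = X a @^-1` A `&` rect J2 B.
    rewrite rect_cons /B' eqxx; congr (_ `&` _); apply: eq_rect_in => b bJ.
    by case: eqP => // ba; rewrite -ba bJ in aJ2.
  have uJ' : uniq (J1 ++ a :: J2) by rewrite uniq_catC /= mem_cat orbC -mem_cat uniq_catC -cons_uniq.
  have JD' b : b \in J1 ++ a :: J2 -> D b.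
    by rewrite mem_cat in_cons orbCA -mem_cat -in_cons; exact: JD.
  transitivity (\int[Pr]_(w in rect (a :: J2) B') (expR (\sum_(a <- J1) c a * X a w))%:E).
    rewrite RE integral_mkcondr; apply: eq_integral => w _.
    by rewrite epatch_indic /g muleC EFinM.
  rewrite IH// RE.
  have uJ2 : uniq (a :: J2) by move: uJ'; rewrite cat_uniq => /and3P[].
  have -> : Pr (X a @^-1` A `&` rect J2 B) = Pr (X a @^-1` A) * Pr (rect J2 B).
    rewrite -RE -cat1s prob_rect_cat//; last first.
      by move=> b bJ; apply: JD'; rewrite mem_cat bJ orbT.
    congr (_ * Pr _); last first.
      apply: eq_rect_in => b bJ; rewrite /B'.
      by case: eqP => // ba; rewrite -ba bJ in aJ2.
    by rewrite rect_cons rect_nil setIT /B' eqxx.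
  have [_ ->] := NX Da; last by [].
  by rewrite /mscale/= /cst0 EFinM fineK ?fin_num_measure// -muleA [normal_prob _ _ _ * _]muleC.
Qed.

Lemma integral_expR_sum (c : I -> R) (J : seq I) : uniq J -> (forall a, a \in J -> D a) ->
  \int[Pr]_w (expR (\sum_(a <- J) c a * X a w))%:E =
  (expR (\sum_(a <- J) c a ^+ 2 / 2))%:E.
Proof.
move=> uJ JD; have := @integral_rect_expR c J [::] (fun=> setT).
by rewrite cats0 rect_nil => ->//; rewrite probability_setT mule1.
Qed.

End Independence.

(** * Independence of events carried by disjoint blocks *)

Section PiLambda.
Local Open Scope ereal_scope.
Context d (Omega : measurableType d) (R : realType) (Pr : probability Omega R).

Lemma indep_g_sigma_algebra_l (G : set (set Omega)) (B : set Omega) :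
  setI_closed G -> G `<=` measurable -> measurable B ->
  (forall A, G A -> Pr (A `&` B) = Pr A * Pr B) ->
  forall A, <<s G >> A -> Pr (A `&` B) = Pr A * Pr B.
Proof.
move=> GI Gm mB GB A; rewrite -setI_closed_g_dynkin_g_sigma_algebra// => sA.
(* Measurability is carried along in the Dynkin class because its closure under complements and
   disjoint unions uses it. *)
suff : [set A | measurable A /\ Pr (A `&` B) = Pr A * Pr B] A by case.
apply: sA; split; last first.
  by move=> C GC; split; [exact: Gm|exact: GB].
split=> /=.
- by rewrite setTI probability_setT mul1e.
- move=> C [mC CB]; split; first exact: measurableC.
  have fC : Pr C \is a fin_num by exact: fin_num_measure.
  have fB : Pr B \is a fin_num by exact: fin_num_measure.
  rewrite setIC -setDE measureD//; last by rewrite ltey_eq fB.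
  transitivity (Pr B - Pr C * Pr B); first by rewrite -CB [C `&` B]setIC.
  rewrite probability_setC// muleBl//.
  by rewrite mul1e.
- move=> F tF FK; have mF n : measurable (F n) by case: (FK n).
  split; first exact: bigcup_measurable.
  rewrite setI_bigcupl measure_bigcup//; last 2 first.
  - by move=> i _; exact: measurableI.
  - exact: trivIset_setIr.
  rewrite measure_bigcup// -(fineK (fin_num_measure Pr _ mB)) muleC -nneseriesZl//.
  apply: eq_eseriesr => i _; transitivity (Pr (F i) * Pr B); first exact: (FK i).2.
  by rewrite fineK ?fin_num_measure// muleC.
Qed.

Lemma indep_g_sigma_algebra (G1 G2 : set (set Omega)) :
  setI_closed G1 -> setI_closed G2 -> G1 `<=` measurable -> G2 `<=` measurable ->
  (forall A B, G1 A -> G2 B -> Pr (A `&` B) = Pr A * Pr B) ->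
  forall A B, <<s G1 >> A -> <<s G2 >> B -> Pr (A `&` B) = Pr A * Pr B.
Proof.
move=> I1 I2 m1 m2 G12 A B sA sB.
have mA : measurable A by exact: (smallest_sub (sigma_algebra_measurable _) m1 sA).
rewrite setIC muleC; apply: (@indep_g_sigma_algebra_l G2) => // C GC.
rewrite setIC muleC; apply: (@indep_g_sigma_algebra_l G1) => //; first exact: m2.
by move=> E GE; exact: G12.
Qed.

Context (I : eqType) (D : set I) (X : I -> Omega -> R).
Hypothesis (NX : forall a, D a -> std_normal_rv Pr (X a)).
Hypothesis indX : mutually_independent Pr D X.

Definition rects (J : seq I) : set (set Omega) :=
  [set A | exists2 B : I -> set R, (forall a, measurable (B a)) & A = rect X J B].

Lemma rects_setI J : setI_closed (rects J).
Proof.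
move=> _ _ [B mB ->] [C mC ->]; exists (fun a => B a `&` C a).
  by move=> a; exact: measurableI.
apply/seteqP; split=> w /=; first by move=> [h1 h2] a aJ; split; [exact: h1|exact: h2].
by move=> h; split=> a aJ; have [] := h a aJ.
Qed.

Lemma indep_blocks (J1 J2 : seq I) A B : uniq (J1 ++ J2) ->
  (forall a, a \in J1 ++ J2 -> D a) ->
  <<s rects J1 >> A -> <<s rects J2 >> B -> Pr (A `&` B) = Pr A * Pr B.
Proof.
move=> uJ JD; apply: indep_g_sigma_algebra; [exact: rects_setI|exact: rects_setI| | |].
- move=> _ [C mC ->]; apply: (measurable_rect NX) => // a aJ; apply: JD.
  by rewrite mem_cat aJ.
- move=> _ [C mC ->]; apply: (measurable_rect NX) => // a aJ; apply: JD.
  by rewrite mem_cat aJ orbT.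
- move=> _ _ [C mC ->] [E mE ->].
  (* The blocks are disjoint, so one family of sides describes both rectangles. *)
  pose F a := if a \in J1 then C a else E a.
  have -> : rect X J1 C = rect X J1 F.
    by apply: eq_rect_in => a aJ; rewrite /F aJ.
  have -> : rect X J2 E = rect X J2 F.
    apply: eq_rect_in => a aJ; rewrite /F; case: ifPn => // aJ1.
    move: uJ; rewrite cat_uniq => /and3P[_ /hasPn/(_ _ aJ)]; by rewrite /= aJ1.
  rewrite -(prob_rect_cat indX)//; last by move=> a; rewrite /F; case: ifP.
  congr (Pr _); apply/seteqP; split=> w /=.
    by move=> [h1 h2] a; rewrite mem_cat => /orP[]; [exact: h1|exact: h2].
  by move=> h; split=> a aJ; apply: h; rewrite mem_cat aJ ?orbT.
Qed.

Lemma measurable_rects_coord J a : a \in J ->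
  measurable_fun setT (X a : g_sigma_algebraType (rects J) -> R).
Proof.
move=> aJ _ B mB; rewrite setTI; apply: sub_sigma_algebra.
exists (fun b => if b == a then B else setT); first by move=> b; case: ifP.
apply/seteqP; split=> w /=.
  by move=> Xw b bJ; case: eqP => // ->.
by move=> /(_ a aJ); rewrite eqxx.
Qed.

End PiLambda.

Section BorelCantelli.
Local Open Scope ereal_scope.
Context d (Omega : measurableType d) (R : realType) (Pr : probability Omega R).

(** Markov's inequality at level 1 bounds the probabilities of 1 <= f_t by a convergent geometric
    series, and Borel-Cantelli applies. The users scale f so that the bad event is the crossing of
    1. *)
Lemma ae_eventually_lt1 (f : nat -> Omega -> R) (C c : R) :
  (forall t, measurable_fun setT (f t)) -> (forall t w, (0 <= f t w)%R) -> (0 < c)%R ->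
  (\forall t \near \oo, \int[Pr]_w (f t w)%:E <= (C * expR (- (t%:R * c)))%:E) ->
  {ae Pr, forall w, \forall t \near \oo, (f t w < 1)%R}.
Proof.
move=> mf f0 c0 [t0 _ ht0].
pose F k := [set w | (1 <= f (k + t0)%N w)%R].
have mF k : measurable (F k).
  rewrite -[X in measurable X]setTI (_ : F k = (f (k + t0)%N) @^-1` `[1%R, +oo[%classic); last first.
    by apply/seteqP; split=> w /=; rewrite in_itv/= andbT.
  exact: mf.
pose q := expR (- c).
have q01 : (`|q| < 1)%R by rewrite ger0_norm ?expR_ge0// expR_lt1 oppr_lt0.
have PF k : Pr (F k) <= (`|C| * q ^+ k)%:E.
  have h : Pr (F k) <= \int[Pr]_w (f (k + t0)%N w)%:E.
    rewrite -[leLHS]mul1e -integral_cst// integral_mkcond.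
    apply: ge0_le_integral => //.
    - by move=> w _; rewrite /patch; case: ifP.
    - by apply/(measurable_restrictT _ _).1.
    - exact/measurable_EFinP.
    - by move=> w _; rewrite /patch; case: ifPn => [|_]; rewrite ?inE ?lee_fin.
  rewrite (le_trans h)// (le_trans (ht0 (k + t0)%N _))/= ?leq_addl// lee_fin.
  rewrite (@le_trans _ _ (`|C| * expR (- ((k + t0)%:R * c)))%R)//.
    by rewrite ler_wpM2r ?expR_ge0// ler_norm.
  rewrite ler_wpM2l// /q -expRM_natr ler_expR mulrC mulNr lerN2 natrD mulrDr lerDl.
  by rewrite mulr_ge0// ltW.
exists (lim_sup_set F); split.
- by apply: bigcap_measurable => [|k _]; [exists 0%N|apply: bigcup_measurable].
- apply: lim_sup_set_cvg0 => //.
  apply: (@le_lt_trans _ _ (`|C| / (1 - q))%:E); last exact: ltry.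
  apply: lime_le; first exact: is_cvg_nneseries.
  near=> n; apply: (@le_trans _ _ (\sum_(0 <= k < n) (`|C| * q ^+ k)%:E)); first by apply: lee_sum => k _; exact: PF.
  rewrite sumEFin lee_fin.
  have := @geometric_seriesE R `|C| q; rewrite lt_eqF; last by rewrite (le_lt_trans (ler_norm q)).
  move=> /(_ isT) /(congr1 (fun u => u n)); rewrite /series /geometric/= => ->.
  rewrite ler_pdivlMr ?subr_gt0; last by rewrite (le_lt_trans (ler_norm q)).
  by rewrite divfK ?subr_eq0 ?gt_eqF ?(le_lt_trans (ler_norm q))// ler_piMr// gerDl oppr_le0 exprn_ge0 ?expR_ge0.
- move=> w /= nw k _; apply: contrapT => nF; apply: nw.
  exists (k + t0)%N => // t /= kt; rewrite ltNge; apply/negP => ft; apply: nF.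
  have tE : (t = (t - t0) + t0)%N by rewrite subnK// (leq_trans _ kt)// leq_addl.
  exists (t - t0)%N; first by rewrite /= leq_subRL ?(leq_trans (leq_addl _ _) kt)// addnC.
  by rewrite /F /= -tE.
Unshelve. all: by end_near. Qed.

End BorelCantelli.

(** * Compactness and the simplex Delta *)

(** If Q failed on K, the sets A with Q (K \ A) would form a proper filter containing K. A
    neighbourhood U of a cluster point with Q U puts the complement of U in this filter, a
    contradiction. *)
Lemma compact_ind (T : topologicalType) (K : set T) (Q : set T -> Prop) :
  compact K -> Q set0 -> (forall A B, A `<=` B -> Q B -> Q A) ->
  (forall A B, Q A -> Q B -> Q (A `|` B)) ->
  (forall x, K x -> exists2 U, nbhs x U & Q U) -> Q K.
Proof.
move=> cK Q0 Qmono QU Qloc; apply: contrapT => nQ.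
pose F : set_system T := [set A | Q (K `\` A)].
have FF : ProperFilter F.
  split; first by rewrite /F /= setD0.
  split.
  - by rewrite /F /= setDT.
  - move=> A B QA QB; change (Q (K `\` (A `&` B))); rewrite setDE setCI setIUr -!setDE; exact: QU.
  - by move=> A B AB; apply: Qmono => x [Kx nBx]; split => // /AB.
have FK : F K by rewrite /F /= setDv.
have [x [Kx clx]] := cK F FF FK.
have [U Ux QxU] := Qloc x Kx.
have FU : F (~` U) by rewrite /F /= setDE setCK; apply: Qmono QxU => y [].
by have [y []] := clx _ _ FU Ux.
Qed.

Lemma matrix_box_compact (R : realType) (m n : nat) (a b : R) :
  compact [set M : 'M[R]_(m, n) | forall i j, a <= M i j <= b].
Proof.
have c : compact [set v : 'rV[R]_(m * n) | forall i, `[a, b]%classic (v 0 i)].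
  by apply: (@rV_compact R _ (fun=> `[a, b]%classic)) => i; exact: segment_compact.
have vc : continuous (@vec_mx R m n).
  move=> v U /nbhs_ballP[e e0 eU]; apply/nbhs_ballP; exists e => // w [_ vw].
  by apply: eU; split => // i j; rewrite !mxE.
have := continuous_compact (continuous_subspaceT vc) c; congr compact.
apply/seteqP; split => M /=.
  by move=> [v vab <-] i j; rewrite mxE; have := vab (mxvec_index i j); rewrite /= in_itv.
move=> Mab; exists (mxvec M); last exact: mxvecK.
by move=> k; case: (mxvec_indexP k) => i j; rewrite mxvecE /= in_itv/= Mab.
Qed.

Lemma nbhs_matrix_prod (R : realType) (m n : nat) (theta : 'M[R]_m) (xi : 'rV[R]_n)
    (G : set ('M[R]_m * 'rV[R]_n)) : nbhs (theta, xi) G ->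
  exists2 e : R, 0 < e & forall (theta' : 'M[R]_m) (xi' : 'rV[R]_n),
    (forall i j, `|theta' i j - theta i j| < e) ->
    (forall i, `|xi' 0 i - xi 0 i| < e) -> G (theta', xi').
Proof.
move=> /nbhs_ballP[e e0 eG]; exists e => // theta' xi' h1 h2; apply: eG; split => /=.
  by split => // i j; rewrite /ball/= distrC.
by split => // i j; rewrite /ball/= distrC ord1.
Qed.

Section Delta.
Context (R : realType) (N : nat) (P : 'M[R]_N) (pi : 'rV[R]_N).
Hypotheses (P0 : forall i j, 0 <= P i j) (P1 : forall i, \sum_j P i j = 1)
  (irr : irreducible P) (pi0 : forall i, 0 < pi 0 i) (pi1 : \sum_i pi 0 i = 1)
  (piP : pi *m P = pi).
Implicit Types (theta : 'M[R]_N) (xi : 'rV[R]_N).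

Lemma irreducible_ind (S : 'I_N -> Prop) j0 : S j0 ->
  (forall i j, S j -> 0 < P i j -> S i) -> forall i, S i.
Proof.
move=> Sj0 Sback i; have [k] := irr i j0.
elim: k i => [|k IH] i.
  by rewrite expr0 mxE; case: eqP => [->//|_]; rewrite ltxx.
rewrite exprS mxE => sgt0.
have [l Pl] : exists l, 0 < P i l * (P ^+ k) l j0.
  apply: contrapT => /forallNP h; move: sgt0; rewrite ltNge => /negP; apply.
  by apply: sumr_le0 => l _; rewrite leNgt; apply/negP/h.
have Pk0 := exprM_ge0 k P0 l j0.
apply: (Sback i l); last first.
  by rewrite lt_def P0 andbT; apply: contraTneq Pl => ->; rewrite mul0r ltxx.
by apply: IH; rewrite lt_def Pk0 andbT; apply: contraTneq Pl => ->; rewrite mulr0 ltxx.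
Qed.

(** Subtract from x the largest multiple c y lying below it. The difference is nonnegative,
    invariant under Q and zero at some k, hence zero at the predecessors of k and, by
    irreducibility, everywhere; equal masses give c = 1. *)
Lemma stationary_unique (Q : 'M[R]_N) (x y : 'I_N -> R) :
  (forall i j, 0 <= Q i j) -> (forall i j, 0 < P i j -> 0 < Q i j) ->
  (forall i, 0 < y i) ->
  (forall j, \sum_i x i * Q i j = x j) -> (forall j, \sum_i y i * Q i j = y j) ->
  \sum_i x i = 1 -> \sum_i y i = 1 -> x =1 y.
Proof.
move=> Q0 PQ y0 xQ yQ x1 y1 i0.
pose k := [arg min_(i < i0) (x i / y i)]%O.
pose c := x k / y k.
have kP i : c * y i <= x i by rewrite -ler_pdivlMr// /c /k; case: arg_minP => //= j _; exact.
have zQ j : \sum_i (x i - c * y i) * Q i j = x j - c * y j.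
  under eq_bigr do rewrite mulrBl -mulrA.
  by rewrite sumrB -mulr_sumr xQ yQ.
have z0 i : x i = c * y i.
  apply: (@irreducible_ind (fun i => x i = c * y i) k) => [|l j zj Plj].
    by rewrite /c divfK// gt_eqF.
  have /eqP := zQ j; rewrite zj subrr psumr_eq0; last first.
    by move=> m _; rewrite mulr_ge0// subr_ge0.
  move=> /allP/(_ l (mem_index_enum l)) /=; rewrite mulf_eq0 subr_eq0 => /orP[/eqP//|/eqP Q0'].
  by have := PQ l j Plj; rewrite Q0' ltxx.
have c1 : c = 1 by rewrite -x1 (eq_bigr _ (fun i _ => z0 i)) -mulr_sumr y1 mulr1.
by rewrite z0 c1 mul1r.
Qed.

Lemma exists_edge i : exists j, 0 < P i j.
Proof.
apply: contrapT => /forallNP h; have := P1 i; rewrite big1 => [/esym/eqP|j _]; first by rewrite oner_eq0.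
by apply/eqP; rewrite eq_le P0 andbT leNgt; apply/negP/h.
Qed.

Definition full_support theta := forall i j, 0 < P i j -> 0 < theta i j.

Lemma full_support_thetabar theta : simplexDelta P theta -> full_support theta ->
  forall i, 0 < thetabar theta i.
Proof.
move=> [t0 _] ft i; have [j Pij] := exists_edge i.
exact: (thetabar_gt0 t0 (ft _ _ Pij)).
Qed.

Lemma sum_thetabar theta : \sum_i thetabar theta i = \sum_i \sum_j theta i j.
Proof. by []. Qed.

(** Balance says that the row masses of both matrices are stationary for the common kernel; they
    agree by uniqueness, and so do the matrices. *)
Lemma same_kernel_eq theta theta' : simplexDelta P theta -> simplexDelta P theta' ->
  full_support theta ->
  (forall i j, theta' i j = thetabar theta' i * (theta i j / thetabar theta i)) ->
  theta' = theta.
Proof.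
move=> D D' ft E; have b0 := full_support_thetabar D ft.
move: D D' => [t0 [t1 [tb _]]] [t0' [t1' [tb' _]]].
have bb : thetabar theta' =1 thetabar theta.
  apply: (@stationary_unique (\matrix_(i, j) (theta i j / thetabar theta i))) => //.
  - by move=> i j; rewrite mxE divr_ge0// ltW.
  - by move=> i j Pij; rewrite mxE divr_gt0// ft.
  - move=> j; rewrite /thetabar tb'; apply: eq_bigr => i _.
    by rewrite [RHS]E mxE.
  - move=> j; rewrite [RHS]/thetabar tb; apply: eq_bigr => i _.
    by rewrite mxE mulrCA mulfV ?mulr1// gt_eqF.
apply/matrixP => i j; rewrite E bb mulrCA mulfV ?mulr1// gt_eqF//.
Qed.

(** The pair law of the stationary chain, a point of Delta that charges every edge. *)
Definition edge_measure : 'M[R]_N := \matrix_(i, j) (pi 0 i * P i j).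

Lemma edge_measure_Delta : simplexDelta P edge_measure.
Proof.
split; first by move=> i j; rewrite mxE mulr_ge0// ltW.
have E i : \sum_j edge_measure i j = pi 0 i.
  by under eq_bigr do rewrite mxE; rewrite -mulr_sumr P1 mulr1.
split; first by under eq_bigr do rewrite E.
split=> [i|i j Pij].
  rewrite E -{1}piP mxE; apply: eq_bigr => j _; by rewrite mxE.
have Pij0 : P i j = 0 by apply/eqP; rewrite eq_le P0 andbT leNgt.
by rewrite mxE Pij0 mulr0.
Qed.

Lemma simplexDelta_mix theta1 theta2 (a : R) : 0 <= a <= 1 ->
  simplexDelta P theta1 -> simplexDelta P theta2 ->
  simplexDelta P (a *: theta1 + (1 - a) *: theta2).
Proof.
move=> /andP[a0 a1] [t10 [t11 [t1b t1P]]] [t20 [t21 [t2b t2P]]].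
have b0 : 0 <= 1 - a by rewrite subr_ge0.
split; first by move=> i j; rewrite !mxE addr_ge0// mulr_ge0.
split.
  transitivity (a * (\sum_i \sum_j theta1 i j) + (1 - a) * (\sum_i \sum_j theta2 i j)).
    rewrite !mulr_sumr -big_split; apply: eq_bigr => i _ /=.
    by rewrite !mulr_sumr -big_split; apply: eq_bigr => j _ /=; rewrite !mxE.
  by rewrite t11 t21 !mulr1 addrC subrK.
split=> [i|i j Pij]; last by rewrite !mxE t1P// t2P// !mulr0 addr0.
transitivity (a * \sum_j theta1 i j + (1 - a) * \sum_j theta2 i j).
  by rewrite !mulr_sumr -big_split; apply: eq_bigr => j _ /=; rewrite !mxE.
rewrite t1b t2b !mulr_sumr -big_split; apply: eq_bigr => j _ /=; by rewrite !mxE.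
Qed.

Lemma thetabar_le1 theta i : simplexDelta P theta -> thetabar theta i <= 1.
Proof.
move=> [t0 [t1 _]]; rewrite -t1 -sum_thetabar (bigD1 i)//= lerDl.
by rewrite sumr_ge0// => k _; exact: thetabar_ge0.
Qed.

(** The real value of [Jfun] where it is finite: as 0 has inverse 0, rows without mass contribute
    nothing. *)
Definition Jreal theta xi : R := \sum_i xi 0 i ^+ 2 / thetabar theta i / 2.

Lemma Jfun_finite theta xi (h : R) : simplexDelta P theta -> (Jfun theta xi <= h%:E)%E ->
  Jfun theta xi = (Jreal theta xi)%:E /\
  (forall i, thetabar theta i = 0 -> xi 0 i = 0).
Proof.
move=> [t0 _]; rewrite /Jfun; case: ifPn => [/forallP b0 _|]; last by rewrite leye_eq.
split; last by move=> i bi; have := b0 i; rewrite bi eqxx => /eqP.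
congr EFin; rewrite /Jreal big_mkcond; apply: eq_bigr => i _.
case: ifPn => bi; first by rewrite mulrCA mulrA.
have -> : thetabar theta i = 0 by apply/eqP; rewrite eq_le thetabar_ge0// andbT leNgt.
by rewrite invr0 mulr0 mul0r.
Qed.

Lemma Jreal_ge0 theta xi : simplexDelta P theta -> 0 <= Jreal theta xi.
Proof.
move=> [t0 _]; apply: sumr_ge0 => i _.
by rewrite !divr_ge0 ?sqr_ge0 ?thetabar_ge0.
Qed.

(* xi is scaled by a ^+ 2 rather than a, so that J <= H becomes strict unless both
   sides vanish. *)
Lemma interior_approx theta xi (a : R) : simplexDelta P theta ->
  (Jfun theta xi <= (entropyH theta)%:E)%E -> 0 < a < 1 ->
  let theta' := a *: theta + (1 - a) *: edge_measure in
  let xi' := a ^+ 2 *: xi in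
  [/\ simplexDelta P theta', full_support theta',
   Jreal theta' xi' < entropyH theta' \/ (entropyH theta' = 0 /\ xi' = 0) &
   a * (entropyH theta - Jreal theta xi) <= entropyH theta' - Jreal theta' xi'].
Proof.
move=> D JH a01 theta' xi'; have /andP[a0 a1] := a01.
have [JE xi0] := Jfun_finite D JH.
move: JH; rewrite JE lee_fin => JH.
have De := edge_measure_Delta.
have D' : simplexDelta P theta' by apply: simplexDelta_mix => //; rewrite !ltW.
have [t0 _] := D; have [e0 _] := De; have [t0' _] := D'.
have ft : full_support theta'.
  move=> i j Pij; rewrite !mxE ltr_wpDl ?mulr_ge0 ?(ltW a0)// mulr_gt0 ?subr_gt0//.
  by rewrite mulr_gt0.
have H' : a * entropyH theta <= entropyH theta' by exact: entropyH_mix.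
(* The numerators gain a factor a^4, while the row masses of theta' are at least a times those of
   theta. *)
have J' : Jreal theta' xi' <= a ^+ 3 * Jreal theta xi.
  rewrite /Jreal mulr_sumr ler_sum// => i _; rewrite /xi' mxE.
  have [bi|bi] := eqVneq (thetabar theta i) 0.
    by rewrite xi0// mulr0 expr0n/= !mul0r mulr0.
  have b0 : 0 < thetabar theta i by rewrite lt_def bi thetabar_ge0.
  have b0' : a * thetabar theta i <= thetabar theta' i.
    by rewrite thetabar_mix lerDl mulr_ge0 ?subr_ge0 ?(ltW a1)// thetabar_ge0.
  have ab0 : 0 < a * thetabar theta i by rewrite mulr_gt0.
  rewrite mulrA ler_pM2r ?invr_gt0//.
  apply: (@le_trans _ _ ((a ^+ 2 * xi 0 i) ^+ 2 / (a * thetabar theta i))).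
    rewrite ler_wpM2l ?sqr_ge0// lef_pV2 ?posrE//.
    exact: lt_le_trans b0'.
  rewrite le_eqVlt; apply/orP; left; apply/eqP; field.
  by rewrite !gt_eqF.
have J0 := Jreal_ge0 xi D; have J0' := Jreal_ge0 xi' D'.
have H0 := entropyH_ge0 t0; have H0' := entropyH_ge0 t0'.
have a2 : 0 < a ^+ 2 < 1 by rewrite exprn_gt0// exprn_ilt1 ?ltW.
have a3 : a ^+ 3 = a ^+ 2 * a by rewrite exprSr.
(* Indeed a^3 J <= a^2 (a H), and a H is at most the entropy of the mixture; the factor a^2 < 1 then
   gives strictness. *)
have J'' : Jreal theta' xi' <= a ^+ 2 * entropyH theta'.
  rewrite (le_trans J')// a3 -mulrA ler_wpM2l ?sqr_ge0//.
  by rewrite (le_trans _ H')// ler_wpM2l// ltW.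
split => //; last by rewrite mulrBr lerB// (le_trans J')// a3 -[leRHS]mul1r -mulrA ler_wpM2r ?mulr_ge0 ?(ltW a0)//; case/andP: a2 => _ /ltW.
have [H'0|H'n] := eqVneq (entropyH theta') 0.
  right; split => //; apply/rowP => i; rewrite [RHS]mxE.
  have : Jreal theta' xi' = 0 by apply/eqP; rewrite eq_le J0' andbT (le_trans J'')// H'0 mulr0.
  move=> /eqP; rewrite /Jreal psumr_eq0; last first.
    by move=> m _; rewrite !divr_ge0 ?sqr_ge0 ?thetabar_ge0.
  move=> /allP/(_ i (mem_index_enum i)) /=; rewrite !mulf_eq0 orbb !invr_eq0.
  by rewrite pnatr_eq0 orbF (gt_eqF (full_support_thetabar D' ft i)) orbF => /eqP.
left; rewrite (le_lt_trans J'')// -[ltRHS]mul1r ltr_pM2r//; first by case/andP: a2.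
by rewrite lt_def H'n.
Qed.

End Delta.

(** * Neighbourhoods that path frequencies avoid *)

Section OutsideDelta.
Context (R : realType) (N : nat).
Implicit Types (theta : 'M[R]_N) (xi : 'rV[R]_N).

Lemma nbhs_lt_continuous (T : topologicalType) (f : T -> R) x a :
  continuous f -> f x < a -> nbhs x [set y | f y < a].
Proof. by move=> fc fx; apply: (cvgr_lt (f x)) => //; exact: fc. Qed.

Lemma nbhs_gt_continuous (T : topologicalType) (f : T -> R) x a :
  continuous f -> a < f x -> nbhs x [set y | a < f y].
Proof. by move=> fc fx; apply: (cvgr_gt (f x)) => //; exact: fc. Qed.

Lemma nbhs_neq_continuous (T : topologicalType) (f : T -> R) x a :
  continuous f -> f x != a -> nbhs x [set y | f y != a].
Proof.
move=> fc; rewrite neq_lt => /orP[h|h].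
  by apply: filterS (nbhs_lt_continuous fc h) => y /=; move=> h'; rewrite lt_eqF.
by apply: filterS (nbhs_gt_continuous fc h) => y /= h'; rewrite gt_eqF.
Qed.

Context (P : 'M[R]_N) (pi : 'rV[R]_N).
Hypotheses (P0 : forall i j, 0 <= P i j) (pi0 : forall i, 0 < pi 0 i).

Lemma near_inv_lt (e : R) : 0 < e -> \forall t \near \oo, (t%:R)^-1 < e :> R.
Proof.
move=> e0; near=> t.
rewrite invf_plt ?posrE//; last by rewrite ltr0n; near: t; exact: nbhs_infty_gt.
near: t; exact: nbhs_infty_gtr.
Unshelve. all: by end_near. Qed.

(** A violated condition of Delta stays violated nearby. For t >= 1 frequencies satisfy positivity,
    total mass and balance exactly, and the support condition up to 1/t, so the last case needs
    large t. *)
Lemma outside_Delta_nbhs theta : ~ simplexDelta P theta ->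
  exists2 U, nbhs theta U & \forall t \near \oo,
    forall s : t.-tuple 'I_N, inS pi P s -> ~ U (Theta R s).
Proof.
have cM i j : continuous (fun M : 'M[R]_N => M i j) by exact: coord_continuous.
have cr i : continuous (fun M : 'M[R]_N => \sum_j M i j).
  by apply: continuous_sum_fun => j; exact: cM.
have cc i : continuous (fun M : 'M[R]_N => \sum_j M j i).
  by apply: continuous_sum_fun => j; exact: cM.
move=> nD.
have [neg|nneg] := pselect (exists i j, theta i j < 0).
  have [i [j tij]] := neg.
  exists [set M | M i j < 0]; first exact: nbhs_lt_continuous.
  by apply: nearW => t s _ /=; rewrite ltNge Theta_ge0.
have t0 i j : 0 <= theta i j.
  by rewrite leNgt; apply/negP => h; apply: nneg; exists i, j.
have [s1|ns1] := eqVneq (\sum_i \sum_j theta i j) 1; last first.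
  exists [set M : 'M[R]_N | \sum_i \sum_j M i j != 1].
    by apply: (@nbhs_neq_continuous _ (fun M : 'M[R]_N => \sum_i \sum_j M i j)) => //; exact: continuous_sum_fun.
  apply: nearW => -[|t] s /=; first by rewrite inS0.
  by rewrite Theta_sum1 eqxx.
have [nb|b] := pselect (exists i, \sum_j theta i j - \sum_j theta j i != 0).
  have [i bi] := nb.
  exists [set M : 'M[R]_N | \sum_j M i j - \sum_j M j i != 0].
    apply: (@nbhs_neq_continuous _ (fun M : 'M[R]_N => \sum_j M i j - \sum_j M j i)) => //.
    by move=> M; exact: (cvgB (cr i M) (cc i M)).
  by apply: nearW => t s _ /=; rewrite Theta_balanced subrr eqxx.
have [off|noff] := pselect (exists i j, ~~ (0 < P i j) /\ 0 < theta i j).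
  have [i [j [Pij tij]]] := off.
  exists [set M : 'M[R]_N | theta i j / 2 < M i j].
    by apply: nbhs_gt_continuous => //; rewrite ltr_pdivrMr// ltr_pMr// ltr1n.
  have : 0 < theta i j / 2 by rewrite divr_gt0.
  move=> /near_inv_lt; apply: filterS => t ht s Ss /=; apply/negP; rewrite -leNgt.
  by rewrite (le_trans (inS_Theta_le P0 pi0 Ss Pij))// ltW.
exfalso; apply: nD; split => //; split => //; split => [i|i j Pij].
  apply/eqP; rewrite -subr_eq0; apply: contrapT => /negP h; apply: b; by exists i.
apply/eqP; rewrite eq_le t0 andbT leNgt; apply/negP => h; apply: noff; by exists i, j.
Qed.

End OutsideDelta.

(** * Upper bound *)

Section GaussianField.
Context (R : realType) (N : nat) (P : 'M[R]_N) (pi : 'rV[R]_N)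
  (d : measure_display) (Omega : measurableType d) (Pr : probability Omega R)
  (Z : forall t : nat, t.-tuple 'I_N -> 'I_t -> Omega -> R).
Hypotheses (NZ : forall a, Zdom pi P a -> std_normal_rv Pr (Zfam Z a))
  (indZ : mutually_independent Pr (Zdom pi P) (Zfam Z)).

Definition Zblock (t : nat) (s : t.-tuple 'I_N) : seq (Zindex N) :=
  [seq existT (fun t : nat => (t.-tuple 'I_N * 'I_t)%type) t (s, k) | k <- enum 'I_t].

Lemma Zblock_uniq t (s : t.-tuple 'I_N) : uniq (Zblock s).
Proof.
rewrite map_inj_uniq ?enum_uniq// => k1 k2 /eqP; rewrite -tag_eqE /tag_eq /= eqxx /=.
by rewrite tagged_asE xpair_eqE eqxx => /eqP.
Qed.

Lemma Zblock_dom t (s : t.-tuple 'I_N) : inS pi P s ->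
  forall a, a \in Zblock s -> Zdom pi P a.
Proof. by move=> Ss a /mapP[k _ ->]. Qed.

Lemma Zblock_disjoint t (s s' : t.-tuple 'I_N) : s != s' -> uniq (Zblock s ++ Zblock s').
Proof.
move=> ss'; rewrite cat_uniq !Zblock_uniq andbT/=; apply/hasPn => a /mapP[k _ ->].
apply/negP => /mapP[k' _] /eqP; rewrite -tag_eqE /tag_eq /= eqxx /= tagged_asE.
by rewrite xpair_eqE => /andP[/eqP ss _]; rewrite ss eqxx in ss'.
Qed.

Lemma Zmeasurable t (s : t.-tuple 'I_N) k : inS pi P s -> measurable_fun setT (Z s k).
Proof. by move=> Ss; have [] := @NZ (existT _ t (s, k)) Ss. Qed.

Lemma sum_Zblock t (s : t.-tuple 'I_N) (c : 'I_N -> R) w :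
  \sum_(a <- Zblock s) c (tnth (tagged a).1 (tagged a).2) * Zfam Z a w =
  \sum_k c (tnth s k) * Z s k w.
Proof. by rewrite big_map enumT. Qed.

Lemma sum_Zcal t (s : t.-tuple 'I_N) (l : 'rV[R]_N) w : inS pi P s ->
  t%:R * (\sum_i l 0 i * Zcal Z s w 0 i) = \sum_k l 0 (tnth s k) * Z s k w.
Proof.
case: t s => [s|t s Ss]; first by rewrite inS0.
rewrite [RHS](partition_big (fun k => tnth s k) predT)//= mulr_sumr.
apply: eq_bigr => i _; rewrite mxE [X in _ * X]mulrCA mulVKf ?pnatr_eq0// mulr_sumr.
by apply: eq_bigr => k /eqP ->.
Qed.

Lemma sum_thetabar_Theta t (s : t.-tuple 'I_N) (c : 'I_N -> R) : inS pi P s ->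
  t%:R * (\sum_i c i * thetabar (Theta R s) i) = \sum_k c (tnth s k).
Proof.
case: t s => [s|t s Ss]; first by rewrite inS0.
rewrite [RHS](partition_big (fun k => tnth s k) predT)//= mulr_sumr.
apply: eq_bigr => i _; rewrite thetabar_Theta mulrCA [X in _ * X]mulrCA divff ?pnatr_eq0// mulr1.
rewrite (eq_bigr (fun=> c i)); last by move=> k /eqP ->.
rewrite sumr_const -[RHS]mulr_natr; congr (_ * _).
by rewrite -sum1_count big_tuple sum1_card.
Qed.

(** The exponent is \sum_k l_(s_k) Z_k; grouping the variances l_(s_k)^2 by vertex gives t \sum_i
    l_i^2 bar(theta)_i. *)
Lemma Zcal_mgf t (s : t.-tuple 'I_N) (l : 'rV[R]_N) : inS pi P s ->
  (\int[Pr]_w (expR (t%:R * (\sum_i l 0 i * Zcal Z s w 0 i)))%:E =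
   (expR (t%:R * (\sum_i l 0 i ^+ 2 * thetabar (Theta R s) i / 2)))%:E)%E.
Proof.
move=> Ss; under eq_integral do rewrite sum_Zcal// -(sum_Zblock s (fun i => l 0 i)).
rewrite (integral_expR_sum NZ indZ (fun a => l 0 (tnth (tagged a).1 (tagged a).2)));
  [|exact: Zblock_uniq|exact: Zblock_dom].
congr (expR _)%:E; under [in RHS]eq_bigr do rewrite mulrAC.
by rewrite (sum_thetabar_Theta (fun i => l 0 i ^+ 2 / 2))// big_map enumT.
Qed.

Lemma measurable_Zcal t (s : t.-tuple 'I_N) i : inS pi P s ->
  measurable_fun setT (fun w => Zcal Z s w 0 i).
Proof.
move=> Ss; under eq_fun do rewrite mxE.
apply: measurable_funM => //; under eq_fun do rewrite big_mkcond.
by apply: measurable_sum => k; case: (tnth s k == i) => //; exact: Zmeasurable.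
Qed.

Lemma measurable_sum_Zcal t (s : t.-tuple 'I_N) (l : 'rV[R]_N) : inS pi P s ->
  measurable_fun setT (fun w => \sum_i l 0 i * Zcal Z s w 0 i).
Proof.
by move=> Ss; apply: measurable_sum => i; apply: measurable_funM => //; exact: measurable_Zcal.
Qed.

(** Written exactly as the numerator of [Qemp], so that [QempE] holds by conversion. *)
Definition hits (t : nat) (w : Omega) (U : set ('M[R]_N * 'rV[R]_N)) : R :=
  (#|[set s : t.-tuple 'I_N |
        inS pi P s && `[< U (Theta R s, Zcal Z s w) >] ]|)%:R.

Lemma hitsE t w U : hits t w U =
  \sum_(s : t.-tuple 'I_N | inS pi P s) (`[< U (Theta R s, Zcal Z s w) >])%:R.
Proof.
rewrite /hits card_mkset -sum1_card natr_sum big_mkcond [RHS]big_mkcond.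
apply: eq_bigr => s _; rewrite unfold_in /=.
by case: (inS pi P s) => //=; case: asbool.
Qed.

Lemma hits_ge0 t w U : 0 <= hits t w U. Proof. exact: ler0n. Qed.

Lemma hits_sub t w (U V : set ('M[R]_N * 'rV[R]_N)) :
  (forall s : t.-tuple 'I_N, inS pi P s -> U (Theta R s, Zcal Z s w) -> V (Theta R s, Zcal Z s w)) ->
  hits t w U <= hits t w V.
Proof.
move=> UV; rewrite !hitsE ler_sum// => s Ss; rewrite ler_nat.
by case: asboolP => // /(UV _ Ss) h; rewrite asboolT.
Qed.

Lemma hits_setU t w U V : hits t w (U `|` V) <= hits t w U + hits t w V.
Proof.
rewrite !hitsE -big_split ler_sum// => s Ss /=; rewrite -natrD ler_nat.
by case: asboolP => // -[/asboolT->|/asboolT->]; rewrite ?leq_addr ?leq_addl.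
Qed.

Definition PhiP F (l : 'rV[R]_N) (x : 'M[R]_N * 'rV[R]_N) := Phi F l x.1 x.2.

(* \sum_s expR (t Phi) has expectation at most N, the Gaussian factors having
   expectation 1 and the weights expR (F i j) being substochastic. *)
Lemma hits_PhiP_le (F : 'I_N -> 'I_N -> R) (l : 'rV[R]_N) (h e : R) :
  (forall i, \sum_j expR (F i j) <= 1) -> 0 < e ->
  {ae Pr, forall w, \forall t \near \oo,
     hits t w [set x | h < PhiP F l x] <= expR (- (t%:R * (h - e)))}.
Proof.
move=> F1 e0.
(* The prefactor makes the expectation at most N exp(-t e), so eventually f < 1 almost surely. *)
pose f t w := expR (- (t%:R * e)) *
  \sum_(s : t.-tuple 'I_N | inS pi P s) expR (t%:R * PhiP F l (Theta R s, Zcal Z s w)).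
have PhiE t (s : t.-tuple 'I_N) w : expR (t%:R * PhiP F l (Theta R s, Zcal Z s w)) =
    expR (t%:R * (\sum_i \sum_j Theta R s i j * F i j
      - \sum_i l 0 i ^+ 2 * thetabar (Theta R s) i / 2)) *
    expR (t%:R * (\sum_i l 0 i * Zcal Z s w 0 i)).
  by rewrite -expRD /PhiP /Phi /=; congr expR; ring.
have mE t (s : t.-tuple 'I_N) : inS pi P s ->
    measurable_fun setT (fun w => expR (t%:R * PhiP F l (Theta R s, Zcal Z s w))).
  move=> Ss; under eq_fun do rewrite PhiE.
  apply: measurable_funM => //; apply: measurableT_comp => //.
  by apply: measurable_funM => //; exact: measurable_sum_Zcal.
have mf t : measurable_fun setT (f t).
  apply: measurable_funM => //; under eq_fun do rewrite big_mkcond.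
  by apply: measurable_sum => s; case: (boolP (inS pi P s)) => [Ss|_] //; exact: mE.
have f0 t w : 0 <= f t w by rewrite mulr_ge0 ?expR_ge0 ?sumr_ge0// => s _; exact: expR_ge0.
have intf : \forall t \near \oo, (\int[Pr]_w (f t w)%:E <= (N%:R * expR (- (t%:R * e)))%:E)%E.
  near=> t; rewrite /f; under eq_integral do rewrite EFinM.
  rewrite ge0_integralZl//; first last.
  - by move=> w _; rewrite lee_fin sumr_ge0// => s _; exact: expR_ge0.
  - apply/measurable_EFinP; under eq_fun do rewrite big_mkcond.
    by apply: measurable_sum => s; case: (boolP (inS pi P s)) => [Ss|_] //; exact: mE.
  rewrite [X in (_ <= X)%E]EFinM [X in (_ <= X)%E]muleC lee_wpmul2l ?lee_fin ?expR_ge0//.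
  under eq_integral do rewrite -sumEFin big_mkcond.
  rewrite ge0_integral_sum//; first last.
  - by move=> s w _; case: ifP => // _; rewrite lee_fin expR_ge0.
  - move=> s; case: (boolP (inS pi P s)) => [Ss|_] //; apply/measurable_EFinP; exact: mE.
  have t0 : (0 < t)%N by near: t; exact: nbhs_infty_gt.
  apply: (@le_trans _ _ (\sum_(s : t.-tuple 'I_N) (expR (t%:R * (\sum_i \sum_j Theta R s i j * F i j)))%:E)).
    apply: lee_sum => s _; case: (boolP (inS pi P s)) => [Ss|_]; last by rewrite integral0 lee_fin expR_ge0.
    under eq_integral do rewrite PhiE EFinM.
    rewrite ge0_integralZl//; first last.
      - apply/measurable_EFinP; apply: measurableT_comp => //.
      by apply: measurable_funM => //; exact: measurable_sum_Zcal.
    by rewrite Zcal_mgf// -EFinM -expRD lee_fin ler_expR mulrBr subrK.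
  rewrite sumEFin lee_fin; under eq_bigr do rewrite sum_Theta.
  by case: (t) t0 => // t' _; exact: sum_expR_Kcount_le.
have := ae_eventually_lt1 mf f0 e0 intf.
apply: filterS => w; apply: filterS => t ft.
rewrite (_ : - (t%:R * (h - e)) = t%:R * e + - (t%:R * h)); last by ring.
rewrite expRD -ler_pdivrMr ?expR_gt0// -expRN opprK.
(* Each path counted in [hits] contributes at least exp(t h) to this sum. *)
apply: (@le_trans _ _ (\sum_(s : t.-tuple 'I_N | inS pi P s) expR (t%:R * PhiP F l (Theta R s, Zcal Z s w)))).
  rewrite hitsE mulr_suml ler_sum// => s Ss; case: asboolP => /= [hs|_]; last by rewrite mul0r expR_ge0.
  by rewrite mul1r ler_expR ler_wpM2l// ltW.
move: ft; rewrite /f expRN mulrC ltr_pdivrMr ?expR_gt0// mul1r; exact: ltW.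
Unshelve. all: by end_near. Qed.

End GaussianField.

(** * From exponential sums over paths to closed sets *)

Section Upper.
Context (R : realType) (n : nat).
Notation N := n.+1.
Context (P : 'M[R]_N) (pi : 'rV[R]_N)
  (d : measure_display) (Omega : measurableType d) (Pr : probability Omega R)
  (Z : forall t : nat, t.-tuple 'I_N -> 'I_t -> Omega -> R).
Hypotheses (P0 : forall i j, 0 <= P i j) (P1 : forall i, \sum_j P i j = 1)
  (irr : irreducible P) (pi0 : forall i, 0 < pi 0 i)
  (NZ : forall a, Zdom pi P a -> std_normal_rv Pr (Zfam Z a))
  (indZ : mutually_independent Pr (Zdom pi P) (Zfam Z)).
Local Notation L := (ln (spectral_radius (zero_one_mx P))).
Local Notation hits := (hits P pi Z).

Lemma rho_ge1 : 1 <= spectral_radius (zero_one_mx P).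
Proof. by have [c []] := Ct_growth P0 P1 irr pi0. Qed.

Lemma L_ge0 : 0 <= L.
Proof. by rewrite ln_ge0// rho_ge1. Qed.

Lemma Ct_ge t : expR (t%:R * L) <= (Ct pi P t.+1)%:R.
Proof.
have [c [r1 /(_ t)/andP[+ _]]] := Ct_growth P0 P1 irr pi0.
by rewrite mulrC expRM_natr lnK// posrE (lt_le_trans _ r1).
Qed.

Lemma Ct_le : exists2 c : R, 0 < c & forall t, (Ct pi P t)%:R <= c * expR (t%:R * L).
Proof.
have [c [r1 cP]] := Ct_growth P0 P1 irr pi0.
exists (`|c| + 1) => [|[|t]]; first by rewrite ltr_wpDl.
  rewrite mul0r expR0 mulr1 /Ct card_mkset eq_card0 ?addr_ge0// => s.
  by rewrite unfold_in /= (tuple0 s) /inS /= ltxx.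
have /andP[_ h] := cP t; apply: (le_trans h); apply: ler_pM => //.
- rewrite -(@pmulr_lge0 _ (spectral_radius (zero_one_mx P) ^+ t)); last first.
    by rewrite exprn_gt0// (lt_le_trans _ r1).
  exact: le_trans h.
- by rewrite exprn_ge0// (le_trans _ r1).
- by rewrite (le_trans (ler_norm c))// lerDl.
- rewrite mulrC expRM_natr lnK ?posrE ?(lt_le_trans _ r1)//.
  by rewrite exprS ler_peMl// exprn_ge0// (le_trans _ r1).
Qed.

Lemma QempE t w U : Qemp pi P Z t w U = hits t w U / (Ct pi P t)%:R.
Proof. by []. Qed.

Lemma Qemp_ge0 t w U : 0 <= Qemp pi P Z t w U.
Proof. by rewrite QempE divr_ge0. Qed.

(** The factor exp(L) compensates for the t edges of a path with t + 1 vertices. *)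
Lemma Qemp_le_hits t w U : Qemp pi P Z t.+1 w U <= expR L * (hits t.+1 w U * expR (- (t.+1%:R * L))).
Proof.
rewrite QempE mulrCA ler_wpM2l ?hits_ge0// -expRD -[X in expR X]opprK expRN lef_pV2.
- apply: le_trans (Ct_ge t); rewrite ler_expR -[t.+1]addn1 natrD; lra.
- by rewrite posrE (lt_le_trans _ (Ct_ge t))// expR_gt0.
- by rewrite posrE expR_gt0.
Qed.

(** The constant C allows finite unions, as [compact_ind] requires, and disappears on the
    exponential scale. *)
Definition exp_bounded (a : R) (U : set ('M[R]_N * 'rV[R]_N)) : Prop :=
  exists2 C, 0 <= C &
    {ae Pr, forall w, \forall t \near \oo, Qemp pi P Z t w U <= C * expR (- (t%:R * a))}.

Lemma exp_bounded_hits a U : {ae Pr, forall w, \forall t \near \oo,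
    hits t w U <= expR (- (t%:R * (a - L)))} -> exp_bounded a U.
Proof.
move=> aeU; exists (expR L); first exact: expR_ge0.
apply: filterS aeU => w [t0 _ ht0]; exists t0.+1 => // -[//|t] /= t0t.
apply: le_trans (Qemp_le_hits _ _ _) _; rewrite ler_pM2l ?expR_gt0//.
have /= := ht0 _ (leq_trans (leqnSn _) t0t) => h.
apply: (le_trans (ler_wpM2r (expR_ge0 _) h)).
by rewrite -expRD ler_expR; lra.
Qed.

(** A count below 1 is 0, so every rate [a] is allowed; this produces the value +oo of the rate
    function. *)
Lemma exp_bounded_hits0 a U : {ae Pr, forall w, \forall t \near \oo, hits t w U < 1} ->
  exp_bounded a U.
Proof.
move=> aeU; exists 0 => //; apply: filterS aeU => w; apply: filterS => t.
by rewrite QempE /hits -[1]/(1%:R) ltr_nat ltnS leqn0 => /eqP ->; rewrite !mul0r.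
Qed.

(** Inclusion is asked only at points realized by admissible paths, so constraints satisfied by
    every path may be added to V. *)
Lemma exp_bounded_sub a (U V : set ('M[R]_N * 'rV[R]_N)) :
  (forall t (s : t.-tuple 'I_N) w, inS pi P s ->
     U (Theta R s, Zcal Z s w) -> V (Theta R s, Zcal Z s w)) ->
  exp_bounded a V -> exp_bounded a U.
Proof.
move=> UV [C C0 aeV]; exists C => //; apply: filterS aeV => w; apply: filterS => t.
apply: le_trans; rewrite !QempE ler_wpM2r// hits_sub// => s; exact: UV.
Qed.

Lemma exp_bounded0 a : exp_bounded a set0.
Proof.
apply: exp_bounded_hits0; apply: aeW => w; apply: nearW => t.
by rewrite hitsE big1// => s _; rewrite asboolF.
Qed.

Lemma exp_boundedU a U V : exp_bounded a U -> exp_bounded a V -> exp_bounded a (U `|` V).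
Proof.
move=> [C C0 aeU] [C' C0' aeV]; exists (C + C'); first exact: addr_ge0.
apply: filterS2 aeU aeV => w; apply: filterS2 => t hU hV.
rewrite mulrDl (le_trans _ (lerD hU hV))// !QempE -mulrDl ler_wpM2r//.
exact: hits_setU.
Qed.

Lemma exp_bounded_bigU a (I : finType) (U : I -> set ('M[R]_N * 'rV[R]_N)) :
  (forall i, exp_bounded a (U i)) -> exp_bounded a [set x | exists i, U i x].
Proof.
move=> Ub; suff : exp_bounded a [set x | exists2 i, i \in enum I & U i x].
  by apply: exp_bounded_sub => t s w _ [i Ui]; exists i => //; rewrite mem_enum.
elim: (enum I) => [|i r IH].
  by apply: exp_bounded_sub (exp_bounded0 a) => t s w _ [].
apply: exp_bounded_sub (exp_boundedU (Ub i) IH) => t s w _ [j].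
by rewrite in_cons => /orP[/eqP->|jr] Uj; [left|right; exists j].
Qed.

Lemma PhiP_continuous F l : continuous (@PhiP R N F l).
Proof.
have c1 i j : continuous (fun x : 'M[R]_N * 'rV[R]_N => x.1 i j).
  move=> p; apply: (@continuous_comp _ _ _ fst (fun x : 'M[R]_N => x i j)).
    exact: cvg_fst.
  exact: coord_continuous.
have c2 i : continuous (fun x : 'M[R]_N * 'rV[R]_N => x.2 0 i).
  move=> p; apply: (@continuous_comp _ _ _ snd (fun x : 'rV[R]_N => x 0 i)).
    exact: cvg_snd.
  exact: coord_continuous.
have k1 : continuous (fun x : 'M[R]_N * 'rV[R]_N => \sum_i \sum_j x.1 i j * F i j).
  apply: continuous_sum_fun => i; apply: continuous_sum_fun => j x.
  by apply: cvgM; [exact: c1|exact: cvg_cst].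
have k2 : continuous (fun x : 'M[R]_N * 'rV[R]_N => \sum_i l 0 i * x.2 0 i).
  by apply: continuous_sum_fun => i x; apply: cvgM; [exact: cvg_cst|exact: c2].
have k3 : continuous (fun x : 'M[R]_N * 'rV[R]_N => \sum_i l 0 i ^+ 2 * thetabar x.1 i / 2).
  apply: continuous_sum_fun => i x; apply: cvgM; last exact: cvg_cst.
  apply: cvgM; first exact: cvg_cst.
  have kt : continuous (fun x : 'M[R]_N * 'rV[R]_N => thetabar x.1 i).
    by apply: continuous_sum_fun => j; exact: c1.
  exact: kt.
by move=> x; exact: (cvgB (cvgD (k1 x) (k2 x)) (k3 x)).
Qed.

Lemma exp_bounded_local a x : (a%:E < rateI P x)%E ->
  exists2 U, nbhs x U & exp_bounded a U.
Proof.
case: x => theta xi aI.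
have [D|nD] := pselect (simplexDelta P theta); last first.
  have [U Uth hU] := outside_Delta_nbhs P0 pi0 nD.
  exists (fst @^-1` U); first exact: cvg_fst.
  apply: exp_bounded_hits0; apply: aeW => w; apply: filterS hU => t hU.
  by rewrite hitsE big1// => s Ss; rewrite asboolF//; exact: hU.
have [t0 [t1 _]] := D.
have [JH|] := boolP (Jfun theta xi <= (entropyH theta)%:E)%E; last first.
  rewrite -ltNge => HJ.
  have [|F [l [F1 Phi0]]] := @Jfun_variational _ _ theta xi 0 t0 t1; first by rewrite add0r.
  (* Phi is positive at the point, so h > 0; the loss h/2 leaves exp(-t h/2) < 1 for t >= 1, and no
     path remains near the point. *)
  pose h := PhiP F l (theta, xi) / 2.
  have h0 : 0 < h by rewrite divr_gt0.
  exists [set x | h < PhiP F l x].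
    by apply: nbhs_gt_continuous; [exact: PhiP_continuous|rewrite /h /PhiP /=; lra].
  apply: exp_bounded_hits0.
  have := @hits_PhiP_le _ _ P pi _ _ Pr Z NZ indZ F l h (h / 2) F1.
  rewrite divr_gt0// => /(_ isT); apply: filterS => w [m _ hm]; exists m.+1 => // t /= mt.
  have /= := hm t (leq_trans (leqnSn _) mt) => ht; apply: (le_lt_trans ht).
  have t_gt0 : 0 < t%:R :> R by rewrite ltr0n; case: (t) mt.
  have h2 : 0 < h - h / 2 by lra.
  by rewrite expR_lt1 oppr_lt0 mulr_gt0.
have [JE _] := Jfun_finite D JH.
move: aI; rewrite /rateI /= asboolT//= JH JE -EFinD lte_fin => aI.
have [|F [l [F1 Phi0]]] := @Jfun_variational _ _ theta xi (a - L) t0 t1.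
  by rewrite JE lte_fin; lra.
(* A level strictly between a - L and Phi at the point; the loss h - (a - L) then leaves exactly the
   rate a - L. *)
pose h := ((a - L) + PhiP F l (theta, xi)) / 2.
exists [set x | h < PhiP F l x].
  by apply: nbhs_gt_continuous; [exact: PhiP_continuous|rewrite /h /PhiP /=; lra].
apply: exp_bounded_hits.
have := @hits_PhiP_le _ _ P pi _ _ Pr Z NZ indZ F l h (h - (a - L)) F1.
have -> : h - (h - (a - L)) = a - L by lra.
by apply; rewrite /h /PhiP /=; lra.
Qed.

(* Chernoff with the tilt l = \pm e_i. *)
Lemma exp_tight a : exists M : R,
  exp_bounded a [set x : 'M[R]_N * 'rV[R]_N | exists i : 'I_N, M < `|x.2 0 i|].
Proof.
(* The constant F = - ln N has row sums 1 and contributes - ln N to Phi, and the unit tilt loses at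
   most 1/2, so Phi > a + 1 beyond M. *)
pose M := a + ln N%:R + 2; exists M.
have H (sg : R) i : `|sg| = 1 -> exp_bounded a [set x : 'M[R]_N * 'rV[R]_N | M < sg * x.2 0 i].
  move=> sg1.
  pose l := \row_k (if k == i then sg else 0) : 'rV[R]_N.
  have F1 (k : 'I_N) : \sum_(j < N) expR (- ln N%:R) <= 1 :> R.
    by rewrite sumr_const card_ord expRN lnK ?posrE ?ltr0n// -[X in X <= _]mulr_natr mulVf.
  have := @hits_PhiP_le _ _ P pi _ _ Pr Z NZ indZ (fun _ _ => - ln N%:R) l (a + 1) 1 F1 ltr01.
  rewrite addrK => h.
  apply: (@exp_bounded_sub _ _ [set x | a + 1 < PhiP (fun _ _ => - ln N%:R) l x]); last first.
    apply: exp_bounded_hits; apply: filterS h => w; apply: filterS => t h.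
    apply: (le_trans h); rewrite ler_expR lerN2 ler_wpM2l//.
    by rewrite gerBl L_ge0.
  move=> [|t] s w Ss; first by rewrite inS0 in Ss.
  rewrite /= => Ms; rewrite /PhiP /Phi /=.
  under eq_bigr do rewrite -mulr_suml.
  rewrite -mulr_suml Theta_sum1 mul1r (bigD1 i)//= big1 ?addr0; last first.
    by move=> k /negbTE ki; rewrite mxE ki mul0r.
  have li : l 0 i = sg by rewrite mxE eqxx.
  rewrite li [X in _ - X](bigD1 i)//= [X in _ - (_ + X)]big1 ?addr0; last first.
    by move=> k /negbTE ki; rewrite mxE ki expr0n/= !mul0r.
  rewrite li -real_normK ?num_real// sg1 expr1n mul1r.
  have b1 : thetabar (Theta R s) i <= 1.
    rewrite -(Theta_sum1 R s) (bigD1 i)//= lerDl sumr_ge0// => k _.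
    by rewrite sumr_ge0// => j _; exact: Theta_ge0.
  by move: Ms; rewrite /M; clear F1; lra.
apply: (@exp_bounded_sub _ _ ([set x : 'M[R]_N * 'rV[R]_N | exists i, M < 1 * x.2 0 i] `|` [set x : 'M[R]_N * 'rV[R]_N | exists i, M < -1 * x.2 0 i])).
  move=> t s w _ [k]; rewrite /= ltr_normr => /orP[h|h]; [left|right]; exists k.
    by rewrite mul1r.
  by rewrite mulN1r.
apply: exp_boundedU.
  by apply: (@exp_bounded_bigU _ _ (fun i (x : 'M[R]_N * 'rV[R]_N) => M < 1 * x.2 0 i)) => i; apply: H; rewrite normr1.
by apply: (@exp_bounded_bigU _ _ (fun i (x : 'M[R]_N * 'rV[R]_N) => M < -1 * x.2 0 i)) => i; apply: H; rewrite normrN1.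
Qed.

Lemma exp_bounded_closed a (K : set ('M[R]_N * 'rV[R]_N)) : closed K ->
  (forall x, K x -> (a%:E < rateI P x)%E) -> exp_bounded a K.
Proof.
move=> cK Ka; have [M tight] := exp_tight a.
pose B := [set theta : 'M[R]_N | forall i j, 0 <= theta i j <= 1] `*`
  [set xi : 'rV[R]_N | forall i j, - M <= xi i j <= M].
have cB : compact B.
  by apply: compact_setX; exact: matrix_box_compact.
apply: (@exp_bounded_sub _ _ ((B `&` K) `|` [set x : 'M[R]_N * 'rV[R]_N | exists i, M < `|x.2 0 i|])).
  move=> t s w _ Ks.
  have [h|nh] := pselect (exists i, M < `|Zcal Z s w 0 i|); [by right|left].
  split=> //; split=> /= i j; first by rewrite Theta_ge0 Theta_le1.
  rewrite -ler_norml leNgt; apply/negP => h; apply: nh; exists j.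
  by rewrite (ord1 i) in h.
apply: exp_boundedU => //.
apply: (compact_ind (compact_closedI cB cK)).
- exact: exp_bounded0.
- by move=> U V UV; apply: exp_bounded_sub => t s w _; exact: UV.
- by move=> U V; exact: exp_boundedU.
- by move=> x [_ /Ka]; exact: exp_bounded_local.
Qed.

End Upper.

(** * Lower bound *)

Lemma near_expR_small (R : realType) (C k e : R) : 0 < k -> 0 < e ->
  \forall t \near \oo, C * expR (- (t%:R * k)) <= e.
Proof.
move=> k0 e0; near=> t.
have t0 : 0 < t%:R :> R by rewrite ltr0n; near: t; exact: nbhs_infty_gt.
rewrite expRN ler_pdivrMr ?expR_gt0//.
have h : `|C| / (k * e) <= t%:R by near: t; exact: nbhs_infty_ger.
rewrite (le_trans (ler_norm C))//.
move: h; rewrite ler_pdivrMr ?mulr_gt0// => h; apply: (le_trans h).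
rewrite mulrA mulrC ler_pM2l//.
by rewrite (le_trans _ (expR_ge1Dx _))// lerDr.
Unshelve. all: by end_near. Qed.

(** * Number of paths with frequencies near theta *)

Section CountLower.
Context (R : realType) (n : nat).
Notation N := n.+1.
Context (P : 'M[R]_N) (pi : 'rV[R]_N).
Hypotheses (P0 : forall i j, 0 <= P i j) (P1 : forall i, \sum_j P i j = 1)
  (irr : irreducible P) (pi0 : forall i, 0 < pi 0 i).

Lemma path_prod_ln (Q : 'M[R]_N) x s : path (fun i j => 0 < Q i j) x s ->
  path_prod Q x s = expR (\sum_(p <- zip (x :: s) s) ln (Q p.1 p.2)).
Proof.
elim: s x => [|y s IH] x /=; first by rewrite big_nil expR0.
by move=> /andP[Qxy ps]; rewrite big_cons expRD lnK ?posrE// IH.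
Qed.

Context (theta : 'M[R]_N).
Hypotheses (D : simplexDelta P theta) (ft : full_support P theta).

(* The Markov chain whose pair frequencies are theta: its stationary law is b and
   its kernel is Q. *)
Let b : 'rV[R]_N := \row_i thetabar theta i.
Let Q : 'M[R]_N := \matrix_(i, j) (theta i j / thetabar theta i).
(** At M = Theta(s), the log-likelihood per step of the closed path under the chain; at theta it
    equals - H(theta). *)
Let ell (M : 'M[R]_N) : R := \sum_i \sum_j M i j * ln (Q i j).
(** Bounds the effect of the closing edge, which counts in [ell] but not in the probability of the
    open path; this includes a closing edge outside E. *)
Let K : R := expR (\sum_i \sum_j `|ln (Q i j)|).

Let t0 : forall i j, 0 <= theta i j. Proof. by have [] := D. Qed.
Let bpos i : 0 < b 0 i. Proof. by rewrite mxE (full_support_thetabar P0 P1 D ft). Qed.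
Let Q0 i j : 0 <= Q i j. Proof. by rewrite mxE divr_ge0// thetabar_ge0. Qed.
Let Q1 i : \sum_j Q i j = 1.
Proof.
under eq_bigr do rewrite mxE; rewrite -mulr_suml divff// gt_eqF//.
by have := bpos i; rewrite mxE.
Qed.
Let Qpos i j : (0 < Q i j) = (0 < P i j).
Proof.
apply/idP/idP => [|Pij]; last first.
  by rewrite mxE divr_gt0 ?ft//; have := bpos i; rewrite mxE.
apply: contraTT => nP; rewrite mxE; have [_ [_ [_ ->//]]] := D.
by rewrite mul0r ltxx.
Qed.

Let inSE t (s : t.-tuple 'I_N) : inS b Q s = inS pi P s.
Proof.
case: t s => [|t] s; first by rewrite !inS0.
by rewrite (tuple_eta s) !inS_cons//; apply: eq_path => i j; exact: Qpos.
Qed.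

Let sum_weight t : \sum_(s : t.+1.-tuple 'I_N | inS pi P s) path_weight b Q s = 1.
Proof.
transitivity (\sum_(s : t.+1.-tuple 'I_N) path_weight b Q s).
  rewrite big_mkcond; apply: eq_bigr => s _; case: ifPn => //.
  rewrite -inSE /inS -leNgt => le0; apply/esym/eqP; rewrite eq_le le0/=.
  by rewrite (tuple_eta s) /= mulr_ge0 ?(ltW (bpos _))// path_prod_ge0.
rewrite big_tuple_cons -[RHS](D.2.1); apply: eq_bigr => x _ /=.
by rewrite -mulr_sumr sum_path_prod_eq// mulr1 mxE.
Qed.

Let weight_le t (s : t.-tuple 'I_N) : inS pi P s ->
  path_weight b Q s <= K * expR (t%:R * ell (Theta R s)).
Proof.
case: t s => [s|t s]; first by rewrite inS0.
rewrite (tuple_eta s) -inSE inS_cons// => ps.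
set x := thead s in ps *; set s' := behead_tuple s in ps *.
rewrite /ell sum_Theta sum_Kcount zip_rot1 zip_rcons_cons -cats1 big_cat big_seq1 /=.
rewrite (path_prod_ln ps) /K -expRD.
have bx1 : b 0 x <= 1 by rewrite mxE (thetabar_le1 x D).
apply: (@le_trans _ _ (1 * expR (\sum_(p <- zip (x :: s') s') ln (Q p.1 p.2)))).
  by rewrite ler_wpM2r ?expR_ge0.
rewrite mul1r ler_expR [X in _ <= _ + X]addrC addrA lerDr.
set y := last _ _.
have : - ln (Q y x) <= \sum_i \sum_j `|ln (Q i j)|.
  rewrite (le_trans (ler_norm _))// normrN (bigD1 y)//= (bigD1 x)//= -addrA lerDl.
  by rewrite addr_ge0 ?sumr_ge0// => k _; rewrite sumr_ge0.
lra.
Qed.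

(** Under the chain, the mass of the paths with frequencies in V tends to 0; this too is stable
    under finite unions, so that [compact_ind] applies. *)
Let vanishing (V : set 'M[R]_N) := forall e : R, 0 < e -> \forall t \near \oo,
  \sum_(s : t.-tuple 'I_N | inS pi P s && `[< V (Theta R s) >]) path_weight b Q s <= e.

Let weight_ge0 t (s : t.-tuple 'I_N) : 0 <= path_weight b Q s.
Proof.
case: t s => [|t] s; first by rewrite (tuple0 s).
by rewrite (tuple_eta s) /= mulr_ge0 ?(ltW (bpos _))// path_prod_ge0.
Qed.

Let ell_theta : ell theta = - entropyH theta.
Proof.
rewrite entropyHE opprK; apply: eq_bigr => i _; apply: eq_bigr => j _.
by rewrite mxE.
Qed.

Let linear_continuous (F : 'I_N -> 'I_N -> R) :
  continuous (fun M : 'M[R]_N => \sum_i \sum_j M i j * F i j).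
Proof.
apply: continuous_sum_fun => i; apply: continuous_sum_fun => j x.
have c : continuous (fun M : 'M[R]_N => M i j) by exact: coord_continuous.
exact: (cvgM (c x) (cvg_cst (F i j))).
Qed.

(** For M in Delta, equality in [gibbs] would give M the kernel of theta, hence M = theta by
    [same_kernel_eq]. *)
Let vanishing_local M : M <> theta -> exists2 V, nbhs M V & vanishing V.
Proof.
move=> Mtheta.
have [DM|nD] := pselect (simplexDelta P M); last first.
  have [U UM hU] := outside_Delta_nbhs P0 pi0 nD; exists U => // e e0.
  apply: filterS hU => t hU; rewrite big1 ?ltW// => s /andP[Ss /asboolP Us].
  by case: (hU s Ss Us).
have [M0 [M1 _]] := DM.
have MQ i j : 0 < M i j -> 0 < Q i j.
  rewrite Qpos; apply: contraTT => nP; have [_ [_ [_ ->//]]] := DM; by rewrite ltxx.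
have Q1le i : \sum_j Q i j <= 1 by rewrite Q1.
have [gle geq] := gibbs M0 Q0 MQ Q1le.
(* Of the 3k available, smoothing F costs k; the remaining 2k at M exceeds the level k that defines
   the neighbourhood. *)
pose k := (- ell M - entropyH M) / 3.
have k0 : 0 < k.
  rewrite divr_gt0// subr_gt0 lt_neqAle gle andbT; apply/eqP => E; apply: Mtheta.
  apply: (same_kernel_eq P0 P1 irr D DM ft) => i j.
  by rewrite (geq _ i j) ?mxE// -/(ell M) E.
have [F [F1 FM]] := entropyH_smooth M0 M1 k0.
exists [set M' : 'M[R]_N | k < \sum_i \sum_j M' i j * F i j - ell M'].
  apply: (@nbhs_gt_continuous _ _ (fun M' : 'M[R]_N => \sum_i \sum_j M' i j * F i j - ell M')).
    by move=> x; exact: (cvgB (@linear_continuous F x) (@linear_continuous (fun i j => ln (Q i j)) x)).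
  have : k * 3 = - ell M - entropyH M by rewrite /k divfK.
  by lra.
move=> e e0; have := near_expR_small (K * N%:R) k0 e0.
move=> [m _ hm]; exists m.+1 => // -[//|t] /= mt; apply: le_trans (hm _ (leq_trans (leqnSn _) mt)).
apply: (@le_trans _ _ (\sum_(s : t.+1.-tuple 'I_N)
    K * expR (- (t.+1%:R * k)) * expR (\sum_i \sum_j (Kcount s i j)%:R * F i j))).
  rewrite big_mkcond; apply: ler_sum => s _; case: ifPn => [/andP[Ss /asboolP Vs]|_]; last first.
    by rewrite !mulr_ge0// expR_ge0.
  apply: (le_trans (weight_le Ss)); rewrite -mulrA ler_pM2l ?expR_gt0//.
  rewrite -expRD ler_expR -sum_Theta -mulrN -mulrDr ler_wpM2l//.
  by move: Vs; rewrite /=; lra.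
rewrite -mulr_sumr [leRHS]mulrAC; apply: ler_wpM2l; first by rewrite mulr_ge0 ?expR_ge0.
exact: sum_expR_Kcount_le.
Qed.

(* Under the chain (b, Q), paths with pair frequencies near M <> theta have
   exponentially small mass by the strict Gibbs inequality and the counting bound;
   so paths near theta carry mass 1/2 eventually, each of weight about
   expR (- t H(theta)). *)
Lemma count_lower (U : set 'M[R]_N) (e : R) : nbhs theta U -> 0 < e ->
  \forall t \near \oo, expR (t%:R * (entropyH theta - e)) <=
    (#|[set s : t.-tuple 'I_N | inS pi P s && `[< U (Theta R s) >]]|)%:R.
Proof.
move=> Uth e0.
pose U' := U `&` [set M : 'M[R]_N | ell M < ell theta + e / 2].
have e20 : 0 < e / 2 by rewrite divr_gt0.
have U'th : nbhs theta U'.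
  apply: filterI => //.
  apply: (@nbhs_lt_continuous _ _ ell); first exact: linear_continuous.
  by rewrite ltrDl.
have van : vanishing (~` U').
  pose B := [set M : 'M[R]_N | forall i j, 0 <= M i j <= 1].
  (* All frequencies lie in the box B, and removing only the interior of U' leaves a closed set, so
     the new set is compact. *)
  suff h : vanishing (B `&` ~` (interior U')).
    move=> d /h; apply: filterS => t; apply: le_trans.
    rewrite big_mkcond [leRHS]big_mkcond ler_sum// => s _.
    case: ifPn => [/andP[-> /asboolP nU]|_]; last by case: ifP.
    rewrite asboolT//=; split; first by move=> i j; rewrite Theta_ge0 Theta_le1.
    by move=> /interior_subset.
  apply: compact_ind.
  - apply: compact_closedI; first exact: matrix_box_compact.
    exact/open_closedC/open_interior.
  - move=> d d0; apply: nearW => t; rewrite big1 ?ltW// => s /andP[_ /asboolP[]].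
  - move=> V W VW vW d /vW; apply: filterS => t; apply: le_trans.
    rewrite big_mkcond [leRHS]big_mkcond ler_sum// => s _.
    case: ifPn => [/andP[-> /asboolP Vs]|_]; last by case: ifP.
    by rewrite asboolT//; exact: VW.
  - move=> V W vV vW d d0.
    have d20 : 0 < d / 2 by rewrite divr_gt0.
    apply: filterS2 (vV _ d20) (vW _ d20) => t hV hW.
    rewrite [leRHS](splitr d) (le_trans _ (lerD hV hW))//.
    rewrite big_mkcond [X in _ <= X + _]big_mkcond [X in _ <= _ + X]big_mkcond -big_split ler_sum// => s _ /=.
    case: ifPn => [/andP[Ss /asboolP[]/asboolT ->]|_]; rewrite ?Ss /=.
    + by rewrite lerDl; case: ifP.
    + by rewrite lerDr; case: ifP.
    + by rewrite addr_ge0//; case: ifP.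
  - move=> M [_ nM]; apply: vanishing_local => Mth; apply: nM.
    by rewrite Mth; exact: U'th.
have h2 : 0 < 2^-1 :> R by rewrite invr_gt0.
(* The factor 2K accounts for the mass 1/2 and for the constant of [weight_le]; the other half of e
   was spent in U'. At t = 0 the bound would read 2K <= 1, against K >= 1. *)
have hK := near_expR_small (2 * K) e20 (@ltr01 R).
apply: filterS2 (van _ h2) hK => -[|t] hv hk.
  have K1 : 1 <= K by rewrite -expR0 ler_expR sumr_ge0// => i _; exact: sumr_ge0.
  by move: hk; rewrite mul0r oppr0 expR0 mulr1 => hk; lra.
pose A := \sum_(s : t.+1.-tuple 'I_N | inS pi P s && `[< U' (Theta R s) >]) path_weight b Q s.
have A2 : 2^-1 <= A.
  have : 1 <= A + 2^-1.
    rewrite -[leLHS](sum_weight t) (le_trans _ (lerD (lexx A) hv))// /A.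
    rewrite big_mkcond [X in _ <= X + _]big_mkcond [X in _ <= _ + X]big_mkcond -big_split ler_sum// => s _ /=.
    case: (inS pi P s) => //=.
    case: asboolP => [h|h]; first by rewrite lerDl; case: ifP.
    by rewrite add0r asboolT.
  by lra.
have AK : A <= (#|[set s : t.+1.-tuple 'I_N | inS pi P s && `[< U (Theta R s) >]]|)%:R *
    (K * expR (t.+1%:R * (- entropyH theta + e / 2))).
  rewrite card_mkset -sum1_card natr_sum mulr_suml /A big_mkcond [leRHS]big_mkcond.
  apply: ler_sum => s _; rewrite unfold_in /=.
  case: ifPn => [/andP[Ss /asboolP[Us ls]]|_].
    rewrite Ss asboolT//= mul1r (le_trans (weight_le Ss))// ler_pM2l ?expR_gt0//.
    by rewrite ler_expR ler_wpM2l// -ell_theta ltW.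
  by case: ifP => // _; rewrite mul1r mulr_ge0// expR_ge0.
move: hk; rewrite expRN ler_pdivrMr ?expR_gt0// mul1r => hk.
have h := le_trans A2 AK.
rewrite -(@ler_pM2r _ (2 * (K * expR (t.+1%:R * (- entropyH theta + e / 2))))); last first.
  by rewrite !mulr_gt0// expR_gt0.
apply: (@le_trans _ _ 1).
  rewrite (_ : forall x y : R, x * (2 * (K * y)) = 2 * K * (x * y)); last by move=> x y; ring.
  rewrite -expRD (_ : t.+1%:R * (entropyH theta - e) + _ = - (t.+1%:R * (e / 2))); last by field.
  by rewrite expRN ler_pdivrMr ?expR_gt0// mul1r.
rewrite mulrCA -ler_pdivrMl// mulr1 (le_trans h)//.
Qed.

End CountLower.

(** * Variance of a count of pairwise independent events *)

Section SecondMoment.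
Local Open Scope ereal_scope.
Context d (Omega : measurableType d) (R : realType) (Pr : probability Omega R).

(** Off-diagonal products contribute at most m^2 to the second moment and diagonal terms m, so the
    variance is at most the mean. *)
Lemma second_moment (I : finType) (T : pred I) (A : I -> set Omega) (m : R) :
  (forall s, T s -> measurable (A s)) ->
  (forall s s', T s -> T s' -> s != s' -> Pr (A s `&` A s') = Pr (A s) * Pr (A s')) ->
  m = (\sum_(s | T s) fine (Pr (A s)))%R ->
  \int[Pr]_w (((\sum_(s | T s) \1_(A s) w - m) ^+ 2)%R)%:E <= m%:E.
Proof.
move=> mA indA mE.
pose X w : R := (\sum_(s | T s) \1_(A s) w)%R.
have pE s : T s -> Pr (A s) = (fine (Pr (A s)))%:E.
  by move=> Ts; rewrite fineK// fin_num_measure//; exact: mA.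
have mX : measurable_fun setT X.
  rewrite /X; under eq_fun do rewrite big_mkcond.
  apply: measurable_sum => s; case: (boolP (T s)) => // Ts.
  by apply: measurable_indic; exact: mA.
have X0 w : (0 <= X w)%R by rewrite sumr_ge0.
have m0 : (0 <= m)%R by rewrite mE sumr_ge0// => s _; rewrite fine_ge0.
have mind s : measurable_fun setT (fun w => (if T s then \1_(A s) w : R else 0)%:E).
  by case: (boolP (T s)) => // Ts; apply/measurable_EFinP/measurable_indic; exact: mA.
have EX : \int[Pr]_w (X w)%:E = m%:E.
  rewrite /X; under eq_integral do rewrite big_mkcond -sumEFin.
  rewrite ge0_integral_sum//; last by move=> s w _; case: ifP.
  rewrite mE -sumEFin [RHS]big_mkcond; apply: eq_bigr => s _.
  case: (boolP (T s)) => Ts; last by rewrite integral0.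
  by rewrite integral_indic ?setIT -?pE//; exact: mA.
have mXX : measurable_fun setT (fun w => ((X w) ^+ 2)%:E).
  by apply/measurable_EFinP; exact: measurable_funX.
have EXX : \int[Pr]_w ((X w) ^+ 2)%:E <= (m ^+ 2 + m)%:E.
  have XE w : ((X w) ^+ 2)%:E = \sum_s \sum_s' (if T s && T s' then \1_(A s `&` A s') w else 0 : R)%:E.
    rewrite expr2 /X big_distrlr /= -sumEFin big_mkcond; apply: eq_bigr => s _.
    rewrite -sumEFin big_mkcond.
    case: (T s); last by rewrite big1//.
    by apply: eq_bigr => s' _ /=; case: (T s') => //; rewrite indicI.
  under eq_integral do rewrite XE.
  have mI s s' : measurable_fun setT (fun w => (if T s && T s' then \1_(A s `&` A s') w else 0 : R)%:E).
    case: (boolP (T s && T s')) => // /andP[Ts Ts']; apply/measurable_EFinP/measurable_indic.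
    by apply: measurableI; exact: mA.
  rewrite ge0_integral_sum//; last 2 first.
  - by move=> s; exact: emeasurable_sum.
  - by move=> s w _; rewrite sume_ge0// => s' _; case: ifP.
  have -> : (m ^+ 2 + m)%:E = \sum_s \sum_s' (if T s && T s' then
      fine (Pr (A s)) * fine (Pr (A s')) + (s == s')%:R * fine (Pr (A s)) else 0)%:E.
    have -> : (m ^+ 2 + m = \sum_(s | T s) \sum_(s' | T s') (fine (Pr (A s)) * fine (Pr (A s')) + (s == s')%:R * fine (Pr (A s))))%R.
      rewrite expr2 {1 2 3}mE big_distrlr /= -big_split; apply: eq_bigr => s Ts /=.
      rewrite big_split; congr (_ + _)%R; rewrite (bigD1 s)//= eqxx mul1r big1 ?addr0//.
      by move=> s' /andP[_ /negbTE ss]; rewrite eq_sym ss mul0r.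
    rewrite -sumEFin big_mkcond; apply: eq_bigr => s _.
    case: (T s); last by rewrite big1.
    by rewrite -sumEFin big_mkcond; apply: eq_bigr => s' _; case: (T s').
  apply: lee_sum => s _; rewrite ge0_integral_sum//; last first.
    by move=> s' w _; case: ifP.
  apply: lee_sum => s' _; case: (boolP (T s && T s')) => [/andP[Ts Ts']|_]; last by rewrite integral0.
  rewrite integral_indic//; last by apply: measurableI; exact: mA.
  rewrite setIT; have [<-|ss] /= := eqVneq s s'.
    apply: (@le_trans _ _ (fine (Pr (A s)))%:E); first by rewrite setIid -pE.
    by rewrite lee_fin mul1r lerDr mulr_ge0 ?fine_ge0.
  rewrite mul0r addr0 EFinM -!pE//.
  by have /eqP := indA _ _ Ts Ts' ss; rewrite eq_le => /andP[].
have mD : measurable_fun setT (fun w => ((X w - m) ^+ 2)%:E).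
  by apply/measurable_EFinP; apply: measurable_funX; apply: measurable_funB.
(* The square is expanded in additive form, so that only integrals of nonnegative functions
   occur. *)
have E : \int[Pr]_w ((X w - m) ^+ 2)%:E + (2 * m * m)%:E = \int[Pr]_w ((X w) ^+ 2)%:E + (m ^+ 2)%:E.
  have -> : (2 * m * m)%:E = \int[Pr]_w (2 * m * X w)%:E.
    under eq_integral do rewrite EFinM; rewrite ge0_integralZl//; first by rewrite EX.
    - exact/measurable_EFinP.
    - by move=> w _; rewrite lee_fin.
    - by rewrite lee_fin mulr_ge0.
  have -> : (m ^+ 2)%:E = \int[Pr]_w (m ^+ 2)%:E.
    transitivity ((m ^+ 2)%:E * Pr setT); first by rewrite probability_setT mule1.
    exact/esym/integral_cst.
  rewrite -!ge0_integralD//.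
  - by apply: eq_integral => w _; rewrite -!EFinD; congr EFin; ring.
  - by move=> w _; rewrite lee_fin sqr_ge0.
  - by move=> w _; rewrite lee_fin sqr_ge0.
  - by move=> w _; rewrite lee_fin sqr_ge0.
  - by move=> w _; rewrite lee_fin !mulr_ge0.
  - by apply/measurable_EFinP; exact: measurable_funM.
rewrite -(@leeD2rE _ (2 * m * m)%:E)// E.
apply: (le_trans (leeD2r _ EXX)).
by rewrite -!EFinD lee_fin; lra.
Qed.
End SecondMoment.

Section GoodEvents.
Context (R : realType) (N : nat) (P : 'M[R]_N) (pi : 'rV[R]_N)
  (d : measure_display) (Omega : measurableType d) (Pr : probability Omega R)
  (Z : forall t : nat, t.-tuple 'I_N -> 'I_t -> Omega -> R).
Hypotheses (NZ : forall a, Zdom pi P a -> std_normal_rv Pr (Zfam Z a))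
  (indZ : mutually_independent Pr (Zdom pi P) (Zfam Z)).

Definition good (xi : 'rV[R]_N) (dl : R) t (s : t.-tuple 'I_N) : set Omega :=
  [set w | forall i, `|Zcal Z s w 0 i - xi 0 i| < dl].

(** The event depends only on the variables of the block of [s]; blocks of distinct paths are
    disjoint, whence the independence in [good_indep]. *)
Lemma good_g_sigma xi dl t (s : t.-tuple 'I_N) : inS pi P s ->
  <<s rects (Zfam Z) (Zblock s) >> (good xi dl s).
Proof.
move=> Ss; pose G := rects (Zfam Z) (Zblock s).
have mZ k : measurable_fun setT (Z s k : g_sigma_algebraType G -> R).
  have := @measurable_rects_coord _ Omega R _ (Zfam Z) (Zblock s) (existT _ t (s, k)).
  by apply; apply/mapP; exists k => //; rewrite mem_enum.
have mZc i : measurable_fun setT ((fun w => Zcal Z s w 0 i) : g_sigma_algebraType G -> R).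
  under eq_fun do rewrite mxE.
  apply: measurable_funM => //; under eq_fun do rewrite big_mkcond.
  by apply: measurable_sum => k; case: (tnth s k == i).
suff : measurable (good xi dl s : set (g_sigma_algebraType G)) by [].
have -> : good xi dl s = \bigcap_i ((fun w => Zcal Z s w 0 i) @^-1` `](xi 0 i - dl), (xi 0 i + dl)[%classic).
  apply/seteqP; split=> w /=.
    by move=> h i _; have := h i; rewrite /= in_itv/= ltr_distl.
  by move=> h i; have := h i I; rewrite /= in_itv/= ltr_distl.
apply: fin_bigcap_measurable => // i _.
by rewrite -[X in measurable X]setTI; exact: mZc.
Qed.

Lemma measurable_good xi dl t (s : t.-tuple 'I_N) : inS pi P s -> measurable (good xi dl s).
Proof.
move=> Ss; apply: (smallest_sub (sigma_algebra_measurable _) _ (good_g_sigma xi dl Ss)).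
move=> _ [B mB ->]; apply: (measurable_rect NZ) => //; exact: Zblock_dom.
Qed.

Lemma good_indep xi dl t (s s' : t.-tuple 'I_N) : inS pi P s -> inS pi P s' -> s != s' ->
  (Pr (good xi dl s `&` good xi dl s') = Pr (good xi dl s) * Pr (good xi dl s'))%E.
Proof.
move=> Ss Ss' ss'; apply: (indep_blocks NZ indZ (Zblock_disjoint ss')).
- by move=> a; rewrite mem_cat => /orP[]; exact: Zblock_dom.
- exact: good_g_sigma.
- exact: good_g_sigma.
Qed.

(* Exponential tilting: under the density proportional to expR (t l.Z) the vector
   Z(s) concentrates at l_i b_i; outside the box, the density is dominated by the
   2N tilts by l \pm dl e_i. *)
Lemma tilted_lower_bound (xi l : 'rV[R]_N) (dl : R) t (s : t.-tuple 'I_N) :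
  inS pi P s -> 0 < dl ->
  (forall i, `|l 0 i * thetabar (Theta R s) i - xi 0 i| <= dl / 4) ->
  expR (t%:R * \sum_i l 0 i ^+ 2 * thetabar (Theta R s) i / 2) *
    (1 - 2 * N%:R * expR (- (t%:R * (dl ^+ 2 / 4)))) <=
  expR (t%:R * (\sum_i l 0 i * xi 0 i + dl * \sum_i `|l 0 i|)) * fine (Pr (good xi dl s)).
Proof.
move=> Ss dl0 close.
set EY := expR (t%:R * \sum_i l 0 i ^+ 2 * thetabar (Theta R s) i / 2).
set cA := expR (t%:R * (\sum_i l 0 i * xi 0 i + dl * \sum_i `|l 0 i|)).
set q := expR (- (t%:R * (dl ^+ 2 / 4))).
pose Y (l : 'rV[R]_N) w := expR (t%:R * \sum_i l 0 i * Zcal Z s w 0 i).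
have mY l' : measurable_fun setT (Y l').
  apply: measurableT_comp => //; apply: measurable_funM => //.
  exact: (measurable_sum_Zcal NZ).
pose l' (sg : bool) i := l + (((-1) ^+ sg * dl) *: delta_mx 0 i) : 'rV[R]_N.
pose c (sg : bool) i := expR (- (t%:R * (dl * ((-1) ^+ sg * xi 0 i + dl)))).
(* This equals Y l w times exp(t dl (sg (Z_i - xi_i) - dl)), which is at least Y l w when Z_i leaves
   the box on the side sg. *)
pose W (p : bool * 'I_N) w := c p.1 p.2 * Y (l' p.1 p.2) w.
have mA := measurable_good xi dl Ss.
have l'E sg i x : \sum_j l' sg i 0 j * x j = \sum_j l 0 j * x j + (-1) ^+ sg * dl * x i.
  rewrite /l'; under eq_bigr do rewrite !mxE mulrDl.
  rewrite big_split; congr (_ + _); rewrite (bigD1 i)//= big1 ?addr0; last first.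
    by move=> j /negbTE ji; rewrite ji ?andbF mulr0 mul0r.
  by rewrite ?eqxx /= mulr1.
have YW w : Y l w <= cA * \1_(good xi dl s) w + \sum_p W p w.
  have W0 p : 0 <= W p w by rewrite mulr_ge0 ?expR_ge0.
  have [gw|ngw] := pselect (good xi dl s w).
    rewrite indicE mem_set// mulr1 -[leLHS]addr0 lerD ?sumr_ge0//.
    rewrite ler_expR ler_wpM2l// -subr_ge0 mulr_sumr -big_split -sumrB sumr_ge0// => i _ /=.
    have h := gw i; rewrite subr_ge0 -lerBlDl -mulrBr.
    rewrite (le_trans (ler_norm _))// normrM mulrC ler_wpM2r// ltW//.
  rewrite indicE memNset// mulr0 add0r.
  have [i hi] : exists i, dl <= `|Zcal Z s w 0 i - xi 0 i|.
    by move: ngw => /existsNP[i /negP]; rewrite -leNgt => h; exists i.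
  have [sg hsg] : exists sg : bool, dl <= (-1) ^+ sg * (Zcal Z s w 0 i - xi 0 i).
    move: hi; rewrite ler_normr => /orP[h|h]; [exists false|exists true].
      by rewrite expr0 mul1r.
    by rewrite expr1 mulN1r.
  apply: (@le_trans _ _ (W (sg, i) w)); last by rewrite (bigD1 (sg, i))//= lerDl sumr_ge0.
  rewrite /W /Y /c /= l'E -expRD ler_expR.
  have : 0 <= t%:R * dl * ((-1) ^+ sg * (Zcal Z s w 0 i - xi 0 i) - dl).
    by rewrite !mulr_ge0 ?subr_ge0// ltW.
  by set S := \sum_j _; set sgn := (-1) ^+ sg; lra.
(* Divided by t, the exponent changes by at most dl^2/4 from the distance of the tilted mean to xi,
   plus dl^2/2 from the variance, minus dl^2 from [c]: in total - dl^2/4. *)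
have EW p : (\int[Pr]_w (W p w)%:E <= (EY * q)%:E)%E.
  rewrite /W; under eq_integral do rewrite EFinM.
  rewrite ge0_integralZl//; first last.
  - by rewrite lee_fin expR_ge0.
  - by move=> w _; rewrite lee_fin expR_ge0.
  - exact/measurable_EFinP.
  rewrite (Zcal_mgf NZ indZ)// -EFinM lee_fin.
  case: p => sg i /=; set tb := thetabar (Theta R s).
  set S := \sum_j l 0 j ^+ 2 * tb j / 2.
  set sgn : R := (-1) ^+ sg.
  have sgn2 : sgn ^+ 2 = 1 by rewrite sqrr_sign.
  have -> : \sum_j l' sg i 0 j ^+ 2 * tb j / 2 =
      S + (sgn * dl * (l 0 i * tb i) + dl ^+ 2 * tb i / 2).
    transitivity (\sum_j (l 0 j ^+ 2 * tb j / 2 +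
        (if j == i then sgn * dl * (l 0 i * tb i) + dl ^+ 2 * tb i / 2 else 0))).
      apply: eq_bigr => j _; rewrite /l' !mxE eqxx /=.
      case: eqP => [->|_]; last by rewrite mulr0 !addr0.
      rewrite mulr1 -/sgn; transitivity (l 0 i ^+ 2 * tb i / 2 + (sgn * dl * (l 0 i * tb i) + sgn ^+ 2 * dl ^+ 2 * tb i / 2)); first by field.
      by rewrite sgn2 mul1r.
    by rewrite big_split -big_mkcond big_pred1_eq.
  rewrite /c /EY /q -!expRD ler_expR -/S -/sgn.
  have h1 : sgn * (l 0 i * tb i - xi 0 i) <= dl / 4.
    by rewrite (le_trans (ler_norm _))// normrM /sgn normrX normrN1 expr1n mul1r.
  have tb1 : tb i <= 1.
    rewrite /tb; case: (t) (s) Ss => [s'|t' s' _]; first by rewrite inS0.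
    rewrite -(Theta_sum1 R s') (bigD1 i)//= lerDl sumr_ge0// => k _.
    by rewrite sumr_ge0// => j _; exact: Theta_ge0.
  have h3 : 0 <= t%:R * dl * (dl / 4 - sgn * (l 0 i * tb i - xi 0 i)).
    by rewrite !mulr_ge0 ?subr_ge0// ltW.
  have h4 : 0 <= t%:R * dl ^+ 2 * (1 - tb i).
    by rewrite mulr_ge0 ?subr_ge0// mulr_ge0// sqr_ge0.
  move: h3 h4; set T := t%:R; set x := l 0 i; set y := tb i; set z := xi 0 i.
  by lra.
have mW p : measurable_fun setT (fun w => (W p w)%:E).
  by apply/measurable_EFinP; exact: measurable_funM.
have : (EY%:E <= (cA * fine (Pr (good xi dl s)))%:E + (2 * N%:R * (EY * q))%:E)%E.
  have <- : (\int[Pr]_w (Y l w)%:E = EY%:E)%E by exact: (Zcal_mgf NZ indZ l Ss).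
  apply: (@le_trans _ _ (\int[Pr]_w ((cA * \1_(good xi dl s) w)%:E + \sum_p (W p w)%:E))%E).
    apply: ge0_le_integral => //.
    - by move=> w _; rewrite lee_fin expR_ge0.
    - exact/measurable_EFinP.
    - apply: emeasurable_funD; last exact: emeasurable_sum.
      by apply/measurable_EFinP; apply: measurable_funM => //; exact: measurable_indic.
    - by move=> w _; rewrite sumEFin -EFinD lee_fin.
  rewrite ge0_integralD//; first last.
  - exact: emeasurable_sum.
  - by move=> w _; rewrite sume_ge0// => p _; rewrite lee_fin mulr_ge0 ?expR_ge0.
  - by apply/measurable_EFinP; apply: measurable_funM => //; exact: measurable_indic.
  - by move=> w _; rewrite lee_fin mulr_ge0 ?expR_ge0.
  apply: leeD.
    under eq_integral do rewrite EFinM.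
    rewrite ge0_integralZl//; first last.
    - by rewrite lee_fin expR_ge0.
    - exact/measurable_EFinP/measurable_indic.
    rewrite integral_indic// setIT EFinM fineK//.
    exact: fin_num_measure.
  rewrite ge0_integral_sum//; last by move=> p w _; rewrite lee_fin mulr_ge0 ?expR_ge0.
  apply: (@le_trans _ _ (\sum_(p : bool * 'I_N) (EY * q)%:E)%E).
    by apply: lee_sum => p _; exact: EW.
  rewrite sumEFin lee_fin sumr_const card_prod card_bool card_ord -[leLHS]mulr_natl.
  by rewrite natrM.
rewrite -EFinD lee_fin => h.
rewrite mulrBr mulr1 lerBlDr (le_trans h)// lerD2l.
by rewrite mulrCA.
Qed.

End GoodEvents.

(** * Lower bound at a point positive on every edge *)

Section LowerPoint.
Context (R : realType) (n : nat).
Notation N := n.+1.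
Context (P : 'M[R]_N) (pi : 'rV[R]_N)
  (d : measure_display) (Omega : measurableType d) (Pr : probability Omega R)
  (Z : forall t : nat, t.-tuple 'I_N -> 'I_t -> Omega -> R).
Hypotheses (P0 : forall i j, 0 <= P i j) (P1 : forall i, \sum_j P i j = 1)
  (irr : irreducible P) (pi0 : forall i, 0 < pi 0 i)
  (NZ : forall a, Zdom pi P a -> std_normal_rv Pr (Zfam Z a))
  (indZ : mutually_independent Pr (Zdom pi P) (Zfam Z)).
Local Notation L := (ln (spectral_radius (zero_one_mx P))).
Local Notation hits := (hits P pi Z).
Implicit Types (theta : 'M[R]_N) (xi : 'rV[R]_N).

Lemma nbhs_thetabar theta i (e : R) : 0 < e ->
  nbhs theta [set M | `|thetabar M i - thetabar theta i| < e].
Proof.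
move=> e0.
have c : continuous (fun M : 'M[R]_N => thetabar M i).
  by apply: continuous_sum_fun => j; exact: coord_continuous.
have h1 : nbhs theta [set M : 'M[R]_N | thetabar M i < thetabar theta i + e].
  by apply: (nbhs_lt_continuous c); rewrite ltrDl.
have h2 : nbhs theta [set M : 'M[R]_N | thetabar theta i - e < thetabar M i].
  by apply: (nbhs_gt_continuous c); rewrite gtrBl.
by apply: filterS2 h1 h2 => M /= h1 h2; rewrite ltr_distl h1 h2.
Qed.

Lemma nbhs_entries theta (e : R) : 0 < e ->
  nbhs theta [set M : 'M[R]_N | forall i j, `|M i j - theta i j| < e].
Proof.
move=> e0; apply/nbhs_ballP; exists e => // M [_ hM] i j.
by have := hM i j; rewrite /ball /= distrC.
Qed.

(** The slack b - L - a is 2k: one k absorbs the constant in the upper bound on C_t, the other is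
    the factor exp(-t k) left to the caller. *)
Lemma Qemp_ge (a b : R) : L + a < b -> exists2 k, 0 < k &
  \forall t \near \oo, forall w U, expR (- (t%:R * k)) * expR (- (t%:R * a)) <= hits t w U ->
     expR (- (t%:R * b)) <= Qemp pi P Z t w U.
Proof.
move=> Lab; pose k := (b - (L + a)) / 2.
have k0 : 0 < k by rewrite divr_gt0// subr_gt0.
exists k => //; have [c c0 Cc] := Ct_le P0 P1 irr pi0.
have [m _ hm] := near_expR_small c k0 (@ltr01 R).
exists m.+1 => // -[//|t] mt w U hU.
have ct : 0 < (Ct pi P t.+1)%:R :> R by rewrite (lt_le_trans _ (Ct_ge P0 P1 irr pi0 t))// expR_gt0.
rewrite QempE ler_pdivlMr// (le_trans _ hU)//.
have /= h1 := hm _ (leq_trans (leqnSn _) mt).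
apply: (@le_trans _ _ (expR (- (t.+1%:R * b)) * (c * expR (t.+1%:R * L)))).
  by rewrite ler_wpM2l ?expR_ge0.
rewrite mulrCA -[X in c * X]expRD.
have -> : - (t.+1%:R * b) + t.+1%:R * L = - (t.+1%:R * k) + (- (t.+1%:R * k) + - (t.+1%:R * a)).
  by rewrite /k; field.
by rewrite -[leRHS]expRD [X in c * X]expRD mulrA -[leRHS]mul1r ler_wpM2r ?expR_ge0.
Qed.

Lemma lower_point_strict theta xi G b : simplexDelta P theta -> full_support P theta ->
  nbhs (theta, xi) G -> Jreal theta xi < entropyH theta ->
  L - entropyH theta + Jreal theta xi < b ->
  {ae Pr, forall w, \forall t \near \oo, expR (- (t%:R * b)) <= Qemp pi P Z t w G}.
Proof.
move=> D ft Gn JH Lb.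
have Bpos := full_support_thetabar P0 P1 D ft.
set H := entropyH theta in JH Lb *; set J := Jreal theta xi in JH Lb *.
(* The losses add up to 3e: one e in the number of paths, two in the probability of each; 8e fits
   below both gaps. *)
pose e := Num.min ((b - (L - H + J)) / 8) ((H - J) / 8).
have e0 : 0 < e by rewrite lt_min !divr_gt0 ?subr_gt0.
have eb : e * 8 <= b - (L - H + J) by rewrite -ler_pdivlMr// ge_min lexx.
have eHJ : e * 8 <= H - J by rewrite -ler_pdivlMr// ge_min lexx orbT.
have [g g0 gG] := nbhs_matrix_prod Gn.
(* The optimal tilt: it moves the mean of Z(s) to xi when the row masses are those of theta. *)
pose l : 'rV[R]_N := \row_i (xi 0 i / thetabar theta i).
have lB i : l 0 i * thetabar theta i = xi 0 i by rewrite mxE divfK// gt_eqF.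
pose S1 := 1 + \sum_i `|l 0 i|; pose S2 := 1 + \sum_i l 0 i ^+ 2.
have S10 : 0 < S1 by rewrite ltr_pwDl// sumr_ge0.
have S20 : 0 < S2 by rewrite ltr_pwDl// sumr_ge0// => i _; exact: sqr_ge0.
have lS1 i : `|l 0 i| <= S1.
  by rewrite /S1 (bigD1 i)//= addrCA lerDl addr_ge0// sumr_ge0.
pose dl := Num.min g (e / S1).
have dl0 : 0 < dl by rewrite lt_min g0 divr_gt0.
have dle : dl * \sum_i `|l 0 i| <= e.
  apply: (@le_trans _ _ (dl * S1)); first by rewrite ler_wpM2l ?(ltW dl0)// lerDr.
  by rewrite -ler_pdivlMr// ge_min lexx orbT.
(* The first bound keeps the tilted mean within dl/4 of xi, the second keeps the quadratic term
   above J - e. *)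
pose eta := Num.min (dl / 4 / S1) (e / S2).
have eta0 : 0 < eta by rewrite lt_min !divr_gt0.
have etaS1 : S1 * eta <= dl / 4 by rewrite mulrC -ler_pdivlMr// ge_min lexx.
have etaS2 : eta * \sum_i l 0 i ^+ 2 <= e.
  apply: (@le_trans _ _ (eta * S2)); first by rewrite ler_wpM2l ?(ltW eta0)// lerDr.
  by rewrite -ler_pdivlMr// ge_min lexx orbT.
pose U := [set M : 'M[R]_N | forall i j, `|M i j - theta i j| < g] `&`
  [set M : 'M[R]_N | forall i, `|thetabar M i - thetabar theta i| < eta].
have Un : nbhs theta U.
  apply: filterI; first exact: nbhs_entries.
  exact: (@filter_forall _ _ (fun i => [set M : 'M[R]_N | `|thetabar M i - thetabar theta i| < eta])
    (nbhs theta) (nbhs_filter theta) (fun i => nbhs_thetabar theta i eta0)).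
have goodG t (s : t.-tuple 'I_N) w : U (Theta R s) -> good Z xi dl s w -> G (Theta R s, Zcal Z s w).
  move=> [Us _] gw; apply: gG => // i; rewrite (lt_le_trans (gw i))//.
  by rewrite ge_min lexx.
pose q t := 2 * N%:R * expR (- (t%:R * (dl ^+ 2 / 4))) : R.
have pP t (s : t.-tuple 'I_N) : inS pi P s -> U (Theta R s) -> q t <= 2^-1 ->
    2^-1 * expR (- (t%:R * (J + 2 * e))) <= fine (Pr (good Z xi dl s)).
  move=> Ss [_ Us] qt.
  have close i : `|l 0 i * thetabar (Theta R s) i - xi 0 i| <= dl / 4.
    rewrite -lB -mulrBr normrM (le_trans _ etaS1)// ler_pM//.
    exact: ltW.
  have := tilted_lower_bound NZ indZ Ss dl0 close.
  rewrite -/(q t) => h.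
  have h1 : expR (t%:R * (J - e)) * 2^-1 <= expR (t%:R * \sum_i l 0 i ^+ 2 * thetabar (Theta R s) i / 2) * (1 - q t).
    rewrite ler_pM ?expR_ge0//; last by lra.
    rewrite ler_expR ler_wpM2l// lerBlDl -lerBlDr.
    rewrite (le_trans _ etaS2)// mulr_sumr -sumrB ler_sum// => i _.
    have -> : xi 0 i ^+ 2 / thetabar theta i / 2 = l 0 i ^+ 2 * thetabar theta i / 2.
      by rewrite -lB; field; rewrite gt_eqF.
    have := Us i; rewrite distrC => /ltW/(le_trans (ler_norm _)) hi.
    have x0 : 0 <= l 0 i ^+ 2 := sqr_ge0 _.
    have h1 : 0 <= l 0 i ^+ 2 * (eta - (thetabar theta i - thetabar (Theta R s) i)).
      by rewrite mulr_ge0// subr_ge0.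
    have h2 : 0 <= l 0 i ^+ 2 * eta by rewrite mulr_ge0// ltW.
    by lra.
  have h2 := le_trans h1 h.
  have lxi : \sum_i l 0 i * xi 0 i = 2 * J.
    rewrite /J /Jreal mulr_sumr; apply: eq_bigr => i _; rewrite -[X in _ * X]lB mxE.
    by field; rewrite gt_eqF.
  rewrite -(@ler_pM2l _ (expR (t%:R * (2 * J + e)))) ?expR_gt0//.
  (* The tilted mass is at least exp(t (J - e)) / 2, and the tilt is at most exp(t (2J + e)) on the
     box; the quotient has exponent -(J + 2e). *)
  apply: (@le_trans _ _ (expR (t%:R * (J - e)) * 2^-1)).
    rewrite mulrCA mulrC ler_pM2r ?invr_gt0// -expRD ler_expR le_eqVlt.
    by apply/orP; left; apply/eqP; ring.
  apply: (le_trans h2); rewrite lxi ler_wpM2r ?fine_ge0// ler_expR ler_wpM2l//.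
  by rewrite lerD2l.
pose T t (s : t.-tuple 'I_N) := inS pi P s && `[< U (Theta R s) >].
pose m t := \sum_(s : t.-tuple 'I_N | T t s) fine (Pr (good Z xi dl s)) : R.
pose X t w := \sum_(s : t.-tuple 'I_N | T t s) \1_(good Z xi dl s) w : R.
pose a := - (H - J - 3 * e).
have na0 : 0 < - a by rewrite /a opprK; lra.
have m0 t : 0 <= m t by rewrite sumr_ge0// => s _; exact: fine_ge0.
have mP : \forall t \near \oo, 2^-1 * expR (- (t%:R * a)) <= m t.
  have q2 : \forall t \near \oo, q t <= 2^-1.
    by apply: near_expR_small; rewrite ?invr_gt0// divr_gt0// exprn_gt0.
  have cnt := count_lower P0 P1 irr pi0 D ft Un e0.
  apply: filterS2 q2 cnt => t qt ct.
  apply: (@le_trans _ _ (\sum_(s : t.-tuple 'I_N | T t s) 2^-1 * expR (- (t%:R * (J + 2 * e))))).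
    rewrite sumr_const -[leRHS]mulr_natl.
    apply: (@le_trans _ _ (expR (t%:R * (H - e)) * (2^-1 * expR (- (t%:R * (J + 2 * e)))))).
      rewrite mulrCA ler_pM2l ?invr_gt0// -expRD ler_expR /a le_eqVlt.
      by apply/orP; left; apply/eqP; ring.
    rewrite ler_wpM2r ?mulr_ge0 ?expR_ge0// (le_trans ct)// card_mkset ler_nat.
    exact: subset_leq_card.
  by apply: ler_sum => s /andP[Ss /asboolP Us]; exact: pP.
(* Chebyshev's ratio: f < 1 means |X - m| < m/2, and its expectation is at most 4/m, exponentially
   small. *)
pose f t w := 4 * (m t ^+ 2)^-1 * (X t w - m t) ^+ 2.
have mX t : measurable_fun setT (X t).
  rewrite /X; under eq_fun do rewrite big_mkcond.
  apply: measurable_sum => s; case: (boolP (T t s)) => // /andP[Ss _].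
  by apply: measurable_indic; exact: (measurable_good NZ).
have mf t : measurable_fun setT (f t).
  apply: measurable_funM => //; apply: measurable_funX; apply: measurable_funB => //; exact: mX.
have f0 t w : 0 <= f t w by rewrite mulr_ge0 ?sqr_ge0// mulr_ge0// invr_ge0 sqr_ge0.
have intf : \forall t \near \oo, (\int[Pr]_w (f t w)%:E <= (8 * expR (- (t%:R * (- a))))%:E)%E.
  apply: filterS mP => t mt.
  have mt0 : 0 < m t by rewrite (lt_le_trans _ mt)// mulr_gt0 ?expR_gt0 ?invr_gt0.
  rewrite /f; under eq_integral do rewrite EFinM.
  rewrite ge0_integralZl//; first last.
  - by rewrite lee_fin mulr_ge0// invr_ge0 sqr_ge0.
  - by move=> w _; rewrite lee_fin sqr_ge0.
  - by apply/measurable_EFinP; apply: measurable_funX; apply: measurable_funB => //; exact: mX.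
  have sm : (\int[Pr]_w ((X t w - m t) ^+ 2)%:E <= (m t)%:E)%E.
    apply: (@second_moment _ _ _ Pr _ (T t) (fun s => good Z xi dl s)) => //.
      by move=> s /andP[Ss _]; exact: (measurable_good NZ).
    by move=> s s' /andP[Ss _] /andP[Ss' _]; exact: (good_indep NZ indZ).
  apply: (le_trans (lee_wpmul2l _ sm)); first by rewrite lee_fin mulr_ge0// invr_ge0 sqr_ge0.
  rewrite -EFinM lee_fin expr2 invfM mulrA mulfVK ?gt_eqF//.
  rewrite mulrN opprK ler_pdivrMr//.
  have : expR (t%:R * a) * expR (- (t%:R * a)) = 1 by rewrite -expRD subrr expR0.
  have := expR_gt0 (t%:R * a); set E1 := expR _; set E2 := expR _ in mt *.
  move=> E10 E12; have : 8 * E1 * (2^-1 * E2) <= 8 * E1 * m t by rewrite ler_pM2l// mulr_gt0.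
  by move: E12; lra.
have bc := ae_eventually_lt1 mf f0 na0 intf.
have Lab : L + a < b by rewrite /a; lra.
have [k k0 Qk] := Qemp_ge Lab.
have k4 := near_expR_small 4 k0 (@ltr01 R).
apply: filterS bc => w fw.
near=> t.
have mt : 2^-1 * expR (- (t%:R * a)) <= m t by near: t.
have mt0 : 0 < m t by rewrite (lt_le_trans _ mt)// mulr_gt0 ?expR_gt0 ?invr_gt0.
have ft1 : f t w < 1 by near: t.
have kt : 4 * expR (- (t%:R * k)) <= 1 by near: t.
have Qt : forall w U, expR (- (t%:R * k)) * expR (- (t%:R * a)) <= hits t w U ->
     expR (- (t%:R * b)) <= Qemp pi P Z t w U by near: t.
apply: Qt.
apply: (@le_trans _ _ (m t / 2)).
  have := expR_gt0 (- (t%:R * a)); set E2 := expR (- (t%:R * a)) in mt *; move=> E20.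
  have : 0 <= E2 * (1 - 4 * expR (- (t%:R * k))) by rewrite mulr_ge0 ?subr_ge0// ltW.
  by lra.
apply: (@le_trans _ _ (X t w)).
  rewrite leNgt; apply/negP => Xm; move: ft1; rewrite ltNge => /negP; apply.
  rewrite /f mulrAC ler_pdivlMr ?exprn_gt0// mul1r.
  have X0 : 0 <= X t w by rewrite sumr_ge0.
  by nra.
rewrite hitsE /X big_mkcond [leRHS]big_mkcond ler_sum// => s _; rewrite /T.
case: (boolP (inS pi P s)) => //= Ss; case: asboolP => // Us.
rewrite indicE ler_nat; case: (boolP (w \in _)) => //; rewrite inE => gw.
by rewrite asboolT//; exact: goodG.
Unshelve. all: by end_near. Qed.

(* When H = 0 the expected number of good paths need not grow; a single path
   suffices, since good has probability tending to 1 exponentially fast. *)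
Lemma lower_point_zero theta G b : simplexDelta P theta -> full_support P theta ->
  nbhs (theta, 0 : 'rV[R]_N) G -> entropyH theta = 0 -> L < b ->
  {ae Pr, forall w, \forall t \near \oo, expR (- (t%:R * b)) <= Qemp pi P Z t w G}.
Proof.
move=> D ft Gn H0 Lb; have [g g0 gG] := nbhs_matrix_prod Gn.
pose U := [set M : 'M[R]_N | forall i j, `|M i j - theta i j| < g].
have Un : nbhs theta U := nbhs_entries theta g0.
pose T t (s : t.-tuple 'I_N) := inS pi P s && `[< U (Theta R s) >].
(* One path near theta is selected for each t independently of the randomness, and B is the event
   that its Gaussian vector is not near 0. *)
pose B t := if [pick s | T t s] is Some s then ~` good Z 0 g s else set0.
have mB t : measurable (B t).
  rewrite /B; case: pickP => // s /andP[Ss _]; apply: measurableC.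
  exact: (measurable_good NZ).
have c0 : 0 < g ^+ 2 / 4 by rewrite divr_gt0// exprn_gt0.
have intB t : (\int[Pr]_w (\1_(B t) w)%:E <= (2 * N%:R * expR (- (t%:R * (g ^+ 2 / 4))))%:E)%E.
  rewrite integral_indic// setIT /B; case: pickP => [s /andP[Ss _]|_]; last first.
    by rewrite measure0 lee_fin mulr_ge0// expR_ge0.
  have mg : measurable (good Z 0 g s) by exact: (measurable_good NZ).
  have close i : `|(0 : 'rV[R]_N) 0 i * thetabar (Theta R s) i - (0 : 'rV[R]_N) 0 i| <= g / 4.
    by rewrite !mxE mul0r subrr normr0 divr_ge0// ltW.
  have := tilted_lower_bound NZ indZ Ss g0 close.
  rewrite [X in t%:R * X]big1 => [|i _]; last by rewrite mxE expr0n/= !mul0r.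
  rewrite [X in t%:R * (X + _)]big1 => [|i _]; last by rewrite mxE mul0r.
  rewrite [X in _ + g * X]big1 => [|i _]; last by rewrite mxE normr0.
  rewrite !mulr0 addr0 mulr0 expR0 !mul1r => h.
  apply: (@le_trans _ _ (1 - Pr (good Z 0%R g s))%E); first by rewrite -probability_setC.
  by rewrite -(fineK (fin_num_measure Pr _ mg)) -EFinB lee_fin lerBlDr -lerBlDl.
pose f t w : R := \1_(B t) w.
have bc : {ae Pr, forall w, \forall t \near \oo, f t w < 1}.
  apply: (@ae_eventually_lt1 _ _ _ Pr f (2 * N%:R) (g ^+ 2 / 4)) => //.
    by move=> t; exact: measurable_indic.
  by apply: nearW => t; exact: intB.
pose b' := (L + b) / 2.
have [k k0 Qk] : exists2 k, 0 < k & \forall t \near \oo, forall w U,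
    expR (- (t%:R * k)) * expR (- (t%:R * 0)) <= hits t w U ->
     expR (- (t%:R * b)) <= Qemp pi P Z t w U by apply: Qemp_ge; rewrite addr0.
have e0 : 0 < k / 2 by rewrite divr_gt0.
(* Used for the existence of an admissible path near theta, since the lower bound is positive. *)
have cnt := count_lower P0 P1 irr pi0 D ft Un e0.
apply: filterS bc => w; apply: filterS3 Qk cnt => t Qt ct ft1; apply: Qt.
move: ft1; rewrite /f /B indicE.
case: pickP => [s /andP[Ss /asboolP Us]|noT]; last first.
  have E0 : #|[set s : t.-tuple 'I_N | inS pi P s && `[< U (Theta R s) >]]| = 0%N.
    by rewrite card_mkset eq_card0// => s; rewrite unfold_in /=; exact: noT.
  by move: ct; rewrite E0 leNgt expR_gt0.
case: (boolP (w \in _)); first by rewrite ltxx.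
move=> /negP; rewrite inE => /contrapT gw _.
apply: (@le_trans _ _ 1).
  by rewrite mulr0 oppr0 expR0 mulr1 expR_le1 oppr_le0 mulr_ge0// ltW.
rewrite hitsE (bigD1 s)//= asboolT ?lerDl ?sumr_ge0//.
by apply: gG => // i; exact: gw.
Qed.

End LowerPoint.

(** * Large deviation principle *)

Section ExtendedReals.
Context (R : realType).
Local Open Scope ereal_scope.

Lemma ereal_rat_dense (x y : \bar R) : x < y -> exists q : rat, x < (ratr q)%:E /\ (ratr q)%:E < y.
Proof.
have real_dense (a b : R) : (a < b)%R -> exists q : rat, a%:E < (ratr q)%:E /\ (ratr q)%:E < b%:E.
  by move=> /rat_in_itvoo[q]; rewrite in_itv/= => /andP[h1 h2]; exists q; rewrite !lte_fin.
case: x => [a| |]; case: y => [b| |] // ab.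
- by apply: real_dense; rewrite -lte_fin.
- have [|q [h1 _]] := @real_dense a (a + 1)%R; first by rewrite ltrDl.
  by exists q; rewrite ltry.
- have [|q [_ h1]] := @real_dense (b - 1)%R b; first by rewrite gtrBl.
  by exists q; rewrite ltNyr.
- by exists 0%R; rewrite ltNyr ltry.
Qed.

Lemma limn_esup_le_near (u : (\bar R)^nat) (l : \bar R) :
  (\forall t \near \oo, u t <= l) -> limn_esup u <= l.
Proof.
move=> ul; apply: (@le_trans _ _ (ereal_sup (u @` [set t | u t <= l]))).
  by apply: ereal_inf_lbound; exists [set t | u t <= l].
by apply: ub_ereal_sup => _ [t /= utl <-].
Qed.

Lemma limn_einf_ge_near (u : (\bar R)^nat) (l : \bar R) :
  (\forall t \near \oo, l <= u t) -> l <= limn_einf u.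
Proof.
move=> ul; rewrite /limn_einf leeNr; apply: limn_esup_le_near.
by apply: filterS ul => t; rewrite leeN2.
Qed.

End ExtendedReals.

Section Conclusion.
Context (R : realType) (n : nat).
Notation N := n.+1.
Context (P : 'M[R]_N) (pi : 'rV[R]_N)
  (d : measure_display) (Omega : measurableType d) (Pr : probability Omega R)
  (Z : forall t : nat, t.-tuple 'I_N -> 'I_t -> Omega -> R).
Hypotheses (P0 : forall i j, 0 <= P i j) (P1 : forall i, \sum_j P i j = 1)
  (irr : irreducible P) (pi0 : forall i, 0 < pi 0 i) (pi1 : \sum_i pi 0 i = 1)
  (piP : pi *m P = pi)
  (NZ : forall a, Zdom pi P a -> std_normal_rv Pr (Zfam Z a))
  (indZ : mutually_independent Pr (Zdom pi P) (Zfam Z)).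
Local Notation L := (ln (spectral_radius (zero_one_mx P))).

Lemma rate_term_le t (x a : R) : (0 < t)%N -> 0 <= x -> x <= expR (- (t%:R * a)) ->
  (((t%:R)^-1)%:E * elog x <= (- a)%:E)%E.
Proof.
move=> t0 x0 xa; have ti : 0 < (t%:R)^-1 :> R by rewrite invr_gt0 ltr0n.
rewrite /elog; case: eqP => [_|/eqP xn0]; first by rewrite gt0_muleNy ?lte_fin// leNye.
rewrite -EFinM lee_fin ler_pdivrMl ?ltr0n// mulrN -(expRK (- (t%:R * a))).
by rewrite ler_ln ?posrE ?expR_gt0// lt_def xn0.
Qed.

Lemma rate_term_ge t (x b : R) : (0 < t)%N -> expR (- (t%:R * b)) <= x ->
  ((- b)%:E <= ((t%:R)^-1)%:E * elog x)%E.
Proof.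
move=> t0 xb; have x0 : 0 < x by apply: lt_le_trans xb; exact: expR_gt0.
rewrite /elog gt_eqF// -EFinM lee_fin ler_pdivlMl ?ltr0n// mulrN -(expRK (- (t%:R * b))).
by rewrite ler_ln ?posrE ?expR_gt0.
Qed.

(** A rate a strictly between q and the infimum leaves exp(-t (a - q)) to absorb the constant of
    [exp_bounded]. *)
Lemma limsup_bound (G : set ('M[R]_N * 'rV[R]_N)) (q : R) :
  (q%:E < ereal_inf [set rateI P x | x in closure G])%E ->
  {ae Pr, forall w, (limn_esup (fun t => ((t%:R)^-1)%:E * elog (Qemp pi P Z t w G)) <= (- q)%:E)%E}.
Proof.
move=> /ereal_rat_dense[a' [qa aI]]; set a : R := ratr a' in qa aI.
have [C C0 aeC] : exp_bounded P pi Pr Z a (closure G).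
  apply: (exp_bounded_closed P0 P1 irr pi0 NZ indZ) => [|x Gx]; first exact: closed_closure.
  by apply: (lt_le_trans aI); apply: ereal_inf_lbound; exists x.
apply: filterS aeC => w hw; apply: limn_esup_le_near.
have qa0 : 0 < a - q by rewrite subr_gt0 -lte_fin.
have hC := near_expR_small C qa0 (@ltr01 R).
near=> t; apply: rate_term_le; first by near: t; exact: nbhs_infty_gt.
  exact: Qemp_ge0.
apply: (@le_trans _ _ (C * expR (- (t%:R * a)))).
  apply: (@le_trans _ _ (Qemp pi P Z t w (closure G))); last by near: t.
  rewrite !QempE ler_wpM2r// hits_sub// => s _; exact: subset_closure.
have -> : - (t%:R * a) = - (t%:R * (a - q)) + - (t%:R * q) by ring.
rewrite expRD mulrA -[leRHS]mul1r ler_wpM2r ?expR_ge0//; near: t; exact: hC.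
Unshelve. all: by end_near. Qed.

Lemma liminf_bound (G : set ('M[R]_N * 'rV[R]_N)) (q : R) :
  (ereal_inf [set rateI P x | x in interior G] < q%:E)%E ->
  {ae Pr, forall w, ((- q)%:E <= limn_einf (fun t => ((t%:R)^-1)%:E * elog (Qemp pi P Z t w G)))%E}.
Proof.
move=> /ereal_inf_lt[_ [[theta xi] Gx <-]].
rewrite /rateI /=; case: ifPn => [/andP[/asboolP D JH]|_]; last by rewrite ltNge leey.
have [JE _] := Jfun_finite D JH.
rewrite JE -EFinD lte_fin => Iq.
suff : {ae Pr, forall w, \forall t \near \oo, expR (- (t%:R * q)) <= Qemp pi P Z t w G}.
  apply: filterS => w hw; apply: limn_einf_ge_near.
  near=> t; apply: rate_term_ge; first by near: t; exact: nbhs_infty_gt.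
  by near: t.
have HJ : 0 <= entropyH theta - Jreal theta xi.
  by rewrite subr_ge0 -lee_fin -JE.
have [g g0 gG] := nbhs_matrix_prod (nbhs_interior Gx).
pose m := Num.min g (q - (L - entropyH theta + Jreal theta xi)).
have m0 : 0 < m by rewrite lt_min g0 subr_gt0.
(* Up to the factor eta, C bounds at once the shift of theta (at most 1), the shift of xi (at most
   2|xi_i|) and the loss in H - J; eta = m / (m + C) gives eta < 1 and eta C < m. *)
pose C := 2 + 2 * \sum_i `|xi 0 i| + (entropyH theta - Jreal theta xi).
have S0 : 0 <= \sum_i `|xi 0 i| by rewrite sumr_ge0.
have C0 : 0 < C by rewrite /C; lra.
pose eta := m / (m + C).
have mC0 : 0 < m + C by rewrite addr_gt0.
have eta0 : 0 < eta by rewrite divr_gt0.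
have eta1 : eta < 1 by rewrite ltr_pdivrMr// mul1r ltrDl.
have etaC : eta * C < m.
  by rewrite mulrAC ltr_pdivrMr// ltr_pM2l// ltrDr.
have a01 : 0 < 1 - eta < 1 by rewrite subr_gt0 eta1 gtrBl.
have [D' ft' JH' HJ'] := interior_approx P0 P1 pi0 pi1 piP D JH a01.
set theta' := _ + _ in D' ft' JH' HJ'; set xi' := _ *: xi in JH' HJ'.
have Gn : nbhs (theta', xi') G.
  have : interior G (theta', xi'); last by [].
  have mg : m <= g by rewrite ge_min lexx.
  apply: gG => [i j|i].
    have De := edge_measure_Delta P0 P1 pi0 pi1 piP.
    have [t0 _] := D; have [e0 _] := De.
    have t1 := le_trans (le_thetabar i j t0) (thetabar_le1 i D).
    have e1 := le_trans (le_thetabar i j e0) (thetabar_le1 i De).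
    have -> : theta' i j - theta i j = eta * (edge_measure P pi i j - theta i j).
      by rewrite /theta' [LHS]addrC !mxE; ring.
    rewrite (lt_le_trans _ mg)// (le_lt_trans _ etaC)// normrM gtr0_norm// ler_pM2l//.
    rewrite (@le_trans _ _ 1)//; last by rewrite /C; lra.
    by rewrite ler_norml; have := t0 i j; have := e0 i j; lra.
  (* Here 1 - (1 - eta)^2 = eta (2 - eta). *)
  have -> : xi' 0 i - xi 0 i = - (eta * ((2 - eta) * xi 0 i)).
    by rewrite /xi' !mxE; ring.
  rewrite (lt_le_trans _ mg)// (le_lt_trans _ etaC)// normrN normrM gtr0_norm// ler_pM2l//.
  rewrite normrM gtr0_norm; last by lra.
  have xS : `|xi 0 i| <= \sum_i `|xi 0 i| by rewrite (bigD1 i)//= lerDl sumr_ge0.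
  have : 0 <= eta * `|xi 0 i| by rewrite mulr_ge0// ltW.
  by rewrite /C; lra.
have mq : m <= q - (L - entropyH theta + Jreal theta xi) by rewrite ge_min lexx orbT.
have HJC : eta * (entropyH theta - Jreal theta xi) <= eta * C.
  by rewrite ler_pM2l// /C; lra.
have Lq : L - entropyH theta' + Jreal theta' xi' < q.
  by move: HJ'; lra.
case: JH' => [JH'|[H0 xi0]]; first exact: (lower_point_strict P0 P1 irr pi0 NZ indZ D' ft' Gn JH' Lq).
rewrite xi0 in Gn Lq; apply: (lower_point_zero P0 P1 irr pi0 NZ indZ D' ft' Gn H0).
have J0 := Jreal_ge0 0 D'.
by move: Lq; rewrite H0; lra.
Unshelve. all: by end_near. Qed.

Lemma ae_forall_rat (Q : rat -> Omega -> Prop) :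
  (forall q, {ae Pr, forall w, Q q w}) -> {ae Pr, forall w, forall q, Q q w}.
Proof.
move=> h; have : {ae Pr, forall w, forall k : nat, forall q, unpickle k = Some q -> Q q w}.
  apply/ae_foralln => k; case E : (unpickle k) => [q|]; last by apply: aeW => w q.
  by apply: filterS (h q) => w Qw _ [<-].
by apply: filterS => w hw q; apply: (hw (pickle q)); rewrite pickleK.
Qed.

(** Each threshold has its own null set; rational thresholds are countably many and separate
    extended reals, so one null set serves both bounds. *)
Lemma ldp (G : set ('M[R]_N * 'rV[R]_N)) :
  {ae Pr, forall w,
     (limn_esup (fun t : nat => ((t%:R)^-1)%:E * elog (Qemp pi P Z t w G))
        <= - ereal_inf [set rateI P x | x in closure G])%E
     /\
     (- ereal_inf [set rateI P x | x in interior G]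
        <= limn_einf (fun t : nat => ((t%:R)^-1)%:E * elog (Qemp pi P Z t w G)))%E}.
Proof.
have up : {ae Pr, forall w, forall q : rat,
    ((ratr q)%:E < ereal_inf [set rateI P x | x in closure G])%E ->
    (limn_esup (fun t => ((t%:R)^-1)%:E * elog (Qemp pi P Z t w G)) <= (- ratr q)%:E)%E}.
  apply: ae_forall_rat => q.
  have [/limsup_bound|h] := pselect (((ratr q)%:E < ereal_inf [set rateI P x | x in closure G])%E).
    by apply: filterS.
  by apply: aeW => w /h.
have lo : {ae Pr, forall w, forall q : rat,
    (ereal_inf [set rateI P x | x in interior G] < (ratr q)%:E)%E ->
    ((- ratr q)%:E <= limn_einf (fun t => ((t%:R)^-1)%:E * elog (Qemp pi P Z t w G)))%E}.
  apply: ae_forall_rat => q.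
  have [/liminf_bound|h] := pselect ((ereal_inf [set rateI P x | x in interior G] < (ratr q)%:E)%E).
    by apply: filterS.
  by apply: aeW => w /h.
apply: filterS2 up lo => w hu hl; split.
  rewrite leNgt; apply/negP; rewrite lteNl => /ereal_rat_dense[q [h1 h2]].
  by have := hu q h2; rewrite EFinN leeNr leNgt h1.
rewrite leNgt; apply/negP; rewrite lteNr => /ereal_rat_dense[q [h1 h2]].
by have := hl q h1; rewrite EFinN leeNl leNgt h2.
Qed.

End Conclusion.

Theorem theorem1 (R : realType) (N : nat) (P : 'M[R]_N) (pi : 'rV[R]_N)
    (d : measure_display) (Omega : measurableType d) (Pr : probability Omega R)
    (Z : forall t : nat, t.-tuple 'I_N -> 'I_t -> Omega -> R) :
  row_stochastic P -> irreducible P -> aperiodic P ->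
  stationary_distribution P pi -> (forall i, 0 < pi 0 i) ->
  (forall a, Zdom pi P a -> std_normal_rv Pr (Zfam Z a)) ->
  mutually_independent Pr (Zdom pi P) (Zfam Z) ->
  forall G : set ('M[R]_N * 'rV[R]_N), borel_set G ->
  {ae Pr, forall omega : Omega,
     (limn_esup (fun t : nat => ((t%:R)^-1)%:E * elog (Qemp pi P Z t omega G))
        <= - ereal_inf [set rateI P x | x in closure G])%E
     /\
     (- ereal_inf [set rateI P x | x in interior G]
        <= limn_einf (fun t : nat => ((t%:R)^-1)%:E * elog (Qemp pi P Z t omega G)))%E}.
Proof.
case: N P pi Z => [|n] P pi Z [P0 P1] irr _ [_ [pi1 piP]] pi0 NZ indZ G _; last exact: ldp.
(* For N = 0 the empty sum of pi would have to be 1. *)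
by move: pi1; rewrite big_ord0 => /eqP; rewrite eq_sym oner_eq0.
Qed.
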